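(* Let $\widetilde Q$ be a probability distribution on $\mathbb{R}$ with $\int x\,\widetilde Q(dx)=0$, $\int x^2\,\widetilde Q(dx)=1$ and $\widetilde b:=\int x^4\,\widetilde Q(dx)<\infty$. For each $N\ge 1$ let $\widetilde X_N$ be the $N\times N$ real-symmetric Wigner matrix associated with $\widetilde Q$, let $\widetilde D_N(\lambda):=\det(\widetilde X_N-\lambda)$, and let $\widetilde f_N(\mu,\nu):=\mathbb{E}\big(\widetilde D_N(\mu)\widetilde D_N(\nu)\big)$ for $\mu,\nu\in\mathbb{R}$. Then for all $\mu,\nu\in\mathbb{R}$, $$\lim_{N\to\infty} d_N''\,\widetilde f_N\!\left(2\sqrt N+\mu/N^{1/6},\,2\sqrt N+\nu/N^{1/6}\right)=\exp\!\left(\tfrac{\widetilde b-3}{2}\right)\,\mathbb{B}(\mu,\nu),$$ where $$d_N'':=\left(\sqrt{2\pi}\,N!\,N^{1/2}\,\exp\!\big(2N+(\mu+\nu)N^{1/3}\big)\right)^{-1}$$ and $$\mathbb{B}(\mu,\nu):=\frac{(\mu+\nu)\,\mathrm{Ai}(\mu)\,\mathrm{Ai}(\nu)-2\,\mathrm{Ai}'(\mu)\,\mathrm{Ai}'(\nu)}{(\mu-\nu)^2}+\frac{2\,\mathrm{Ai}(\mu)\,\mathrm{Ai}'(\nu)-2\,\mathrm{Ai}'(\mu)\,\mathrm{Ai}(\nu)}{(\mu-\nu)^3},$$ understood by continuous extension when $\mu=\nu$.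
   Context: The $N\times N$ real-symmetric Wigner matrix $\widetilde X_N=(\widetilde X_{ij})_{i,j=1,\dots,N}$ associated with $\widetilde Q$ is defined by $\widetilde X_{ij}:=\widetilde X^{\mathrm{Re}}_{ij}$ for $i<j$, $\widetilde X_{ii}:=\sqrt2\,\widetilde X^{\mathrm{Re}}_{ii}$, and $\widetilde X_{ij}:=\widetilde X^{\mathrm{Re}}_{ji}$ for $i>j$, where $\{\widetilde X^{\mathrm{Re}}_{ij}: i\le j\}$ is a collection of i.i.d. real random variables with distribution $\widetilde Q$. Here $\det(\widetilde X_N-\lambda)$ means $\det(\widetilde X_N-\lambda I_N)$, $\mathbb{E}$ denotes expectation, and $\mathrm{Ai}$ denotes the Airy function. *)

(* Defs.v *)
From HB Require Import structures.
From mathcomp Require Import all_boot all_order all_algebra.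
From mathcomp Require Import all_classical all_reals all_analysis.

Set Implicit Arguments.
Unset Strict Implicit.
Unset Printing Implicit Defensive.

Import Order.TTheory GRing.Theory Num.Theory.
Import numFieldNormedType.Exports.

Local Open Scope classical_set_scope.
Local Open Scope ring_scope.

(* Mutual independence of the random variables [X i], [i] ranging over [D]:
   the product rule for every subfamily [J] of [D]. *)
Definition mutually_independent (d : measure_display) (T : measurableType d)
    (R : realType) (P : probability T R) (I : finType) (D : {set I})
    (X : I -> {RV P >-> R}) : Prop :=
  forall J : {set I}, J \subset D ->
  forall A : I -> set R, (forall i, measurable (A i)) ->
  P (\bigcap_(i in [set` J]) (X i @^-1` A i)) =
  (\prod_(i in J) P (X i @^-1` A i))%E.

Definition iid_with_law (d : measure_display) (T : measurableType d)
    (R : realType) (P : probability T R) (I : finType) (D : {set I})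
    (Q : probability R R) (X : I -> {RV P >-> R}) : Prop :=
  mutually_independent D X /\
  forall i, i \in D ->
  forall A : set R, measurable A -> distribution P (X i) A = Q A.

Definition upper_index (N : nat) : {set 'I_N * 'I_N} :=
  [set ij : 'I_N * 'I_N | (ij.1 <= ij.2)%N].

(* Only the entries [X (i, j)] with [i <= j] are used. *)
Definition wigner_mx (R : realType) (T : Type) (N : nat)
    (X : 'I_N * 'I_N -> T -> R) (w : T) : 'M[R]_N :=
  \matrix_(i, j) if (i < j)%N then X (i, j) w
                 else if i == j then Num.sqrt 2 * X (i, i) w
                 else X (j, i) w.

Definition char_det (R : realType) (N : nat) (M : 'M[R]_N) (lambda : R) : R :=
  \det (M - lambda%:M).

(* The integrand has degree at most 4 in each independent entry, so [fine] is
   harmless when the entries have a finite fourth moment. *)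
Definition second_corr (d : measure_display) (T : measurableType d)
    (R : realType) (P : probability T R) (N : nat)
    (X : 'I_N * 'I_N -> {RV P >-> R}) (mu nu : R) : R :=
  fine 'E_P[fun w => char_det (wigner_mx X w) mu *
                     char_det (wigner_mx X w) nu].

(* Ai(x) = (1 / pi) int_0^oo cos (t^3 / 3 + x t) dt, the integral being
   conditionally convergent (hence a limit of integrals over [0, r]). *)
Definition Airy (R : realType) (x : R) : R :=
  pi^-1 * lim ((\int[lebesgue_measure]_(t in `[0, r])
                  cos (t ^+ 3 / 3 + x * t)) @[r --> +oo]).

Definition dAiry (R : realType) (x : R) : R := derive1 (@Airy R) x.

Definition airy_kernel_offdiag (R : realType) (mu nu : R) : R :=
  ((mu + nu) * Airy mu * Airy nu - 2 * dAiry mu * dAiry nu)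
    / (mu - nu) ^+ 2
  + (2 * Airy mu * dAiry nu - 2 * dAiry mu * Airy nu)
    / (mu - nu) ^+ 3.

(* On the diagonal, the limit is taken jointly in both variables, along the
   points off the diagonal. *)
Definition airy_kernel (R : realType) (mu nu : R) : R :=
  if mu == nu then
    lim (airy_kernel_offdiag p.1 p.2
           @[p --> within [set p : R * R | p.1 != p.2] (nbhs (mu, nu))])
  else airy_kernel_offdiag mu nu.

Definition edge_norm (R : realType) (mu nu : R) (N : nat) : R :=
  (Num.sqrt (2 * pi) * (N`!)%:R * N%:R `^ (2^-1)
   * expR (2 * N%:R + (mu + nu) * N%:R `^ (3^-1)))^-1.

Definition edge_point (R : realType) (N : nat) (mu : R) : R :=
  2 * Num.sqrt N%:R + mu / N%:R `^ (6^-1).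

(* Main.v *)
(* Both determinants are at most quadratic in each independent entry, so their
   mean product only depends on the moments of order at most 4. Expanding along
   the first row and averaging over it gives a recursion on N in which the
   resolvent identity removes the adjugates; its solution is
     N! * sum_k ((b - 3) / 2)^k / k! * g_(N - 2 k),
     g_n = sum_(j <= n) (n + 1 - j) * j! * a_j(x) * a_j(y),   a_j = He_j / j!.
   Christoffel-Darboux summation expresses g_N through a_N and a_N' alone. On the
   circle of radius sqrt N * (1 - N^(-1/3)), which passes at distance N^(1/6) from
   the saddle point, Cauchy's integral for a_N converges by dominated convergence,
   after rescaling, to (1 / pi) * Re int_0^oo exp(i (z^3 / 3 + mu z)) dz along
   z = t + i; a contour shift identifies this with Ai(mu). The g_(N - 2 k)
   differ from g_N by O(k) times a sum bounded by the diagonal Hermite kernel,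
   which is negligible, so the weights sum to exp((b - 3) / 2). On the diagonal,
   the limit of the Airy kernel comes from its Taylor expansion in mu - nu, by
   the mean value theorem and Ai'' = x Ai. *)

Require Import Defs.
From HB Require Import structures.
From mathcomp Require Import all_boot all_order all_algebra.
From mathcomp Require Import all_fingroup.
From mathcomp Require Import all_classical all_reals all_analysis.
From mathcomp Require Import measurable_realfun.
From mathcomp Require Import ring lra zify.

Set Implicit Arguments.
Unset Strict Implicit.
Unset Printing Implicit Defensive.

Import Order.TTheory GRing.Theory Num.Theory.
Import numFieldNormedType.Exports.

Local Open Scope ring_scope.

(** * Bordered matrices and signed expectations *)

(** The average is made algebraic before anything is computed: a signed law on five points turns it
    into a finite sum, so linearity, conditioning on a minor and differentiation in the spectral
    parameter cost no integrability argument. Integrals enter only to show that the true mean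
    product is the same polynomial in the moments. Division by [y - x] in the resolvent identity
    forces the recursion to be solved for distinct parameters first; both sides being polynomials,
    the diagonal follows. At the edge the exponent of Cauchy's integral has a double saddle point.
    On the circle through it the limit integrand would be the purely oscillating Airy integrand,
    with no dominating function; moving inwards by one unit of the local scale [N^(1/6)] amounts to
    [Im z = 1] and yields the decay [exp(- t^2)]. With [k = N^(1/3)] the phases are exact
    polynomials in [1/k] and three rescaled trigonometric remainders, so no error terms are
    propagated. Derivatives of Hermite polynomials are corrected by the weight [exp(- x^2/4)], which
    cancels their dominant part. *)

Lemma det_bordered (R : comNzRingType) n (a : 'M[R]_1) (u : 'rV[R]_n)
    (v : 'cV[R]_n) (B : 'M[R]_n) :
  \det (block_mx a u v B) * \det B =
  (a 0 0 * \det B - (u *m \adj B *m v) 0 0) * \det B.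
Proof.
(* Multiplying on the right by this triangular matrix, of determinant [\det B], clears the block [v]
   by means of [B *m \adj B], so [B] need not be invertible. *)
have dl : \det (block_mx (\det B)%:M 0 (- (\adj B *m v)) 1%:M) = \det B.
  by rewrite det_lblock det1 mulr1 det_scalar1.
rewrite -[X in _ * X = _]dl -det_mulmx mulmx_block.
rewrite !mulmx0 !mulmx1 !add0r mulmxN mulmxN [v *m _]mul_mx_scalar.
rewrite (mulmxA B) mul_mx_adj mul_scalar_mx mul_mx_scalar subrr det_ublock.
by congr (_ * _); rewrite det_mx11 mulmxA !mxE mulrC.
Qed.

(** The extra factor of [det_bordered] is here the monic polynomial [char_poly A], which is nonzero
    and can be cancelled over a domain. *)
Lemma char_poly_bordered (R : idomainType) n (a : 'M[R]_1) (v : 'cV[R]_n)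
    (A : 'M[R]_n) :
  char_poly (block_mx a v^T v A : 'M[_]_(1 + n)) =
  ('X - (a 0 0)%:P) * char_poly A -
  ((map_mx polyC v)^T *m \adj (char_poly_mx A) *m map_mx polyC v) 0 0.
Proof.
have nz : \det (char_poly_mx A) != 0.
  by rewrite -/(char_poly A) monic_neq0 // char_poly_monic.
apply: (mulIf nz); rewrite /char_poly.
have -> : char_poly_mx (block_mx a v^T v A : 'M[_]_(1 + n)) =
    block_mx ('X%:M - map_mx polyC a) (- (map_mx polyC v)^T) (- map_mx polyC v)
      (char_poly_mx A).
  rewrite /char_poly_mx map_block_mx scalar_mx_block opp_block_mx add_block_mx.
  by rewrite !add0r map_trmx.
rewrite det_bordered; congr ((_ * _ - _) * _); first by rewrite !mxE.
by rewrite mulNmx mulmxN mulNmx opprK.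
Qed.

(** Jacobi's formula. Only the diagonal entries of [char_poly_mx] depend on the indeterminate, so
    differentiating the product of a permutation leaves one term per fixed point, and these are the
    terms of the diagonal cofactors. *)
Lemma tr_adj_char_poly_mx (R : comNzRingType) n (A : 'M[R]_n) :
  \tr (\adj (char_poly_mx A)) = (char_poly A)^`().
Proof.
have dprod (F : 'I_n -> {poly R}) s : uniq s ->
    (\prod_(i <- s) F i)^`() = \sum_(i <- s) (F i)^`() * \prod_(j <- s | i != j) F j.
  elim: s => [|x s IHs] /=; first by rewrite !big_nil -(polyC1 R) derivC.
  case/andP=> xs us; rewrite !big_cons derivM IHs // eqxx; congr (_ * _ + _).
    rewrite big_seq [RHS]big_seq_cond; apply: eq_bigl => j.
    by case: (boolP (j \in s)) => //= js; apply/esym/eqP => xj; rewrite xj js in xs.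
  rewrite mulr_sumr big_seq [RHS]big_seq; apply: eq_bigr => i si.
  rewrite big_cons ifT; last by apply: contraNneq xs => <-.
  by rewrite mulrCA.
rewrite /char_poly /(\det _) raddf_sum.
rewrite /mxtrace; under eq_bigr do rewrite mxE expand_cofactor.
rewrite (exchange_big_dep predT) //=; apply: eq_bigr => s _.
have -> (p : {poly R}) : ((-1) ^+ odd_perm s * p)^`() = (-1) ^+ odd_perm s * p^`().
  rewrite derivM; suff -> : ((-1) ^+ odd_perm s : {poly R})^`() = 0 by rewrite mul0r add0r.
  by case: (odd_perm s); rewrite ?expr0 ?expr1 ?derivN -?(polyC1 R) derivC ?oppr0.
rewrite dprod ?index_enum_uniq // mulr_sumr big_mkcond /=.
apply: eq_bigr => i _; rewrite !mxE eq_sym.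
case: eqP => [<-|_]; first by rewrite mulr1n derivB derivX derivC subr0 mul1r.
by rewrite mulr0n derivB -(polyC0 R) !derivC subrr mul0r mulr0.
Qed.

(** The resolvent times the characteristic polynomial: unlike the inverse it is defined at the
    eigenvalues and is polynomial in [x] and in the entries. *)
Definition rsv (R : comNzRingType) n (A : 'M[R]_n) (x : R) : 'M[R]_n := \adj (x%:M - A).

Section char_poly_eval.
Variables (R : idomainType) (n : nat).
Implicit Types (A : 'M[R]_n) (x y : R).

Lemma map_char_poly_mx_horner A x :
  map_mx (horner_eval x) (char_poly_mx A) = x%:M - A.
Proof.
apply/matrixP=> i j; rewrite !mxE /horner_eval !hornerE; congr (_ - _).
by case: (_ == _); rewrite ?mulr1n ?mulr0n ?hornerX ?horner0.
Qed.

Lemma horner_char_poly A x : (char_poly A).[x] = \det (x%:M - A).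
Proof.
by rewrite -[LHS]/(horner_eval x _) -det_map_mx map_char_poly_mx_horner.
Qed.

Lemma horner_adj_char_poly_mx A x i j :
  (\adj (char_poly_mx A) i j).[x] = rsv A x i j.
Proof.
by rewrite /rsv -map_char_poly_mx_horner -map_mx_adj [RHS]mxE.
Qed.

Lemma tr_rsv A x : \tr (rsv A x) = (char_poly A)^`().[x].
Proof.
rewrite -tr_adj_char_poly_mx /mxtrace horner_sum.
by apply: eq_bigr => i _; rewrite horner_adj_char_poly_mx.
Qed.

Lemma rsv_sym A x : A^T = A -> (rsv A x)^T = rsv A x.
Proof. by move=> sA; rewrite /rsv trmx_adj linearB /= tr_scalar_mx sA. Qed.

(* Resolvent identity, multiplied by both characteristic polynomials. *)
Lemma tr_rsv_mul A x y :
  (y - x) * \tr (rsv A x *m rsv A y) =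
  (char_poly A).[y] * (char_poly A)^`().[x]
  - (char_poly A).[x] * (char_poly A)^`().[y].
Proof.
rewrite -!tr_rsv !horner_char_poly -!mxtraceZ -linearB /=; congr (\tr _).
have -> : (y - x) *: (rsv A x *m rsv A y) =
    rsv A x *m ((y%:M - A) - (x%:M - A)) *m rsv A y.
  have -> : y%:M - A - (x%:M - A) = (y - x)%:M by rewrite opprB addrA subrK raddfB.
  by rewrite mul_mx_scalar -scalemxAl.
rewrite mulmxBr mulmxBl -mulmxA mul_mx_adj /rsv mul_adj_mx.
by rewrite mul_mx_scalar mul_scalar_mx.
Qed.

End char_poly_eval.

(** This closes the recursion on the size: the fourth cumulant weighs products of diagonal entries,
    and a diagonal cofactor is a characteristic polynomial of size one less. *)
Lemma rsv_diag (R : idomainType) n (A : 'M[R]_n.+1) x i :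
  rsv A x i i = (char_poly (row' i (col' i A))).[x].
Proof.
rewrite horner_char_poly /rsv mxE /cofactor addnn -signr_odd odd_double mul1r.
congr (\det _); apply/matrixP=> a b; rewrite !mxE.
by rewrite (inj_eq lift_inj).
Qed.

Lemma horner_char_poly_bordered (R : idomainType) n (a : 'M[R]_1)
    (v : 'cV[R]_n) (A : 'M[R]_n) x :
  (char_poly (block_mx a v^T v A : 'M[_]_(1 + n))).[x] =
  (x - a 0 0) * (char_poly A).[x] - \sum_i \sum_j rsv A x i j * v i 0 * v j 0.
Proof.
rewrite char_poly_bordered !hornerE; congr (_ - _).
rewrite mxE horner_sum exchange_big /=; apply: eq_bigr => j _.
rewrite hornerM mxE horner_sum [map_mx _ _ _ _]mxE hornerC mulr_suml.
apply: eq_bigr => i _; rewrite hornerM horner_adj_char_poly_mx mxE.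
by rewrite [map_mx _ _ _ _]mxE hornerC; congr (_ * _); rewrite mulrC.
Qed.

Lemma col_mx_ord0 (R : Type) n p (a : 'M[R]_(1, p)) (v : 'M[R]_(n, p)) j :
  (col_mx a v : 'M[_]_(1 + n, p)) ord0 j = a 0 j.
Proof. by have := col_mxEu a v 0 j; congr (col_mx _ _ _ _ = _); exact: val_inj. Qed.

Lemma col_mx_lift0 (R : Type) n p (a : 'M[R]_(1, p)) (v : 'M[R]_(n, p)) i j :
  (col_mx a v : 'M[_]_(1 + n, p)) (lift ord0 i) j = v i j.
Proof. by have := col_mxEd a v i j; congr (col_mx _ _ _ _ = _); exact: val_inj. Qed.

Lemma row_mx_ord0 (R : Type) n p (a : 'M[R]_(p, 1)) (v : 'M[R]_(p, n)) i :
  (row_mx a v : 'M[_]_(p, 1 + n)) i ord0 = a i 0.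
Proof. by have := row_mxEl a v i 0; congr (row_mx _ _ _ _ = _); exact: val_inj. Qed.

Lemma row_mx_lift0 (R : Type) n p (a : 'M[R]_(p, 1)) (v : 'M[R]_(p, n)) i j :
  (row_mx a v : 'M[_]_(p, 1 + n)) i (lift ord0 j) = v i j.
Proof. by have := row_mxEr a v i j; congr (row_mx _ _ _ _ = _); exact: val_inj. Qed.

Lemma row'_col'E (R : Type) m n (B : 'M[R]_(m.+1, n.+1)) i j a b :
  row' i (col' j B) a b = B (lift i a) (lift j b).
Proof. by rewrite !mxE. Qed.

Definition bordered (R : Type) n (a : R) (v : 'cV[R]_n) (A : 'M[R]_n) : 'M[R]_n.+1 :=
  block_mx (const_mx a : 'M[_]_1) v^T v A.

Section bordered.
Variables (R : Type) (n : nat) (a : R) (v : 'cV[R]_n) (A : 'M[R]_n).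

Lemma bordered00 : bordered a v A ord0 ord0 = a.
Proof. by rewrite /bordered /block_mx col_mx_ord0 row_mx_ord0 mxE. Qed.

Lemma bordered0S j : bordered a v A ord0 (lift ord0 j) = v j 0.
Proof. by rewrite /bordered /block_mx col_mx_ord0 row_mx_lift0 mxE. Qed.

Lemma borderedS0 i : bordered a v A (lift ord0 i) ord0 = v i 0.
Proof. by rewrite /bordered /block_mx col_mx_lift0 row_mx_ord0. Qed.

Lemma borderedSS i j : bordered a v A (lift ord0 i) (lift ord0 j) = A i j.
Proof. by rewrite /bordered /block_mx col_mx_lift0 row_mx_lift0. Qed.

Definition borderedE := (bordered00, bordered0S, borderedS0, borderedSS).

Lemma bordered_minor0 : row' ord0 (col' ord0 (bordered a v A)) = A.
Proof. by apply/matrixP => i j; rewrite row'_col'E borderedE. Qed.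

End bordered.

Lemma bordered_minorS (R : Type) n (a : R) (v : 'cV[R]_n.+1) (A : 'M[R]_n.+1) i :
  row' (lift ord0 i) (col' (lift ord0 i) (bordered a v A)) =
  bordered a (row' i v) (row' i (col' i A)).
Proof.
have l0 : lift (lift ord0 i) ord0 = ord0 by exact: val_inj.
have lS (j : 'I_n) : lift (lift ord0 i) (lift ord0 j) = lift ord0 (lift i j).
  by apply: val_inj; rewrite /= /bump /= !add1n ltnS addnS.
apply/matrixP => j k; rewrite row'_col'E.
by case: (unliftP ord0 j) => [j'|] ->; case: (unliftP ord0 k) => [k'|] ->;
   rewrite ?l0 ?lS !borderedE // ?row'_col'E // mxE.
Qed.

Lemma bordered_tr (R : Type) n (a : R) (v : 'cV[R]_n) (A : 'M[R]_n) :
  A^T = A -> (bordered a v A)^T = bordered a v A.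
Proof.
move=> sA; apply/matrixP => j k; rewrite mxE.
case: (unliftP ord0 j) => [j'|] ->; case: (unliftP ord0 k) => [k'|] ->;
  by rewrite !borderedE // -[in RHS]sA mxE.
Qed.

(** The factor [sqrt 2] on the diagonal is applied after sampling, so that all entries on and above
    the diagonal have the same law under [sym_esp]. *)
Definition scale_diag (R : nzRingType) (s : R) n (B : 'M[R]_n) : 'M[R]_n :=
  \matrix_(i, j) if i == j then s * B i j else B i j.

Lemma scale_diag_bordered (R : nzRingType) (s : R) n a (v : 'cV[R]_n) A :
  scale_diag s (bordered a v A) = bordered (s * a) v (scale_diag s A).
Proof.
apply/matrixP => j k; rewrite mxE.
case: (unliftP ord0 j) => [j'|] ->; case: (unliftP ord0 k) => [k'|] ->;
  rewrite ?eqxx !borderedE //.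
by rewrite (inj_eq lift_inj) mxE.
Qed.

Lemma scale_diag_tr (R : nzRingType) (s : R) n (B : 'M[R]_n) :
  B^T = B -> (scale_diag s B)^T = scale_diag s B.
Proof.
move=> sB; apply/matrixP => i j; rewrite !mxE eq_sym -[in RHS]sB mxE.
by case: eqP => // ->.
Qed.

Lemma scale_diag_minor (R : nzRingType) (s : R) n (B : 'M[R]_n.+1) i :
  row' i (col' i (scale_diag s B)) = scale_diag s (row' i (col' i B)).
Proof. by apply/matrixP => j k; rewrite row'_col'E !mxE (inj_eq lift_inj). Qed.

(* The weights may be negative: only finitely many moments of the law matter,
   so it can be replaced by a signed measure with finite support. *)
Section signed_expectation.
Variables (R : comNzRingType) (K : finType) (w e : K -> R).
Hypothesis w1 : \sum_k w k = 1.

Fixpoint vec_esp n : ('cV[R]_n -> R) -> R :=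
  match n with
  | 0 => fun phi => phi 0
  | m.+1 => fun phi =>
      \sum_k w k * vec_esp (fun v : 'cV_m => phi (col_mx (const_mx (e k) : 'M[_]_1) v))
  end.

(** The minor [A] is outermost: it is frozen while the corner and the first column are averaged, as
    in a conditional expectation. *)
Fixpoint sym_esp n : ('M[R]_n -> R) -> R :=
  match n with
  | 0 => fun phi => phi 0
  | m.+1 => fun phi => sym_esp (fun A : 'M[_]_m =>
      vec_esp (fun v => \sum_k w k * phi (bordered (e k) v A)))
  end.

Lemma vec_espS n (phi : 'cV[R]_n.+1 -> R) :
  vec_esp phi =
  \sum_k w k * vec_esp (fun v : 'cV_n => phi (col_mx (const_mx (e k) : 'M[_]_1) v)).
Proof. by []. Qed.

Lemma sym_espS n (phi : 'M[R]_n.+1 -> R) :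
  sym_esp phi = sym_esp (fun A : 'M[_]_n =>
      vec_esp (fun v => \sum_k w k * phi (bordered (e k) v A))).
Proof. by []. Qed.

Lemma eq_vec_esp n (f g : 'cV[R]_n -> R) : f =1 g -> vec_esp f = vec_esp g.
Proof.
elim: n f g => [|n IHn] f g fg /=; first by rewrite fg.
by apply: eq_bigr => k _; congr (_ * _); apply: IHn => v; rewrite fg.
Qed.

Lemma vec_esp_lin n c (f g : 'cV[R]_n -> R) :
  vec_esp (fun v => c * f v + g v) = c * vec_esp f + vec_esp g.
Proof.
elim: n f g => [|n IHn] f g //=.
rewrite mulr_sumr -big_split; apply: eq_bigr => k _ /=.
by rewrite IHn; ring.
Qed.

Lemma vec_esp0 n : vec_esp (fun _ : 'cV[R]_n => 0) = 0.
Proof.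
by elim: n => //= n IHn; apply: big1 => k _; rewrite IHn mulr0.
Qed.

Lemma vec_espZ n c (f : 'cV[R]_n -> R) : vec_esp (fun v => c * f v) = c * vec_esp f.
Proof.
rewrite -[RHS]addr0 -(vec_esp0 n) -vec_esp_lin.
by apply: eq_vec_esp => v; rewrite addr0.
Qed.

Lemma vec_espD n (f g : 'cV[R]_n -> R) :
  vec_esp (fun v => f v + g v) = vec_esp f + vec_esp g.
Proof.
by rewrite -[vec_esp f]mul1r -vec_esp_lin; apply: eq_vec_esp => v; rewrite mul1r.
Qed.

Lemma vec_esp_cst n c : vec_esp (fun _ : 'cV[R]_n => c) = c.
Proof.
elim: n => //= n IHn; under eq_bigr do rewrite IHn.
by rewrite -mulr_suml w1 mul1r.
Qed.

Lemma vec_esp_row' n (phi : 'cV[R]_n -> R) i :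
  vec_esp (fun v : 'cV[R]_n.+1 => phi (row' i v)) = vec_esp phi.
Proof.
elim: n phi i => [|n IHn] phi i.
  rewrite /=; under eq_bigr do rewrite [row' _ _](flatmx0 _) -[X in phi X](flatmx0 0).
  by rewrite -mulr_suml w1 mul1r.
case: (unliftP ord0 i) => [i'|] ->; last first.
  transitivity (\sum_k w k * vec_esp phi); last by rewrite -mulr_suml w1 mul1r.
  rewrite vec_espS; apply: eq_bigr => k _; congr (_ * _).
  apply: eq_vec_esp => v; congr phi; apply/matrixP => a b.
  by rewrite mxE (col_mx_lift0 (const_mx (e k) : 'M[_]_1) v).
rewrite [LHS]vec_espS [RHS]vec_espS; apply: eq_bigr => k _; congr (_ * _).
rewrite -(IHn _ i'); apply: eq_vec_esp => v; congr phi.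
apply/matrixP => a b; rewrite mxE.
case: (unliftP ord0 a) => [a'|] ->; last first.
  have -> : lift (lift ord0 i') ord0 = ord0 by exact: val_inj.
  by rewrite (col_mx_ord0 (const_mx (e k) : 'M[_]_1) v) col_mx_ord0.
have -> : lift (lift ord0 i') (lift ord0 a') = lift ord0 (lift i' a').
  by apply: val_inj; rewrite /= /bump /= !add1n ltnS addnS.
by rewrite (col_mx_lift0 (const_mx (e k) : 'M[_]_1) v) col_mx_lift0 mxE.
Qed.

(** Only symmetric matrices are ever built, so agreement there suffices; the symmetry of the
    resolvent becomes usable under the average. *)
Lemma eq_sym_esp n (f g : 'M[R]_n -> R) :
  (forall B, B^T = B -> f B = g B) -> sym_esp f = sym_esp g.
Proof.
elim: n f g => [|n IHn] f g fg /=; first by rewrite fg // trmx0.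
apply: IHn => A sA; apply: eq_vec_esp => v; apply: eq_bigr => k _.
by rewrite fg // bordered_tr.
Qed.

Lemma sym_esp_lin n c (f g : 'M[R]_n -> R) :
  sym_esp (fun v => c * f v + g v) = c * sym_esp f + sym_esp g.
Proof.
elim: n f g => [|n IHn] f g //=.
rewrite -IHn; apply: eq_sym_esp => A _; rewrite -vec_esp_lin.
apply: eq_vec_esp => v; rewrite mulr_sumr -big_split; apply: eq_bigr => k _ /=.
by ring.
Qed.

Lemma sym_esp0 n : sym_esp (fun _ : 'M[R]_n => 0) = 0.
Proof.
elim: n => //= n IHn; rewrite -[RHS]IHn; apply: eq_sym_esp => A _.
rewrite -[RHS](vec_esp0 n); apply: eq_vec_esp => v.
by apply: big1 => k _; rewrite mulr0.
Qed.

Lemma sym_espZ n c (f : 'M[R]_n -> R) : sym_esp (fun v => c * f v) = c * sym_esp f.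
Proof.
rewrite -[RHS]addr0 -(sym_esp0 n) -sym_esp_lin.
by apply: eq_sym_esp => v _; rewrite addr0.
Qed.

Lemma sym_espD n (f g : 'M[R]_n -> R) :
  sym_esp (fun v => f v + g v) = sym_esp f + sym_esp g.
Proof.
by rewrite -[sym_esp f]mul1r -sym_esp_lin; apply: eq_sym_esp => v _; rewrite mul1r.
Qed.

Lemma sym_esp_sum n (I : Type) (r : seq I) (P : pred I) (f : I -> 'M[R]_n -> R) :
  sym_esp (fun B => \sum_(i <- r | P i) f i B) = \sum_(i <- r | P i) sym_esp (f i).
Proof.
elim: r => [|i r IHr].
  by rewrite big_nil -[RHS](sym_esp0 n); apply: eq_sym_esp => B _; rewrite big_nil.
rewrite big_cons; case: ifP => Pi; rewrite -IHr.
  by rewrite -sym_espD; apply: eq_sym_esp => B _; rewrite big_cons Pi.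
by apply: eq_sym_esp => B _; rewrite big_cons Pi.
Qed.

(** Exchangeability of the indices: deleting the first row and column integrates them out with total
    weight 1, and any other index is reached one level deeper in the recursion. *)
Lemma sym_esp_minor n (phi : 'M[R]_n -> R) i :
  sym_esp (fun B : 'M[R]_n.+1 => phi (row' i (col' i B))) = sym_esp phi.
Proof.
have minor0 m (psi : 'M[R]_m -> R) :
    sym_esp (fun B : 'M[R]_m.+1 => psi (row' ord0 (col' ord0 B))) = sym_esp psi.
  rewrite [LHS]sym_espS; apply: eq_sym_esp => A _; rewrite -[RHS](@vec_esp_cst m).
  apply: eq_vec_esp => v; under eq_bigr do rewrite bordered_minor0.
  by rewrite -mulr_suml w1 mul1r.
elim: n phi i => [|n IHn] phi i; first by rewrite (ord1 i) minor0.
case: (unliftP ord0 i) => [i'|] ->; last exact: minor0.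
rewrite [RHS]sym_espS -(IHn _ i') [LHS]sym_espS; apply: eq_sym_esp => A _.
rewrite -(vec_esp_row' _ i'); apply: eq_vec_esp => v.
by apply: eq_bigr => k _; rewrite bordered_minorS.
Qed.

End signed_expectation.

Lemma sum_bordered (V : nmodType) n (F : 'I_n.+1 -> 'I_n.+1 -> V) :
  \sum_i \sum_j F i j =
  F ord0 ord0 + \sum_(i < n) (F ord0 (lift ord0 i) + F (lift ord0 i) ord0)
  + \sum_(i < n) \sum_(j < n) F (lift ord0 i) (lift ord0 j).
Proof.
rewrite big_ord_recl big_ord_recl /= big_split /= !addrA -addrA; congr (_ + _).
by rewrite -big_split /=; apply: eq_bigr => i _; rewrite big_ord_recl.
Qed.

(** * Moments of linear and quadratic forms in an independent column *)

Section column_moments.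
Variables (R : comNzRingType) (K : finType) (w e : K -> R) (b : R).
Hypothesis w1 : \sum_k w k = 1.
Hypothesis we : \sum_k w k * e k = 0.
Hypothesis we2 : \sum_k w k * e k ^+ 2 = 1.
Hypothesis we4 : \sum_k w k * e k ^+ 4 = b.

Definition linform n (u : 'I_n -> R) (v : 'cV[R]_n) := \sum_i u i * v i 0.
Definition quadform n (U : 'I_n -> 'I_n -> R) (v : 'cV[R]_n) :=
  \sum_i \sum_j U i j * v i 0 * v j 0.

Lemma linform_col n (u : 'I_n.+1 -> R) a (v : 'cV[R]_n) :
  linform u (col_mx (const_mx a : 'M[_]_1) v) =
  u ord0 * a + linform (fun i : 'I_n => u (lift ord0 i)) v.
Proof.
rewrite /linform big_ord_recl (col_mx_ord0 (const_mx a : 'M[_]_1) v) mxE.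
by congr (_ + _); apply: eq_bigr => i _; rewrite (col_mx_lift0 (const_mx a : 'M[_]_1) v).
Qed.

Lemma quadform_col n (U : 'I_n.+1 -> 'I_n.+1 -> R) a (v : 'cV[R]_n) :
  quadform U (col_mx (const_mx a : 'M[_]_1) v) =
  U ord0 ord0 * a ^+ 2
  + a * linform (fun i : 'I_n => U ord0 (lift ord0 i) + U (lift ord0 i) ord0) v
  + quadform (fun i j : 'I_n => U (lift ord0 i) (lift ord0 j)) v.
Proof.
have E0 j : (col_mx (const_mx a : 'M[_]_1) v : 'cV_(1 + n)) ord0 j = a.
  by rewrite col_mx_ord0 mxE.
have ES := col_mx_lift0 (const_mx a : 'M[_]_1) v.
rewrite /quadform big_ord_recl big_ord_recl E0.
under eq_bigr do rewrite ES.
under [X in _ + X]eq_bigr => i _.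
  rewrite big_ord_recl E0 ES; under eq_bigr do rewrite ES.
over.
rewrite big_split /=.
have -> : a * linform (fun i : 'I_n => U ord0 (lift ord0 i) + U (lift ord0 i) ord0) v =
    \sum_(i < n) U ord0 (lift ord0 i) * a * v i 0
    + \sum_(i < n) U (lift ord0 i) ord0 * v i 0 * a.
  rewrite /linform mulr_sumr -big_split /=; apply: eq_bigr => i _; ring.
by rewrite expr2 mulrA !addrA.
Qed.

Lemma vec_esp_linform n (u : 'I_n -> R) : vec_esp w e (linform u) = 0.
Proof.
elim: n u => [|n IHn] u; first by rewrite /= /linform big_ord0.
transitivity (u ord0 * \sum_k w k * e k); last by rewrite we mulr0.
rewrite vec_espS mulr_sumr; apply: eq_bigr => k _; rewrite mulrCA; congr (_ * _).
under eq_vec_esp do rewrite linform_col.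
by rewrite vec_espD vec_esp_cst // IHn addr0.
Qed.

Lemma vec_esp_linform2 n (u u' : 'I_n -> R) :
  vec_esp w e (fun v => linform u v * linform u' v) = \sum_i u i * u' i.
Proof.
elim: n u u' => [|n IHn] u u'; first by rewrite /= /linform !big_ord0 mulr0.
rewrite vec_espS big_ord_recl.
transitivity (\sum_k (w k * e k ^+ 2 * (u ord0 * u' ord0)
   + w k * \sum_(i < n) u (lift ord0 i) * u' (lift ord0 i))).
  apply: eq_bigr => k _; rewrite -mulrA -mulrDr; congr (_ * _).
  transitivity (vec_esp w e (fun v : 'cV_n => e k ^+ 2 * (u ord0 * u' ord0)
    + (u ord0 * e k * linform (fun i : 'I_n => u' (lift ord0 i)) v
    + (u' ord0 * e k * linform (fun i : 'I_n => u (lift ord0 i)) v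
    + linform (fun i : 'I_n => u (lift ord0 i)) v * linform (fun i : 'I_n => u' (lift ord0 i)) v)))).
    by apply: eq_vec_esp => v; rewrite !linform_col; ring.
  by rewrite vec_espD vec_esp_cst // vec_esp_lin vec_esp_lin !vec_esp_linform IHn; ring.
by rewrite big_split /= -!mulr_suml we2 w1 !mul1r.
Qed.

Lemma vec_esp_quadform n (U : 'I_n -> 'I_n -> R) :
  vec_esp w e (quadform U) = \sum_i U i i.
Proof.
elim: n U => [|n IHn] U; first by rewrite /= /quadform !big_ord0.
rewrite vec_espS big_ord_recl.
transitivity (\sum_k (w k * e k ^+ 2 * U ord0 ord0
   + w k * \sum_(i < n) U (lift ord0 i) (lift ord0 i))).
  apply: eq_bigr => k _; rewrite -mulrA -mulrDr; congr (_ * _).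
  under eq_vec_esp do rewrite quadform_col.
  rewrite !vec_espD vec_esp_cst // vec_espZ // vec_esp_linform // IHn; ring.
by rewrite big_split /= -!mulr_suml we2 w1 !mul1r.
Qed.

(** Wick's formula with a correction: the three pairings of a Gaussian column, and the fourth
    cumulant [b - 3] on coincident indices. The third moment multiplies only linear forms, whose
    mean is 0. *)
Lemma vec_esp_quadform2 n (U W : 'I_n -> 'I_n -> R) :
  vec_esp w e (fun v => quadform U v * quadform W v) =
  (\sum_i U i i) * (\sum_i W i i) + \sum_i \sum_j U i j * (W i j + W j i)
  + (b - 3) * \sum_i U i i * W i i.
Proof.
elim: n U W => [|n IHn] U W.
  by rewrite /= /quadform !big_ord0 !(mulr0, addr0).
pose U' (i j : 'I_n) := U (lift ord0 i) (lift ord0 j : 'I_n.+1).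
pose W' (i j : 'I_n) := W (lift ord0 i) (lift ord0 j : 'I_n.+1).
pose u (i : 'I_n) := U ord0 (lift ord0 i) + U (lift ord0 i) (ord0 : 'I_n.+1).
pose z (i : 'I_n) := W ord0 (lift ord0 i) + W (lift ord0 i) (ord0 : 'I_n.+1).
set U0 := U ord0 ord0; set W0 := W ord0 ord0.
rewrite vec_espS.
transitivity (vec_esp w e (fun v : 'cV_n => b * (U0 * W0)
  + (U0 * quadform W' v + (W0 * quadform U' v + (linform u v * linform z v
  + (quadform U' v * quadform W' v
  + (\sum_k w k * e k ^+ 3) * (U0 * linform z v + W0 * linform u v))))))).
  (* The average over the first entry is moved inside [vec_esp], so that the terms can be sorted by
     powers of [e k]. *)
  transitivity (vec_esp w e (fun v : 'cV_n => \sum_k w k *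
      (quadform U (col_mx (const_mx (e k) : 'M[_]_1) v) *
       quadform W (col_mx (const_mx (e k) : 'M[_]_1) v)))).
    elim: (index_enum K) => [|k r IHr].
      by rewrite big_nil -[LHS](vec_esp0 w e n); apply: eq_vec_esp => v; rewrite big_nil.
    rewrite big_cons IHr -vec_esp_lin.
    by apply: eq_vec_esp => v; rewrite big_cons.
  apply: eq_vec_esp => v.
  transitivity (\sum_k (w k * e k ^+ 4 * (U0 * W0)
    + w k * e k ^+ 3 * (U0 * linform z v + W0 * linform u v)
    + w k * e k ^+ 2 *
      (U0 * quadform W' v + W0 * quadform U' v + linform u v * linform z v)
    + w k * e k * (linform u v * quadform W' v + linform z v * quadform U' v)
    + w k * (quadform U' v * quadform W' v))).
    by apply: eq_bigr => k _; rewrite !quadform_col -/U' -/W' -/u -/z -/U0 -/W0; ring.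
  by rewrite !big_split /= -!mulr_suml we4 we2 we w1; ring.
rewrite vec_espD vec_esp_cst // !vec_esp_lin vec_espD vec_espD vec_espZ // vec_esp_lin.
rewrite vec_espZ // !vec_esp_linform !vec_esp_quadform vec_esp_linform2 IHn.
rewrite [\sum_(i < n.+1) U i i]big_ord_recl [\sum_(i < n.+1) W i i]big_ord_recl.
rewrite [\sum_(i < n.+1) U i i * W i i]big_ord_recl.
have -> : \sum_(i < n.+1) \sum_(j < n.+1) U i j * (W i j + W j i) =
    U0 * W0 *+ 2 + \sum_i u i * z i + \sum_i \sum_j U' i j * (W' i j + W' j i).
  rewrite sum_bordered -/U0 -/W0; congr (_ + _ + _); first by ring.
  by apply: eq_bigr => i _; rewrite /u /z; ring.
rewrite -/U0 -/W0 -/U' -/W'; rewrite /U' /W'; ring.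
Qed.

End column_moments.

(** * Hermite polynomials and the recursion on the size *)

(* [hermite_fact n] is He_n / n!, with He_n monic (probabilists' convention). *)
Fixpoint hermite_fact (R : fieldType) n : {poly R} :=
  match n with
  | 0 => 1
  | m.+1 => match m with
    | 0 => 'X
    | k.+1 => (m.+1%:R)^-1 *: ('X * hermite_fact R m - hermite_fact R k)
    end
  end.

Section hermite.
Variable R : numFieldType.
Local Notation a := (hermite_fact R).

Lemma hermite_factSS n : n.+2%:R *: a n.+2 = 'X * a n.+1 - a n.
Proof. by rewrite [a n.+2]/= scalerA divff ?scale1r // pnatr_eq0. Qed.

(** Dividing by the factorial turns the derivative into a plain shift of the index; this is how
    derivatives are later read off circle integrals. *)
Lemma deriv_hermite_fact n : (a n.+1)^`() = a n.
Proof.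
elim/ltn_ind: n => -[_|[_|n IHn]]; first by rewrite /= derivX.
  have n2 : 2%:R != 0 :> R by rewrite pnatr_eq0.
  apply: (scalerI n2); rewrite -derivZ hermite_factSS derivB derivM derivX.
  by rewrite /= -(polyC1 R) derivC subr0 polyC1 mul1r mulr1 scaler_nat.
have n3 : n.+3%:R != 0 :> R by rewrite pnatr_eq0.
apply: (scalerI n3); rewrite -derivZ hermite_factSS derivB derivM derivX.
rewrite IHn // IHn; last by rewrite ltnW.
by rewrite mul1r -addrA -hermite_factSS -{1}[a n.+2]scale1r -scalerDl nat1r.
Qed.

Lemma hermite_fact_raise n : n.+1%:R *: a n.+1 = 'X * a n - (a n)^`().
Proof.
case: n => [|n]; last by rewrite deriv_hermite_fact hermite_factSS.
by rewrite /= -(polyC1 R) derivC subr0 polyC1 scale1r mulr1.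
Qed.

Lemma hermite_fact_raise_horner n x :
  n.+1%:R * (a n.+1).[x] = x * (a n).[x] - (a n)^`().[x].
Proof. by rewrite -hornerZ hermite_fact_raise !hornerE. Qed.

Lemma hermite_fact_rec n x :
  n.+2%:R * (a n.+2).[x] = x * (a n.+1).[x] - (a n).[x].
Proof. by rewrite hermite_fact_raise_horner deriv_hermite_fact. Qed.

(** Written with derivatives, the right-hand side has the same antisymmetric form as that of
    [tr_rsv_mul]: this match is why averaged resolvent traces become partial sums of Hermite
    products. *)
Lemma christoffel_darboux n x y :
  (x - y) * \sum_(j < n) j`!%:R * (a j).[x] * (a j).[y] =
  n`!%:R * ((a n).[x] * (a n)^`().[y] - (a n)^`().[x] * (a n).[y]).
Proof.
elim: n => [|n IHn].
  have -> : (a 0)^`() = 0 by rewrite /= -(polyC1 R) derivC.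
  by rewrite big_ord0 !horner0; ring.
rewrite big_ord_recr /= mulrDr IHn !deriv_hermite_fact factS natrM.
have := hermite_fact_raise_horner n x; have := hermite_fact_raise_horner n y.
move: (n`!%:R : R) => c hx hy.
transitivity (c * ((x * (a n).[x] - (a n)^`().[x]) * (a n).[y]
   - (a n).[x] * (y * (a n).[y] - (a n)^`().[y]))); first by ring.
by rewrite -hx -hy; ring.
Qed.

(** In characteristic 0 the points [y + 1], [y + 2], ... are pairwise distinct, more of them than
    any degree. The lemma restores the point [y] lost in a division by [x - y]. *)
Lemma poly_eq_off_point (p q : {poly R}) y :
  (forall x, x != y -> p.[x] = q.[x]) -> p = q.
Proof.
move=> pq; apply/eqP; rewrite -subr_eq0; set r := p - q.
apply/eqP/(@roots_geq_poly_eq0 _ r [seq y + i.+1%:R | i <- iota 0 (size r)]).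
- apply/allP => _ /mapP[i _ ->]; rewrite /root /r !hornerE pq ?subrr //.
  by rewrite -subr_eq0 addrC addKr pnatr_eq0.
- rewrite map_inj_uniq ?iota_uniq // => i j /addrI /eqP.
  by rewrite eqr_nat => /eqP[].
- by rewrite size_map size_iota.
Qed.

End hermite.

(** * The recursion on the size and its solution *)

Section determinant_moment.
Variables (R : numFieldType) (K : finType) (w e : K -> R) (b s : R).
Hypothesis w1 : \sum_k w k = 1.
Hypothesis we : \sum_k w k * e k = 0.
Hypothesis we2 : \sum_k w k * e k ^+ 2 = 1.
Hypothesis we4 : \sum_k w k * e k ^+ 4 = b.
Hypothesis s2 : s ^+ 2 = 2.
Local Notation a := (hermite_fact R).
Local Notation esp := (sym_esp w e).
Local Notation cp B := (char_poly (scale_diag s B)).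

Definition det_moment n x y : R := esp (fun B : 'M[_]_n => (cp B).[x] * (cp B).[y]).

(** The average of a polynomial is taken coefficientwise, hence is a polynomial in the parameter;
    this justifies both the extension across one point and the exchange with the derivative. *)
Lemma esp_horner n (P : 'M[R]_n -> {poly R}) (g : 'M[R]_n -> R) m x :
  (forall B, (size (P B) <= m)%N) ->
  esp (fun B => (P B).[x] * g B) = (\poly_(i < m) esp (fun B => (P B)`_i * g B)).[x].
Proof.
move=> sP; rewrite horner_poly.
transitivity (\sum_(i < m) esp (fun B => x ^+ i * ((P B)`_i * g B))).
  rewrite -sym_esp_sum; apply: eq_sym_esp => B _.
  rewrite (horner_coef_wide _ (sP B)) mulr_suml.
  by apply: eq_bigr => i _; ring.
by apply: eq_bigr => i _; rewrite sym_espZ mulrC.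
Qed.

Lemma esp_horner_off_point n (P : 'M[R]_n -> {poly R}) (g : 'M[R]_n -> R) m q y :
  (forall B, (size (P B) <= m)%N) ->
  (forall x, x != y -> esp (fun B => (P B).[x] * g B) = q.[x]) ->
  forall x, esp (fun B => (P B).[x] * g B) = q.[x].
Proof.
move=> sP Pq x; rewrite (esp_horner _ _ sP); congr (_.[x]).
by apply: (@poly_eq_off_point _ _ _ y) => z zy; rewrite -esp_horner // Pq.
Qed.

Lemma esp_deriv n (P : 'M[R]_n -> {poly R}) (g : 'M[R]_n -> R) m q :
  (forall B, (size (P B) <= m)%N) ->
  (forall x, esp (fun B => (P B).[x] * g B) = q.[x]) ->
  forall x, esp (fun B => (P B)^`().[x] * g B) = q^`().[x].
Proof.
move=> sP Pq x.
(* [q] is determined by its values, so it is the coefficientwise average. *)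
have -> : q = \poly_(i < m) esp (fun B => (P B)`_i * g B).
  by apply: (@poly_eq_off_point _ _ _ 0) => z _; rewrite -esp_horner // Pq.
have sP' B : (size (P B)^`() <= m)%N.
  apply/leq_sizeP => j mj; rewrite coef_deriv nth_default ?mul0rn //.
  by rewrite (leq_trans (sP B)) // leqW.
rewrite (esp_horner _ _ sP'); congr (_.[x]); apply/polyP => i.
rewrite coef_deriv !coef_poly.
case: ltnP => im.
  case: ltnP => im1.
    by rewrite -mulr_natl -sym_espZ; apply: eq_sym_esp => B _; rewrite coef_deriv; ring.
  rewrite mul0rn -[RHS](sym_esp0 w e n); apply: eq_sym_esp => B _.
  by rewrite coef_deriv nth_default ?mul0rn ?mul0r // (leq_trans (sP B)).
by rewrite ltnNge (leq_trans im) // mul0rn.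
Qed.

(** With the minor frozen, each factor is [(x - s a) p - v^T U v]. The mean of [v^T U v] is the
    trace [p'], the corner adds [s ^+ 2 = 2], the pairings add [2 \tr (U W)] since [W] is symmetric,
    and the cumulant term averages over the [n] principal minors. *)
Lemma det_moment_step n x y :
  det_moment n.+1 x y =
  esp (fun B : 'M[_]_n => (x * (cp B).[x] - (cp B)^`().[x]) *
                       (y * (cp B).[y] - (cp B)^`().[y])
     + 2 * ((cp B).[x] * (cp B).[y])
     + 2 * \tr (rsv (scale_diag s B) x *m rsv (scale_diag s B) y))
  + (b - 3) * (n%:R * det_moment n.-1 x y).
Proof.
have -> : n%:R * det_moment n.-1 x y =
    esp (fun B : 'M[_]_n => \sum_i rsv (scale_diag s B) x i i * rsv (scale_diag s B) y i i).
  rewrite sym_esp_sum /det_moment; case: n => [|n]; first by rewrite big_ord0 mul0r.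
  transitivity (\sum_(i < n.+1) det_moment n x y).
    by rewrite sumr_const card_ord mulr_natl.
  apply: eq_bigr => i _; rewrite -[LHS](sym_esp_minor e w1 _ i).
  by apply: eq_sym_esp => B _; rewrite !rsv_diag scale_diag_minor.
rewrite /det_moment sym_espS addrC -sym_esp_lin; apply: eq_sym_esp => A sA.
set U := rsv _ x; set W := rsv _ y; set p := (cp A).[x]; set q := (cp A).[y].
have trE z : (cp A)^`().[z] = \sum_i rsv (scale_diag s A) z i i.
  by rewrite -tr_rsv.
rewrite !trE -/U -/W.
transitivity (vec_esp w e (fun v : 'cV_n => (x * y + 2) * (p * q)
   + ((- (x * p)) * quadform W v + ((- (y * q)) * quadform U v
   + quadform U v * quadform W v)))).
  apply: eq_vec_esp => v.
  transitivity (\sum_k (w k * ((x * p - quadform U v) * (y * q - quadform W v))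
    - w k * e k * (s * (p * (y * q - quadform W v) + q * (x * p - quadform U v)))
    + w k * e k ^+ 2 * (s ^+ 2 * (p * q)))).
    apply: eq_bigr => k _; rewrite scale_diag_bordered /bordered.
    rewrite !horner_char_poly_bordered !mxE -/U -/W -/p -/q.
    rewrite -!/(quadform _ _); ring.
  rewrite !big_split /= sumrN -!mulr_suml w1 we we2 s2; ring.
rewrite vec_espD vec_esp_cst // !vec_esp_lin !vec_esp_quadform //.
rewrite (vec_esp_quadform2 w1 we we2 we4).
have -> : \sum_i \sum_j U i j * (W i j + W j i) = 2 * \tr (U *m W).
  have sW : W^T = W by apply: rsv_sym; apply: scale_diag_tr.
  rewrite /mxtrace mulr_sumr; apply: eq_bigr => i _; rewrite mxE mulr_sumr.
  apply: eq_bigr => j _; have -> : W i j = W j i by rewrite -[in LHS]sW mxE.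
  ring.
ring.
Qed.

(** The weight of [j! a_j(x) a_j(y)] in the solution. Truncated subtraction kills the terms with
    [2 k > n], so the range of [k] can be enlarged at will. *)
Definition moment_coef n j : R :=
  \sum_(k < n.+1) ((b - 3) / 2) ^+ k / k`!%:R * (n.+1 - k.*2 - j)%:R.

Lemma moment_coef_wide n j M : (n < M)%N -> moment_coef n j =
  \sum_(k < M) ((b - 3) / 2) ^+ k / k`!%:R * (n.+1 - k.*2 - j)%:R.
Proof.
move=> nM; rewrite /moment_coef.
rewrite (big_ord_widen M (fun k => ((b - 3) / 2) ^+ k / k`!%:R * (n.+1 - k.*2 - j)%:R)) //.
rewrite big_mkcond; apply: eq_bigr => k _; case: ifPn => //; rewrite -leqNgt => nk.
by rewrite (_ : _ - _ - _ = 0)%N ?mulr0 //; lia.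
Qed.

Lemma moment_coef_eq0 n j : (n < j)%N -> moment_coef n j = 0.
Proof.
move=> nj; apply: big1 => k _.
by rewrite (_ : _ - _ - _ = 0)%N ?mulr0 //; lia.
Qed.

(** Comparison of the coefficients of [j! a_j(x) a_j(y)] in [det_moment_step]. For each [k] it is an
    identity of natural numbers: the factor [n + 1] splits into [2 k], supplied by the cumulant
    term, and [n + 1 - 2 k], supplied by the other two. *)
Lemma moment_coef_rec n i : (i <= n.+1)%N ->
  n.+1%:R * moment_coef n.+1 i =
  (if i is i'.+1 then i%:R * moment_coef n i' else 0)
  + 2 * (\sum_(i <= j < n.+1) moment_coef n j)
  + (b - 3) * (if n is n'.+1 then moment_coef n' i else 0).
Proof.
move=> le_in; set bs := (b - 3) / 2.
(* A triangular number, doubled to stay in [nat]; the terms with [j >= m] vanish by truncation. *)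
have sumE m M : (m <= M)%N ->
    (2 * \sum_(i <= j < M) (m - j) = (m - i) * (m.+1 - i))%N.
  move=> mM; case: (leqP i M) => [iM|Mi]; last first.
    have -> : (m - i = 0)%N by apply/eqP; rewrite subn_eq0 (leq_trans mM) // ltnW.
    by rewrite big_geq ?muln0 ?mul0n // ltnW.
  move: (M - i)%N (subnK iM) => d; elim: d i {iM le_in} => [|d IHd] i iM.
    have -> : (m - i = 0)%N by apply/eqP; rewrite subn_eq0 -[i]add0n iM.
    by rewrite big_geq ?muln0 ?mul0n // -iM.
  rewrite big_ltn; last by rewrite -iM addSn ltnS leq_addl.
  rewrite mulnDr IHd; last by rewrite addnS -addSn.
  case: (leqP m i) => mi.
    have -> : (m - i = 0)%N by apply/eqP; rewrite subn_eq0.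
    have -> : (m - i.+1 = 0)%N by apply/eqP; rewrite subn_eq0 leqW.
    by rewrite !mul0n muln0.
  have mi' : (m - i = (m - i.+1).+1)%N by rewrite subnSK.
  rewrite subSS (subSn (ltnW mi)) !mi' -mulnDl mulnC.
  by rewrite addnC addn2.
have term m : (m <= n.+1)%N ->
   (m * (m.+1 - i) = (if i is i'.+1 then i * (m - i') else 0)
    + 2 * \sum_(i <= j < n.+1) (m - j))%N.
  by move=> mn; rewrite sumE //; case: (i) le_in => [|i'] le_in; nia.
pose c k := bs ^+ k / k`!%:R.
have -> : (if n is n'.+1 then moment_coef n' i else 0) =
    \sum_(k < n.+1) c k * (n - k.*2 - i)%:R.
  case: (n) => [|n'].
    by rewrite big_ord_recl big_ord0 mulr0 addr0.
  by rewrite (@moment_coef_wide n' i n'.+2).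
(* Since [b - 3 = 2 * bs], the factor [bs] raises [k] by one, and the change of factorial leaves the
   factor [2 * k.+1], which is [k.*2] at the new index. *)
have -> : (b - 3) * (\sum_(k < n.+1) c k * (n - k.*2 - i)%:R) =
    \sum_(k < n.+2) c k * (k.*2 * (n.+2 - k.*2 - i))%:R.
  rewrite [RHS]big_ord_recl /= double0 mul0n mulr0 add0r mulr_sumr; apply: eq_bigr => k _.
  rewrite /bump add1n (_ : n.+2 - k.+1.*2 - i = n - k.*2 - i)%N; last by lia.
  rewrite natrM /c exprS factS natrM -(muln2 k.+1) natrM.
  have k1 : k.+1%:R != 0 :> R by rewrite pnatr_eq0.
  have kf : k`!%:R != 0 :> R by rewrite pnatr_eq0 -lt0n fact_gt0.
  by rewrite /bs; field; rewrite kf nat1r k1.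
have -> : (if i is i'.+1 then i%:R * moment_coef n i' else 0) =
    \sum_(k < n.+2) c k * (if i is i'.+1 then i * (n.+1 - k.*2 - i') else 0)%:R.
  case: (i) => [|i'].
    by rewrite big1 // => k _; rewrite mulr0.
  rewrite (@moment_coef_wide n i' n.+2) // mulr_sumr.
  by apply: eq_bigr => k _; rewrite natrM /c; ring.
have -> : \sum_(i <= j < n.+1) moment_coef n j =
    \sum_(k < n.+2) c k * (\sum_(i <= j < n.+1) (n.+1 - k.*2 - j))%:R.
  under eq_bigr do rewrite (@moment_coef_wide n _ n.+2) //.
  rewrite exchange_big; apply: eq_bigr => k _ /=.
  by rewrite natr_sum mulr_sumr.
rewrite !mulr_sumr -!big_split /=; apply: eq_bigr => k _ /=.
transitivity (c k * (n.+1 * (n.+2 - k.*2 - i))%:R); first by rewrite natrM /c -/bs; ring.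
rewrite mulrCA -mulrDr -mulrDr; congr (_ * _).
rewrite -natrM -!natrD; congr (_%:R).
rewrite -term; last by lia.
case: (leqP k.*2 n.+1) => kn; last by rewrite (_ : n.+2 - k.*2 - i = 0)%N; lia.
by rewrite (subSn kn) -mulnDl subnK.
Qed.

(** The recursion preserves combinations of [j! a_j(x) a_j(y)]: the operator [x p - p'] raises the
    Hermite index in each variable, and the trace term becomes a Christoffel-Darboux sum. The
    resolvent identity gives the latter only after multiplication by [y - z], so the formula is
    proved for [z != y] and then extended. *)
Lemma det_moment_formula n x y :
  det_moment n x y =
  n`!%:R * \sum_(j < n.+1) moment_coef n j * (j`!%:R * (a j).[x] * (a j).[y]).
Proof.
have sP m (B : 'M[R]_m) : (size (cp B) <= m.+1)%N by rewrite size_char_poly.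
elim/ltn_ind: n x y => -[_|n IHn] x y.
  rewrite /det_moment /= /char_poly !det_mx00 fact0 big_ord_recl big_ord0 addr0.
  rewrite /moment_coef big_ord_recl big_ord0 /= !hornerE fact0 invr1.
  by do ![rewrite [RHS]mulr1 | rewrite [RHS]mul1r].
(* The induction hypothesis as a bilinear form; averages involving derivatives follow by
   differentiating it in either argument. *)
pose T (u v : nat -> R) :=
  \sum_(j < n.+1) n`!%:R * moment_coef n j * j`!%:R * u j * v j.
have T00 z t : esp (fun B : 'M[_]_n => (cp B).[z] * (cp B).[t]) =
    T (fun j => (a j).[z]) (fun j => (a j).[t]).
  rewrite -[LHS]/(det_moment n z t) IHn // mulr_sumr.
  by apply: eq_bigr => j _; ring.
have T10 z t : esp (fun B : 'M[_]_n => (cp B)^`().[z] * (cp B).[t]) =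
    T (fun j => (a j)^`().[z]) (fun j => (a j).[t]).
  pose q := \sum_(j < n.+1) (n`!%:R * moment_coef n j * j`!%:R * (a j).[t]) *: a j.
  rewrite (@esp_deriv _ _ _ n.+1 q) => [||u]; last first.
  - by rewrite T00 /q horner_sum; apply: eq_bigr => j _; rewrite !hornerE; ring.
  - exact: sP.
  - rewrite /q raddf_sum /= horner_sum; apply: eq_bigr => j _.
    by rewrite derivZ !hornerE; ring.
have T01 z t : esp (fun B : 'M[_]_n => (cp B).[z] * (cp B)^`().[t]) =
    T (fun j => (a j).[z]) (fun j => (a j)^`().[t]).
  rewrite [RHS](_ : _ = T (fun j => (a j)^`().[t]) (fun j => (a j).[z])).
    by rewrite -T10; apply: eq_sym_esp => B _; rewrite mulrC.
  by apply: eq_bigr => j _; ring.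
have T11 z t : esp (fun B : 'M[_]_n => (cp B)^`().[z] * (cp B)^`().[t]) =
    T (fun j => (a j)^`().[z]) (fun j => (a j)^`().[t]).
  pose q := \sum_(j < n.+1) (n`!%:R * moment_coef n j * j`!%:R * (a j)^`().[t]) *: a j.
  rewrite (@esp_deriv _ _ _ n.+1 q) => [||u]; last first.
  - by rewrite T01 /q horner_sum; apply: eq_bigr => j _; rewrite !hornerE; ring.
  - exact: sP.
  - rewrite /q raddf_sum /= horner_sum; apply: eq_bigr => j _.
    by rewrite derivZ !hornerE; ring.
pose h z j := j`!%:R * (a j).[z] * (a j).[y].
have rhsE z : n.+1`!%:R * (\sum_(j < n.+2) moment_coef n.+1 j * h z j) =
  n`!%:R * ((\sum_(j < n.+1) moment_coef n j * (j.+1%:R * h z j.+1))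
   + 2 * (\sum_(j < n.+1) moment_coef n j * h z j)
   + 2 * (\sum_(j < n.+1) moment_coef n j * \sum_(i < j) h z i)
   + (b - 3) * (if n is n'.+1 then \sum_(j < n) moment_coef n' j * h z j else 0)).
  rewrite factS mulnC natrM -mulrA; congr (_ * _); rewrite mulr_sumr.
  under eq_bigr => i _ do rewrite mulrA (@moment_coef_rec n i (ltn_ord i)) 2!mulrDl.
  rewrite !big_split /= -[X in _ = X + _]addrA; congr (_ + _ + _).
  - rewrite big_ord_recl mul0r add0r; apply: (@eq_bigr _ _ _ 'I_n.+1) => j _; rewrite /= /bump add1n; ring.
  (* The pairs [i <= j] consist of [i = j], which comes from the corner term, and [i < j], which
     comes from the trace. *)
  - transitivity (\sum_(j < n.+1) \sum_(i < n.+2 | (i <= j)%N) 2 * (moment_coef n j * h z i)).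
      rewrite (exchange_big_dep predT) //=; apply: eq_bigr => i _.
      rewrite big_geq_mkord mulr_sumr mulr_suml; apply: eq_bigr => j _.
      by rewrite mulrA.
    rewrite -mulrDr -big_split /= mulr_sumr; apply: eq_bigr => j _.
    rewrite -!mulr_sumr -mulrDr addrC; congr (_ * (_ * _)).
    have -> : \sum_(i < j) h z i + h z j = \sum_(i < j.+1) h z i by rewrite big_ord_recr.
    rewrite (big_ord_widen n.+2 (fun i => h z i)); last by rewrite ltnS ltnW.
    by apply: eq_bigl => i; rewrite ltnS.
  - case: (n) => [|n'].
      by rewrite mulr0; apply: big1 => i _; rewrite mul0r.
    rewrite mulr_sumr big_ord_recr big_ord_recr /= !moment_coef_eq0 //.
    by rewrite !mulr0 !mul0r !addr0; apply: eq_bigr => i _; rewrite mulrA.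
have main z : z != y -> det_moment n.+1 z y = n.+1`!%:R * \sum_(j < n.+2)
    moment_coef n.+1 j * (j`!%:R * (a j).[z] * (a j).[y]).
  move=> zy; have yz : y - z != 0 by rewrite subr_eq0 eq_sym.
  rewrite (rhsE z) det_moment_step !sym_espD !sym_espZ.
  have -> : esp (fun B : 'M[_]_n => \tr (rsv (scale_diag s B) z *m rsv (scale_diag s B) y)) =
      n`!%:R * \sum_(j < n.+1) moment_coef n j * \sum_(i < j) h z i.
    apply: (mulfI yz); rewrite -sym_espZ.
    under eq_sym_esp do rewrite tr_rsv_mul.
    transitivity (esp (fun B : 'M[_]_n => (cp B)^`().[z] * (cp B).[y])
       + (-1) * esp (fun B : 'M[_]_n => (cp B).[z] * (cp B)^`().[y])).
      by rewrite -sym_espZ -sym_espD; apply: eq_sym_esp => B _; ring.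
    rewrite T10 T01 /T !mulr_sumr -big_split; apply: eq_bigr => j _.
    have := christoffel_darboux j z y.
    rewrite -/(h z _) => cd.
    transitivity (n`!%:R * moment_coef n j * - ((z - y) * \sum_(i < j) h z i)); last by ring.
    by rewrite cd /=; ring.
  have -> : esp (fun B : 'M[_]_n => (z * (cp B).[z] - (cp B)^`().[z]) *
       (y * (cp B).[y] - (cp B)^`().[y])) =
      n`!%:R * \sum_(j < n.+1) moment_coef n j * (j.+1%:R * h z j.+1).
    transitivity (z * y * T (fun j => (a j).[z]) (fun j => (a j).[y])
      + ((- z) * T (fun j => (a j).[z]) (fun j => (a j)^`().[y])
      + ((- y) * T (fun j => (a j)^`().[z]) (fun j => (a j).[y])
      + T (fun j => (a j)^`().[z]) (fun j => (a j)^`().[y])))).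
      rewrite -T00 -T01 -T10 -T11 -!sym_esp_lin.
      by apply: eq_sym_esp => B _; ring.
    rewrite /T !mulr_sumr -!big_split; apply: eq_bigr => j _ /=.
    transitivity (n`!%:R * moment_coef n j * j`!%:R *
        (j.+1%:R * (a j.+1).[z]) * (j.+1%:R * (a j.+1).[y])).
      by rewrite !hermite_fact_raise_horner; ring.
    by rewrite /h factS natrM; ring.
  rewrite T00 /T.
  have -> : n%:R * det_moment n.-1 z y = n`!%:R *
     (if n is n'.+1 then \sum_(j < n) moment_coef n' j * h z j else 0).
    case: (n) IHn => [|n'] IHn; first by rewrite mul0r mulr0.
    by rewrite IHn // mulrA -natrM.
  rewrite !mulrDr; congr (_ + _ + _ + _); last 2 first.
  - exact: mulrCA.
  - exact: mulrCA.
  rewrite mulrCA; congr (_ * _); rewrite mulr_sumr.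
  by apply: eq_bigr => j _; rewrite /h; ring.
(* For fixed [y] the formula is a polynomial in the other argument, so agreement off [y] is
   enough. *)
pose q := n.+1`!%:R *: \sum_(j < n.+2)
    (moment_coef n.+1 j * (j`!%:R * (a j).[y])) *: a j.
have qE z : q.[z] = n.+1`!%:R * \sum_(j < n.+2)
    moment_coef n.+1 j * (j`!%:R * (a j).[z] * (a j).[y]).
  rewrite hornerZ horner_sum; congr (_ * _); apply: eq_bigr => j _.
  by rewrite hornerZ; ring.
rewrite -qE; apply: (@esp_horner_off_point _ _ _ n.+2 _ y) => [B|z zy].
  exact: sP.
by rewrite qE -main.
Qed.

End determinant_moment.

(** * Reduction of the expectation to moments *)

Definition sort_pair n (i j : 'I_n) : 'I_n * 'I_n := if (i <= j)%N then (i, j) else (j, i).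

Lemma sort_pair_upper n (i j : 'I_n) : ((sort_pair i j).1 <= (sort_pair i j).2)%N.
Proof. by rewrite /sort_pair; case: (leqP i j) => [//|/ltnW]. Qed.

Definition sym_of_upper (R : nzRingType) (s : R) n (X : 'I_n * 'I_n -> R) : 'M[R]_n :=
  \matrix_(i, j) if i == j then s * X (i, i) else X (sort_pair i j).

Lemma scale_diag_sym (R : nzRingType) (s : R) n (B : 'M[R]_n) : B^T = B ->
  scale_diag s B = sym_of_upper s (fun k => B k.1 k.2).
Proof.
move=> sB; apply/matrixP => i j; rewrite !mxE; case: eqP => [->//|_].
by rewrite /sort_pair; case: leqP => //= _; rewrite -[in LHS]sB mxE.
Qed.

Section determinant_expansion.
Variables (R : comNzRingType) (s : R) (n : nat).
Implicit Types (X : 'I_n * 'I_n -> R) (p : 'S_n) (k : 'I_n * 'I_n).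

Definition entry_poly x (i j : 'I_n) : {poly R} :=
  if i == j then x%:P - s *: 'X else - 'X.

(** Collects the factors of the permutation [p] that involve the independent entry [k]; the
    positions [(i, j)] and [(j, i)] share one entry. *)
Definition perm_poly x p k : {poly R} :=
  \prod_(i | sort_pair i (p i) == k) entry_poly x i (p i).

(** A row contributes to [k] only if it is one of the two indices of [k]. Hence degree at most 2,
    and at most 4 for a product of two determinants: this is where the fourth moment bounds what
    matters. *)
Lemma size_perm_poly x p k : (size (perm_poly x p k) <= 3)%N.
Proof.
have sz i j : (size (entry_poly x i j) <= 2)%N.
  rewrite /entry_poly; case: eqP => _; last by rewrite size_polyN size_polyX.
  rewrite (leq_trans (size_polyD _ _)) // geq_max size_polyN.
  rewrite (leq_trans (size_polyC_leq1 _)) //=.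
  by rewrite (leq_trans (size_scale_leq _ _)) // size_polyX.
have szp (r : seq 'I_n) : (size (\prod_(i <- r) entry_poly x i (p i))%R <= (size r).+1)%N.
  elim: r => [|i r IHr]; first by rewrite big_nil size_poly1.
  rewrite big_cons (leq_trans (size_polyMleq _ _)) //=.
  move: IHr (sz i (p i)); move: (size (polyseq (\prod_(j <- r) _))) (size (polyseq (entry_poly _ _ _))).
  by move=> c [|d]; lia.
rewrite /perm_poly -big_filter; apply: leq_trans (szp _) _; rewrite ltnS.
apply: (@uniq_leq_size _ _ [:: k.1; k.2]); first by rewrite filter_uniq // index_enum_uniq.
move=> i; rewrite mem_filter => /andP[/eqP <- _]; rewrite /sort_pair !inE.
by case: leqP; rewrite eqxx ?orbT.
Qed.

Lemma horner_char_poly_expand x X :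
  \det (x%:M - sym_of_upper s X) =
  \sum_(p : 'S_n) (-1) ^+ odd_perm p * \prod_(k : 'I_n * 'I_n | (k.1 <= k.2)%N) (perm_poly x p k).[X k].
Proof.
apply: eq_bigr => p _; congr (_ * _).
rewrite (partition_big (fun i => sort_pair i (p i)) (fun k => k.1 <= k.2)%N) /=; last first.
  by move=> i _; apply: sort_pair_upper.
apply: eq_bigr => k _; rewrite /perm_poly horner_prod.
apply: eq_bigr => i /eqP <-; rewrite !mxE /entry_poly.
case: eqP => [<-|_]; first by rewrite /sort_pair leqnn !hornerE.
by rewrite mulr0n sub0r hornerN hornerX.
Qed.

Lemma det_mul_expand x y X :
  \det (x%:M - sym_of_upper s X) * \det (y%:M - sym_of_upper s X) =
  \sum_(p : 'S_n) \sum_(q : 'S_n) ((-1) ^+ odd_perm p * (-1) ^+ odd_perm q) *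
    \prod_(k : 'I_n * 'I_n | (k.1 <= k.2)%N) (perm_poly x p k * perm_poly y q k).[X k].
Proof.
rewrite !horner_char_poly_expand mulr_suml; apply: eq_bigr => p _.
rewrite mulr_sumr; apply: eq_bigr => q _; rewrite mulrACA -big_split /=.
by congr (_ * _); apply: eq_bigr => k _; rewrite hornerM.
Qed.

Lemma size_perm_polyM x y p q k : (size (perm_poly x p k * perm_poly y q k)%R <= 5)%N.
Proof.
have := size_perm_poly x p k; have := size_perm_poly y q k.
have := size_polyMleq (perm_poly x p k) (perm_poly y q k); lia.
Qed.

End determinant_expansion.

Section signed_expectation_prod.
Variables (R : comNzRingType) (K : finType) (w e : K -> R).
Local Notation l F := (\sum_c w c * F (e c)).

Lemma vec_esp_prod n (F : 'I_n -> R -> R) :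
  vec_esp w e (fun v => \prod_i F i (v i 0)) = \prod_i l (F i).
Proof.
elim: n F => [|n IHn] F; first by rewrite /= !big_ord0.
rewrite vec_espS big_ord_recl mulr_suml; apply: eq_bigr => c _.
rewrite -mulrA; congr (_ * _); rewrite -(IHn (fun i => F (lift ord0 i))) -vec_espZ; apply: eq_vec_esp => v.
rewrite big_ord_recl (col_mx_ord0 (const_mx (e c) : 'M[_]_1) v) mxE; congr (_ * _).
by apply: eq_bigr => i _; rewrite (col_mx_lift0 (const_mx (e c) : 'M[_]_1) v).
Qed.

(** Mirrors the order in which [sym_esp] peels off entries: corner, rest of the first row, smaller
    upper triangle. *)
Lemma prod_upper_recl (V : comNzRingType) n (F : 'I_n.+1 * 'I_n.+1 -> V) :
  \prod_(k : 'I_n.+1 * 'I_n.+1 | (k.1 <= k.2)%N) F k =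
  F (ord0, ord0) * (\prod_(j < n) F (ord0, lift ord0 j)) *
  \prod_(k : 'I_n * 'I_n | (k.1 <= k.2)%N) F (lift ord0 k.1, lift ord0 k.2).
Proof.
have split m (G : 'I_m * 'I_m -> V) : \prod_(k : 'I_m * 'I_m | (k.1 <= k.2)%N) G k =
    \prod_(i < m) \prod_(j < m | (i <= j)%N) G (i, j).
  by rewrite pair_big_dep; apply: eq_bigr => -[].
rewrite !split big_ord_recl big_ord_recl; congr (_ * _).
by apply: eq_bigr => i _; rewrite big_mkcond big_ord_recl /= mul1r [RHS]big_mkcond.
Qed.

Lemma sym_esp_prod n (F : 'I_n * 'I_n -> R -> R) :
  sym_esp w e (fun B => \prod_(k : 'I_n * 'I_n | (k.1 <= k.2)%N) F k (B k.1 k.2)) =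
  \prod_(k : 'I_n * 'I_n | (k.1 <= k.2)%N) l (F k).
Proof.
elim: n F => [|n IHn] F.
  by rewrite /= !big1 // => -[[]].
rewrite sym_espS prod_upper_recl -(IHn (fun k => F (lift ord0 k.1, lift ord0 k.2))) -sym_espZ; apply: eq_sym_esp => A _.
rewrite -(vec_esp_prod (fun j => F (ord0, lift ord0 j))) mulrAC -vec_espZ; apply: eq_vec_esp => v.
rewrite -mulrA mulr_suml; apply: eq_bigr => c _; rewrite -mulrA; congr (_ * _).
rewrite prod_upper_recl bordered00 -mulrA; congr (_ * _).
rewrite [RHS]mulrC; congr (_ * _).
  by apply: eq_bigr => j _; rewrite bordered0S.
by apply: eq_bigr => k _; rewrite borderedSS.
Qed.

End signed_expectation_prod.

Section moment_functional.
Variables (R : numFieldType) (K : finType) (w e : K -> R) (s : R) (m : nat -> R).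
Hypothesis w_moment : forall i, (i < 5)%N -> \sum_c w c * e c ^+ i = m i.

Lemma signed_moment (q : {poly R}) : (size q <= 5)%N ->
  \sum_c w c * q.[e c] = \sum_(i < 5) q`_i * m i.
Proof.
move=> sq; transitivity (\sum_c \sum_(i < 5) q`_i * (w c * e c ^+ i)).
  apply: eq_bigr => c _; rewrite (horner_coef_wide _ sq) mulr_sumr.
  by apply: eq_bigr => i _; rewrite mulrCA.
by rewrite exchange_big; apply: eq_bigr => i _; rewrite -mulr_sumr w_moment.
Qed.

(** The weights enter the right-hand side only through [m]; the true law, having the same moments,
    leads to the same expression. *)
Lemma det_moment_expand n x y :
  det_moment w e s n x y =
  \sum_(p : 'S_n) \sum_(q : 'S_n) ((-1) ^+ odd_perm p * (-1) ^+ odd_perm q) *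
    \prod_(k : 'I_n * 'I_n | (k.1 <= k.2)%N)
      \sum_(i < 5) (perm_poly s x p k * perm_poly s y q k)`_i * m i.
Proof.
rewrite /det_moment.
transitivity (sym_esp w e (fun B : 'M[_]_n => \sum_(p : 'S_n) \sum_(q : 'S_n)
    ((-1) ^+ odd_perm p * (-1) ^+ odd_perm q) *
    \prod_(k : 'I_n * 'I_n | (k.1 <= k.2)%N) (perm_poly s x p k * perm_poly s y q k).[B k.1 k.2])).
  by apply: eq_sym_esp => B sB; rewrite !horner_char_poly scale_diag_sym // det_mul_expand.
rewrite sym_esp_sum; apply: eq_bigr => p _.
rewrite sym_esp_sum; apply: eq_bigr => q _.
rewrite sym_espZ; congr (_ * _).
rewrite (sym_esp_prod w e (fun k t => (perm_poly s x p k * perm_poly s y q k).[t])).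
by apply: eq_bigr => k _; rewrite signed_moment // size_perm_polyM.
Qed.

End moment_functional.

Local Open Scope classical_set_scope.
Local Open Scope ring_scope.

(** * Integrals of products of functions of independent variables *)

Section independent_product.
Context {R : realType} {d : measure_display} {T : measurableType d}
  (P : probability T R) (Q : probability R R).
Import HBNNSimple.

(** Upgrades an indicator to a non-negative function in one factor, [G] being the product of the
    others: simple functions by linearity, then monotone convergence. *)
Lemma ge0_integral_indep_step (X : {RV P >-> R}) (G : T -> R) (c m : R) (f : R -> R) :
  measurable_fun setT G -> (forall x, 0 <= G x) ->
  (forall B, measurable B -> (\int[P]_x (\1_B (X x) * G x)%:E = Q B * c%:E)%E) ->
  measurable_fun setT f -> (forall x, 0 <= f x) -> (\int[Q]_x (f x)%:E = m%:E)%E ->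
  (\int[P]_x (f (X x) * G x)%:E = (m * c)%:E)%E.
Proof.
move=> mG G0 GB mf f0 fm.
(* Taking [B] to be the whole line identifies [c] with the integral of [G]. *)
have c0 : 0 <= c.
  have := GB _ (@measurableT _ R); rewrite probability_setT mul1e => H.
  by rewrite -lee_fin -H; apply: integral_ge0 => x _; rewrite lee_fin mulr_ge0.
have mX : measurable_fun setT X by [].
have simple (h : {nnsfun R >-> R}) :
    (\int[P]_x (h (X x) * G x)%:E = \int[Q]_x (h x)%:E * c%:E)%E.
  rewrite integralT_nnsfun sintegralE ge0_mule_fsuml; last first.
    by move=> r; exact: nnsfun_mulemu_ge0.
  transitivity (\int[P]_x (\sum_(r \in range h)
      (r%:E * (\1_(h @^-1` [set r]) (X x) * G x)%:E)))%E.
    apply: eq_integral => x _; rewrite EFinM fimfunE -fsumEFin // ge0_mule_fsuml.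
      by apply: eq_fsbigr => r _; rewrite -!EFinM mulrA.
    by move=> r; rewrite EFinM nnfun_muleindic_ge0.
  rewrite ge0_integral_fsum //; last 2 first.
  - move=> r; apply/measurable_EFinP; apply: measurable_funM => //.
    apply: measurable_funM => //; apply: measurableT_comp => //.
  - move=> r x _; rewrite EFinM muleA mule_ge0 ?lee_fin //.
    exact: nnfun_muleindic_ge0.
  apply: eq_fsbigr => r /set_mem[z _ hz]; rewrite -muleA -GB //.
  rewrite ge0_integralZl //.
  - apply/measurable_EFinP; apply: measurable_funM => //.
    by apply: measurableT_comp.
  - by move=> x _; rewrite lee_fin mulr_ge0.
  - by rewrite lee_fin -hz.
pose f_ := nnsfun_approx (@measurableT _ R) (proj2 (measurable_EFinP _ _) mf).
have cf x : EFin \o f_^~ x @ \oo --> (f x)%:E.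
  by apply: cvg_nnsfun_approx => // y _; rewrite lee_fin.
have ndf x : {homo f_^~ x : a b / (a <= b)%N >-> (a <= b)}.
  by move=> a b ab; exact/lefP/nd_nnsfun_approx.
have lim1 : (\int[P]_x (f_ n (X x) * G x)%:E @[n --> \oo] --> \int[P]_x (f (X x) * G x)%:E)%E.
  rewrite (_ : (\int[P]_x (f (X x) * G x)%:E)%E =
      (\int[P]_x limn (fun n => (f_ n (X x) * G x)%:E))%E); last first.
    apply: eq_integral => x _; apply/esym/cvg_lim => //.
    under eq_fun do rewrite EFinM.
    by rewrite EFinM; apply: cvgeZr => //; exact: cf.
  apply: cvg_monotone_convergence => //.
  - move=> n; apply/measurable_EFinP; apply: measurable_funM => //.
    by apply: measurableT_comp.
  - by move=> n x _; rewrite lee_fin mulr_ge0.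
  - by move=> x _ a b ab; rewrite lee_fin ler_wpM2r // ndf.
have lim2 : ((\int[Q]_x (f_ n x)%:E * c%:E) @[n --> \oo] --> \int[Q]_x (f x)%:E * c%:E)%E.
  apply: cvgeZr => //.
  rewrite (_ : (\int[Q]_x (f x)%:E)%E = (\int[Q]_x limn (fun n => (f_ n x)%:E))%E); last first.
    by apply: eq_integral => x _; apply/esym/cvg_lim => //; exact: cf.
  apply: cvg_monotone_convergence => //.
  - by move=> n; apply/measurable_EFinP.
  - by move=> n x _; rewrite lee_fin.
  - by move=> x _ a b ab; rewrite lee_fin ndf.
rewrite EFinM -fm; move: lim1; under eq_fun do rewrite simple.
by move=> lim1; exact: (cvg_unique _ lim1 lim2).
Qed.

Lemma prod_measurable (I : Type) (r : seq I) (p : pred I) (F : I -> T -> R) :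
  (forall i, measurable_fun setT (F i)) ->
  measurable_fun setT (fun x => \prod_(i <- r | p i) F i x).
Proof.
move=> mF; elim: r => [|i r IHr]; first by under eq_fun do rewrite big_nil; exact: measurable_cst.
under eq_fun do rewrite big_cons.
by case: (p i) => //; exact: measurable_funM.
Qed.

Section iid.
Variables (I : finType) (D : {set I}) (X : I -> {RV P >-> R}).
Hypothesis X_iid : iid_with_law D Q X.

(** Functions replace indicators one index at a time. Keeping an arbitrary subfamily [J] of
    indicators is what carries the induction, which starts from the product rule for
    independence. *)
Lemma ge0_iid_integral_prod_indic (f : I -> R -> R) (m : I -> R) (r : seq I) (J : {set I}) (A : I -> set R) :
  (forall i, measurable_fun setT (f i)) -> (forall i x, 0 <= f i x) ->
  (forall i, \int[Q]_x (f i x)%:E = (m i)%:E)%E ->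
  uniq r -> (forall i, i \in r -> i \in D /\ i \notin J) -> J \subset D ->
  (forall i, measurable (A i)) ->
  (\int[P]_x (\prod_(i <- r) f i (X i x) * \prod_(i in J) \1_(A i) (X i x))%:E =
   (\prod_(i <- r) m i)%:E * \prod_(i in J) Q (A i))%E.
Proof.
move=> mf f0 fm; elim: r J A => [|i r IHr] J A.
  move=> _ _ JD mA; rewrite big_nil mul1e.
  under eq_integral do rewrite big_nil mul1r.
  have mA' i : measurable (X i @^-1` A i).
    by rewrite -[X in measurable X]setTI; apply: (measurable_funP (X i)).
  transitivity (\int[P]_x (\1_(\bigcap_(i in [set` J]) (X i @^-1` A i)) x)%:E)%E.
    apply: eq_integral => x _; congr (_%:E).
    have [H|] := pselect (forall i, i \in J -> A i (X i x)).
      rewrite big1 => [|i iJ]; first by rewrite indicE mem_set // => i; exact: H.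
      by rewrite indicE mem_set //; exact: H.
    move/existsNP => [i /not_implyP[iJ Ai]].
    rewrite (bigD1 i) //= indicE memNset // mul0r indicE memNset // => /(_ i iJ).
    exact: Ai.
  have mcap : measurable (\bigcap_(i in [set` J]) (X i @^-1` A i)).
    by apply: fin_bigcap_measurable => //; exact: finite_finset.
  rewrite integral_indic // setIT.
  rewrite [LHS](X_iid.1 J JD A mA); apply: eq_bigr => i iJ.
  by rewrite -(X_iid.2 i) // (fintype.subsetP JD).
move=> /= /andP[ir ur] rD JD mA.
have [iD iJ] := rD i (mem_head _ _).
under eq_integral do rewrite big_cons -mulrA.
have QA j : Q (A j) = (fine (Q (A j)))%:E by rewrite fineK // fin_num_measure.
pose c := (\prod_(j <- r) m j) * \prod_(j in J) fine (Q (A j)).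
have cE : c%:E = ((\prod_(j <- r) m j)%:E * \prod_(j in J) Q (A j))%E.
  by rewrite EFinM -[in LHS](prodEFin (index_enum I)); congr (_ * _)%E; apply: eq_bigr.
rewrite (@ge0_integral_indep_step (X i) _ c (m i) (f i)) //.
- by rewrite EFinM cE big_cons EFinM muleA.
- apply: measurable_funM; apply: prod_measurable => j.
    exact: measurableT_comp.
  by apply: measurableT_comp => //; exact: measurable_indic.
- by move=> x; rewrite mulr_ge0 // prodr_ge0.
- move=> B mB.
  have iJ' : i \notin J by [].
  (* The factor under treatment enters the induction hypothesis as the indicator of [B] at the new
     index [i]. *)
  have := IHr (i |: J) (fun j => if j == i then B else A j) ur.
  rewrite big_setU1 //= eqxx cE.
  have -> : (\prod_(j in J) Q (if j == i then B else A j) = \prod_(j in J) Q (A j))%E.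
    by apply: eq_bigr => j jJ; case: eqP => // ji; rewrite ji (negbTE iJ) in jJ.
  rewrite muleCA => <- //; last 3 first.
  + move=> j jr; have [|jD jJ] := rD j; first by rewrite inE jr orbT.
    split => //; rewrite !inE negb_or jJ andbT.
    by apply: contraNneq ir => <-.
  + by apply/fintype.subsetP => j; rewrite !inE => /orP[/eqP -> //|/(fintype.subsetP JD)].
  + by move=> j; case: eqP.
  apply: eq_integral => x _; congr (_%:E); rewrite mulrCA; congr (_ * _).
  rewrite big_setU1 //= eqxx; congr (_ * _).
  by apply: eq_bigr => j jJ; case: eqP => // ji; rewrite ji (negbTE iJ) in jJ.
Qed.

(** Signed factors are split into positive and negative parts, which move from [r1] to the
    non-negative list [r2]; the product becomes a difference of integrable functions. *)
Lemma iid_integral_prod_mixed (f h : I -> R -> R) (m mh : I -> R) (r1 r2 : seq I) :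
  (forall i, measurable_fun setT (f i)) ->
  (forall i, Q.-integrable setT (EFin \o f i)) ->
  (forall i, \int[Q]_x (f i x)%:E = (m i)%:E)%E ->
  (forall i, measurable_fun setT (h i)) -> (forall i x, 0 <= h i x) ->
  (forall i, \int[Q]_x (h i x)%:E = (mh i)%:E)%E ->
  uniq (r1 ++ r2) -> {subset r1 ++ r2 <= D} ->
  P.-integrable setT (fun x =>
    (\prod_(i <- r1) f i (X i x) * \prod_(i <- r2) h i (X i x))%:E) /\
  (\int[P]_x (\prod_(i <- r1) f i (X i x) * \prod_(i <- r2) h i (X i x))%:E =
   (\prod_(i <- r1) m i * \prod_(i <- r2) mh i)%:E)%E.
Proof.
move=> mf intf fm; elim: r1 r2 h mh => [|i r1 IH] r2 h mh mh' h0 hm.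
  move=> ur rD; rewrite big_nil mul1r.
  have E : (\int[P]_x (\prod_(i <- r2) h i (X i x))%:E = (\prod_(i <- r2) mh i)%:E)%E.
    have := @ge0_iid_integral_prod_indic h mh r2 finset.set0 (fun=> setT) mh' h0 hm ur.
    rewrite big_set0 mule1 => <- //; last 2 first.
    - by move=> j /rD jD; rewrite inE.
    - exact: finset.sub0set.
    by apply: eq_integral => x _; rewrite big_set0 mulr1.
  have E0 : (fun x => (\prod_(i <- [::]) f i (X i x) * \prod_(i <- r2) h i (X i x))%:E) =
      (fun x => (\prod_(i <- r2) h i (X i x))%:E).
    by apply/funext => x; rewrite big_nil mul1r.
  rewrite E0; split => //; apply/integrableP; split.
    apply/measurable_EFinP; apply: prod_measurable => j.
    exact: measurableT_comp.
  under eq_integral do rewrite abse_EFin ger0_norm ?prodr_ge0 //.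
  by rewrite E ltry.
rewrite cat_cons /= mem_cat negb_or => /andP[/andP[ir1 ir2] ur] rD.
pose g (s : bool) x := Num.max (if s then f i x else - f i x) 0.
have g0 s x : 0 <= g s x by rewrite /g le_max lexx orbT.
have mg s : measurable_fun setT (g s).
  by apply: measurable_maxr => //; case: s => //; exact: measurableT_comp.
have fg x : f i x = g true x - g false x.
  by rewrite /g /= /Order.max; case: ifPn; case: ifPn; rewrite -?leNgt; lra.
have intg s : Q.-integrable setT (EFin \o g s).
  apply: (le_integrable _ _ _ (intf i)) => //.
    exact/measurable_EFinP.
  move=> x _ /=; rewrite lee_fin ger0_norm // /g ge_max normr_ge0 andbT.
  by case: s; rewrite ?ler_norm // -normrN ler_norm.
pose mg' s := fine (\int[Q]_x (g s x)%:E).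
have gm s : (\int[Q]_x (g s x)%:E = (mg' s)%:E)%E.
  by rewrite fineK //; apply: (integrable_fin_num measurableT (intg s)).
have mfg : m i = mg' true - mg' false.
  apply/EFin_inj; rewrite -fm EFinB -!gm -integralB //.
    by apply: eq_integral => x _; rewrite fg EFinB.
  - exact: intg.
  - exact: intg.
have step s := IH (i :: r2) (fun j => if j == i then g s else h j)
  (fun j => if j == i then mg' s else mh j).
have {step} : forall s, P.-integrable setT (fun x => (g s (X i x) *
    (\prod_(j <- r1) f j (X j x) * \prod_(j <- r2) h j (X j x)))%:E) /\
   (\int[P]_x (g s (X i x) *
    (\prod_(j <- r1) f j (X j x) * \prod_(j <- r2) h j (X j x)))%:E =
    (mg' s * (\prod_(j <- r1) m j * \prod_(j <- r2) mh j))%:E)%E.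
  move=> s.
  have E1 (v : I -> R) a : \prod_(j <- i :: r2) (if j == i then a else v j) =
      a * \prod_(j <- r2) v j.
    rewrite big_cons eqxx; congr (_ * _); rewrite big_seq [RHS]big_seq.
    by apply: eq_bigr => j jr; case: eqP => // ji; rewrite -ji jr in ir2.
  have E2 : (fun x => (\prod_(j <- r1) f j (X j x) *
       \prod_(j <- i :: r2) (if j == i then g s else h j) (X j x))%:E) =
     (fun x => (g s (X i x) *
    (\prod_(j <- r1) f j (X j x) * \prod_(j <- r2) h j (X j x)))%:E).
    apply/funext => x; congr (_%:E); rewrite mulrCA -E1; congr (_ * _).
    by apply: eq_bigr => j _; case: eqP => // ->.
  have := step s; rewrite E1 E2 mulrCA; apply.
  - by move=> j; case: eqP.
  - by move=> j x; case: eqP.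
  - by move=> j; case: eqP.
  - by rewrite (perm_uniq (permEl (perm_catCA r1 [:: i] r2))) /= mem_cat negb_or ir1 ir2.
  - by move=> j; rewrite (perm_mem (permEl (perm_catCA r1 [:: i] r2))); exact: rD.
move=> step; have [i1 e1] := step true; have [i0 e0] := step false.
have E3 : (fun x => (\prod_(i <- i :: r1) f i (X i x) * \prod_(i <- r2) h i (X i x))%:E) =
  (fun x => (g true (X i x) *
    (\prod_(j <- r1) f j (X j x) * \prod_(j <- r2) h j (X j x)))%:E -
    (g false (X i x) *
    (\prod_(j <- r1) f j (X j x) * \prod_(j <- r2) h j (X j x)))%:E)%E.
  by apply/funext => x; rewrite -EFinB big_cons fg; congr (_%:E); ring.
rewrite E3; split; first exact: integrableB.
rewrite integralB // e1 e0 -EFinB; congr (_%:E).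
by rewrite big_cons mfg; ring.
Qed.

Lemma iid_integral_prod (f : I -> R -> R) (m : I -> R) :
  (forall i, measurable_fun setT (f i)) ->
  (forall i, Q.-integrable setT (EFin \o f i)) ->
  (forall i, \int[Q]_x (f i x)%:E = (m i)%:E)%E ->
  P.-integrable setT (fun x => (\prod_(i in D) f i (X i x))%:E) /\
  (\int[P]_x (\prod_(i in D) f i (X i x))%:E = (\prod_(i in D) m i)%:E)%E.
Proof.
move=> mf intf fm.
have E : (fun x => (\prod_(i in D) f i (X i x))%:E) =
    (fun x => (\prod_(i <- enum D) f i (X i x) * \prod_(i <- [::] : seq I) cst 1 (X i x))%:E).
  by apply/funext => x; rewrite big_nil mulr1 big_enum.
rewrite E; have -> : \prod_(i in D) m i = \prod_(i <- enum D) m i * \prod_(i <- [::] : seq I) 1.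
  by rewrite big_nil mulr1 big_enum.
apply: (@iid_integral_prod_mixed f (fun=> cst 1) m (fun=> 1)) => //.
- by move=> i; rewrite (eq_integral (cst 1%E)) // integral_cst //= probability_setT mule1.
- by rewrite cats0 enum_uniq.
- by move=> i; rewrite cats0 mem_enum.
Qed.

End iid.

End independent_product.

Section has_mean.
Context {d : measure_display} {T : measurableType d} {R : realType}
  (mu : {measure set T -> \bar R}).

(** Integrability and value travel together, so that linearity applies to finite sums without
    further side conditions. *)
Definition has_mean (f : T -> R) (v : R) : Prop :=
  mu.-integrable setT (EFin \o f) /\ (\int[mu]_x (f x)%:E = v%:E)%E.

Lemma has_meanZ f v c : has_mean f v -> has_mean (fun x => c * f x) (c * v).
Proof.
move=> [fi fv]; split.
  by apply: (integrableZl measurableT c fi).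
under eq_integral do rewrite EFinM.
by rewrite integralZl // fv.
Qed.

Lemma has_meanD f g u v : has_mean f u -> has_mean g v ->
  has_mean (fun x => f x + g x) (u + v).
Proof.
move=> [fi fu] [gi gv]; split; first exact: (integrableD measurableT fi gi).
under eq_integral do rewrite EFinD.
by rewrite integralD // fu gv.
Qed.

Lemma has_mean0 : has_mean (fun=> 0) 0.
Proof. by split; [exact: integrable0 | rewrite integral0]. Qed.

Lemma has_mean_sum (I : Type) (r : seq I) (f : I -> T -> R) (v : I -> R) :
  (forall i, has_mean (f i) (v i)) ->
  has_mean (fun x => \sum_(i <- r) f i x) (\sum_(i <- r) v i).
Proof.
move=> fv; elim: r => [|i r IHr].
  by rewrite big_nil; under [X in has_mean X]eq_fun do rewrite big_nil; exact: has_mean0.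
rewrite big_cons; under [X in has_mean X]eq_fun do rewrite big_cons.
exact: has_meanD.
Qed.

End has_mean.

Section second_correlation.
Context {R : realType} (Q : probability R R) (b : R).
Hypothesis Q_mean : (\int[Q]_x (x : R)%:E = 0)%E.
Hypothesis Q_var : (\int[Q]_x ((x : R) ^+ 2)%:E = 1)%E.
Hypothesis Q_fourth : (\int[Q]_x ((x : R) ^+ 4)%:E = b%:E)%E.

(** [x^4] is non-negative with finite integral, and [|x|^i <= 1 + x^4] for [i <= 4], by comparing
    [|x|] with 1. *)
Lemma integrable_moment i : (i < 5)%N -> Q.-integrable setT (EFin \o (fun x : R => x ^+ i)).
Proof.
move=> i5; have me j : measurable_fun setT (fun x : R => x ^+ j).
  by apply: measurable_funX.
have int4 : Q.-integrable setT (EFin \o (fun x : R => x ^+ 4)).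
  apply/integrableP; split; first exact/measurable_EFinP.
  under eq_integral do rewrite /= ger0_norm ?exprn_even_ge0 //.
  by rewrite Q_fourth ltry.
have int1 : Q.-integrable setT (EFin \o (fun x : R => 1 + x ^+ 4)).
  apply: (@integrableD _ _ _ Q setT _ (cst 1%E) (EFin \o (fun x : R => x ^+ 4))) => //.
  exact: finite_measure_integrable_cst.
apply: (le_integrable _ _ _ int1) => //; first exact/measurable_EFinP.
move=> x _ /=; rewrite lee_fin [X in _ <= X]ger0_norm ?addr_ge0 ?exprn_even_ge0 //.
rewrite normrX; have [x1|x1] := lerP `|x| 1.
  by rewrite (@le_trans _ _ 1) ?exprn_ile1 // lerDl exprn_even_ge0.
have -> : x ^+ 4 = `|x| ^+ 4 by rewrite -normrX ger0_norm // exprn_even_ge0.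
by rewrite (le_trans (ler_weXn2l (ltW x1) (_ : (i <= 4)%N))) // lerDr ler01.
Qed.

Definition law_moment i : R := fine (\int[Q]_x (x ^+ i)%:E).

Lemma has_mean_horner (q : {poly R}) : (size q <= 5)%N ->
  has_mean Q (fun x => q.[x]) (\sum_(i < 5) q`_i * law_moment i).
Proof.
move=> sq; under [X in has_mean _ X]eq_fun do rewrite (horner_coef_wide _ sq).
apply: has_mean_sum => i; apply: has_meanZ; split; first exact: integrable_moment.
by rewrite /law_moment fineK //; apply: (integrable_fin_num measurableT (integrable_moment _)).
Qed.

(** The nodes [-2, ..., 2] carry any moments of order 0 to 4 (a Vandermonde system). The even
    moments fix the symmetric parts [w2], [w4] of the weights, the odd ones the antisymmetric parts
    [v2], [v4], and the middle weight fixes the total mass. *)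
Lemma signed_weights : exists (w e : 'I_5 -> R), forall i, (i < 5)%N ->
  \sum_c w c * e c ^+ i = law_moment i.
Proof.
set m := law_moment.
pose w4 := (m 4 - m 2) / 24; pose w2 := (4 * m 2 - m 4) / 6.
pose v4 := (m 3 - m 1) / 12; pose v2 := (4 * m 1 - m 3) / 6.
exists (fun c => [:: w4 - v4; w2 - v2; m 0 - 2 * w4 - 2 * w2; w2 + v2; w4 + v4]`_c),
  (fun c => c%:R - 2) => i i5.
rewrite 5!big_ord_recl big_ord0 /= /bump /=.
by case: i i5 => [|[|[|[|[|//]]]]] _; rewrite /w4 /w2 /v4 /v2 /=; field.
Qed.

Lemma wigner_mxE (T : Type) N (X : 'I_N * 'I_N -> T -> R) t :
  wigner_mx X t = sym_of_upper (Num.sqrt 2) (fun k => X k t).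
Proof.
apply/matrixP => i j; rewrite !mxE /sort_pair.
case: eqP => [->|/eqP ij]; first by rewrite ltnn.
by rewrite (ltn_neqAle i j) (inj_eq val_inj) ij /=; case: leqP.
Qed.

Lemma char_detM N (M : 'M[R]_N) x y :
  char_det M x * char_det M y = \det (x%:M - M) * \det (y%:M - M).
Proof.
have E z : char_det M z = (-1) ^+ N * \det (z%:M - M).
  by rewrite -detZ scaleN1r opprB.
by rewrite !E mulrACA -exprD addnn -signr_odd odd_double mul1r.
Qed.

Lemma second_corr_formula (d : measure_display) (T : measurableType d)
    (P : probability T R) N (X : 'I_N * 'I_N -> {RV P >-> R}) x y :
  iid_with_law (upper_index N) Q X ->
  second_corr X x y = N`!%:R * \sum_(j < N.+1) moment_coef b N j *
    (j`!%:R * (hermite_fact R j).[x] * (hermite_fact R j).[y]).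
Proof.
move=> X_iid; have [w [e we]] := signed_weights.
have s2 : (Num.sqrt 2 : R) ^+ 2 = 2 by rewrite sqr_sqrtr.
have m0 : law_moment 0 = 1.
  rewrite /law_moment; under eq_integral do rewrite expr0.
  by rewrite integral_cst //= probability_setT mule1.
have m1 : law_moment 1 = 0 by rewrite /law_moment; under eq_integral do rewrite expr1; rewrite Q_mean.
have m2 : law_moment 2 = 1 by rewrite /law_moment Q_var.
have m4 : law_moment 4 = b by rewrite /law_moment Q_fourth.
rewrite -(@det_moment_formula R _ w e b (Num.sqrt 2)) //; last 4 first.
- rewrite -[RHS]m0 -[RHS](we 0%N isT).
  by apply: eq_bigr => c _; rewrite expr0 mulr1.
- exact: etrans (we 1%N isT) m1.
- exact: etrans (we 2%N isT) m2.
- exact: etrans (we 4%N isT) m4.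
rewrite (det_moment_expand _ we) /second_corr unlock.
(* The expanded product is a finite sum of products over independent entries, so its mean exists and
   is the expression already found for the signed law. *)
have [_ ->] : has_mean P (fun t => char_det (wigner_mx (fun k => X k) t) x *
    char_det (wigner_mx (fun k => X k) t) y)
  (\sum_(p : 'S_N) \sum_(q : 'S_N) ((-1) ^+ odd_perm p * (-1) ^+ odd_perm q) *
    \prod_(k : 'I_N * 'I_N | (k.1 <= k.2)%N)
      \sum_(i < 5) (perm_poly (Num.sqrt 2) x p k * perm_poly (Num.sqrt 2) y q k)`_i * law_moment i).
  under [X in has_mean _ X]eq_fun do rewrite char_detM wigner_mxE det_mul_expand.
  apply: has_mean_sum => p; apply: has_mean_sum => q; apply: has_meanZ.
  pose F k := perm_poly (Num.sqrt 2) x p k * perm_poly (Num.sqrt 2) y q k.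
  have Fm k := has_mean_horner (size_perm_polyM (Num.sqrt 2) x y p q k).
  have [|||H] := iid_integral_prod X_iid (f := fun k t => (F k).[t])
    (m := fun k => \sum_(i < 5) (F k)`_i * law_moment i).
  - by move=> k; apply: continuous_measurable_fun; exact: continuous_horner.
  - by move=> k; have [] := Fm k.
  - by move=> k; have [] := Fm k.
  have upE (V : comNzRingType) (G : 'I_N * 'I_N -> V) :
      \prod_(k in upper_index N) G k = \prod_(k : 'I_N * 'I_N | (k.1 <= k.2)%N) G k.
    by apply: eq_bigl => k; rewrite inE.
  rewrite upE => HE.
  have E : (fun t => \prod_(k : 'I_N * 'I_N | (k.1 <= k.2)%N) (F k).[X k t]) =
      (fun t => \prod_(k in upper_index N) (F k).[X k t]).
    by apply/funext => t; rewrite upE.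
  suff : has_mean P (fun t => \prod_(k in upper_index N) (F k).[X k t])
     (\prod_(k : 'I_N * 'I_N | (k.1 <= k.2)%N) \sum_(i < 5) (F k)`_i * law_moment i).
    by rewrite -E.
  by split.
by [].
Qed.

End second_correlation.

(** * Closed forms of Hermite sums *)

Section hermite_sums.
Variable R : numFieldType.
Local Notation a := (hermite_fact R).

Definition herm_fun n x : R := (a n).[x].
(* [exp (x^2/4) d/dx (exp (- x^2/4) He_n(x) / n!)] *)
Definition herm_dfun n x : R := (a n)^`().[x] - x / 2 * (a n).[x].

Definition herm_prod j x y : R := j`!%:R * (a j).[x] * (a j).[y].
Definition herm_kernel n x y : R := \sum_(j < n.+1) herm_prod j x y.
(** The kernels of sizes up to [n] summed once more, hence the weights [n.+1 - j]. *)
Definition herm_kernel_sum n x y : R := \sum_(j < n.+1) (n.+1 - j)%:R * herm_prod j x y.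

Lemma herm_kernel_sumS n x y :
  herm_kernel_sum n.+1 x y = herm_kernel_sum n x y + herm_kernel n.+1 x y.
Proof.
rewrite /herm_kernel_sum /herm_kernel big_ord_recr [\sum_(j < n.+2) herm_prod j x y]big_ord_recr.
rewrite /= subSnn mul1r addrA.
congr (_ + _); rewrite -big_split; apply: eq_bigr => j _ /=.
by rewrite subSn ?natr1 // ?(ltnW (ltn_ord j)) // -natr1 mulrDl mul1r.
Qed.

(** Expresses everything at [n.+1] through value and derivative at [n], so that the inductive steps
    of the closed forms are identities of rational functions. *)
Lemma herm_step n x : exists p, [/\ (a n)^`().[x] = p, (a n.+1)^`().[x] = (a n).[x]
  & (a n.+1).[x] = (x * (a n).[x] - p) / n.+1%:R].
Proof.
exists (a n)^`().[x]; split => //; first by rewrite deriv_hermite_fact.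
apply: (mulfI (_ : n.+1%:R != 0)); first by rewrite pnatr_eq0.
by rewrite hermite_fact_raise_horner [RHS]mulrC divfK // pnatr_eq0.
Qed.

(** The confluent Christoffel-Darboux formula. Passing from the derivative to [herm_dfun] completes
    a square, so no mixed term is left. *)
Lemma herm_kernel_diag n x :
  herm_kernel n x x = n`!%:R * ((n.+1%:R - x ^+ 2 / 4) * herm_fun n x ^+ 2 + herm_dfun n x ^+ 2).
Proof.
rewrite /herm_fun /herm_dfun; elim: n => [|n IHn].
  rewrite /herm_kernel big_ord_recl big_ord0 /herm_prod.
  have -> : (a 0)^`() = 0 by rewrite /= -(polyC1 R) derivC.
  have a0 z : (a 0).[z] = 1 by rewrite /= -(polyC1 R) hornerC.
  by rewrite !a0 /= ?subn0 !fact0 !horner0; field.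
rewrite /herm_kernel big_ord_recr /= -/(herm_kernel n x x) IHn /herm_prod.
have [p [-> -> ->]] := herm_step n x.
have k0 : n.+1%:R != 0 :> R by rewrite pnatr_eq0.
rewrite factS natrM -[n.+2%:R]natr1; move: k0; move: (n.+1%:R) (n`!%:R) ((a n).[x]).
by move=> k c A k0; field.
Qed.

(** The confluent case needs its own induction, because the formula for distinct points carries the
    factor [(x - y) ^+ 3], which is 0 here. *)
Lemma herm_kernel_sum_diag n x :
  herm_kernel_sum n x x = n`!%:R *
    ((x ^+ 4 / 24 - (4 * n%:R + 5) / 12 * x ^+ 2
      + (2 * n%:R + 3) * (n%:R + 1) / 3) * herm_fun n x ^+ 2
     + ((2 * n%:R + 4) / 3 - x ^+ 2 / 6) * herm_dfun n x ^+ 2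
     - x / 6 * herm_fun n x * herm_dfun n x).
Proof.
elim: n => [|n IHn].
  rewrite /herm_kernel_sum big_ord_recl big_ord0 /herm_prod /herm_fun /herm_dfun.
  have -> : (a 0)^`() = 0 by rewrite /= -(polyC1 R) derivC.
  have a0 z : (a 0).[z] = 1 by rewrite /= -(polyC1 R) hornerC.
  by rewrite !a0 /= ?subn0 !fact0 !horner0; field.
rewrite herm_kernel_sumS IHn herm_kernel_diag /herm_fun /herm_dfun.
have [p [-> -> ->]] := herm_step n x.
have k0 : n.+1%:R != 0 :> R by rewrite pnatr_eq0.
have nE : n%:R = n.+1%:R - 1 :> R by rewrite -natr1 addrK.
rewrite factS natrM -[n.+2%:R]natr1 nE.
move: k0; move: (n.+1%:R) (n`!%:R) ((a n).[x]).
by move=> k c A k0; field.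
Qed.

(** One factor [x - y] clears each kernel by Christoffel-Darboux, two more clear the sum over the
    sizes; the result then involves the single index [n]. *)
Lemma herm_kernel_sum_offdiag n x y :
  (x - y) ^+ 3 * herm_kernel_sum n x y = n`!%:R *
    ((x - y) * ((x * y / 2 + (x - y) ^+ 2 / 2 - (2 * n%:R + 1)) * herm_fun n x * herm_fun n y
       - 2 * herm_dfun n x * herm_dfun n y)
     - ((x - y) ^+ 2 + 2) * (herm_dfun n x * herm_fun n y - herm_fun n x * herm_dfun n y)).
Proof.
elim: n => [|n IHn].
  rewrite /herm_kernel_sum big_ord_recl big_ord0 /herm_prod /herm_fun /herm_dfun.
  have -> : (a 0)^`() = 0 by rewrite /= -(polyC1 R) derivC.
  have a0 z : (a 0).[z] = 1 by rewrite /= -(polyC1 R) hornerC.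
  by rewrite !a0 /= ?subn0 !fact0 !horner0; field.
rewrite herm_kernel_sumS mulrDr IHn.
have -> : (x - y) ^+ 3 * herm_kernel n.+1 x y =
    (x - y) ^+ 2 * (n.+2`!%:R * ((a n.+2).[x] * (a n.+1).[y] - (a n.+1).[x] * (a n.+2).[y])).
  have := christoffel_darboux n.+2 x y; rewrite !deriv_hermite_fact => <-.
  by rewrite /herm_kernel /herm_prod; ring.
rewrite /herm_fun /herm_dfun.
have := hermite_fact_raise_horner n.+1 x; have := hermite_fact_raise_horner n.+1 y.
have [p [-> -> ->]] := herm_step n x; have [q [-> -> ->]] := herm_step n y.
have k0 : n.+1%:R != 0 :> R by rewrite pnatr_eq0.
move=> hy hx.
have -> : n.+2`!%:R * ((a n.+2).[x] * ((y * (a n).[y] - q) / n.+1%:R)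
      - (x * (a n).[x] - p) / n.+1%:R * (a n.+2).[y]) =
   n.+1`!%:R * ((n.+2%:R * (a n.+2).[x]) * ((y * (a n).[y] - q) / n.+1%:R)
      - (x * (a n).[x] - p) / n.+1%:R * (n.+2%:R * (a n.+2).[y])) :> R.
  by rewrite [n.+2`!]factS natrM; ring.
have nE : n%:R = n.+1%:R - 1 :> R by rewrite -natr1 addrK.
rewrite hx hy factS natrM nE {hx hy nE}.
move: k0; move: (n.+1%:R) (n`!%:R) ((a n).[x]) ((a n).[y]).
by move=> k c A B k0; field.
Qed.

End hermite_sums.

(** * Calculus and elementary bounds *)

Section pointwise_derivatives.
Context {R : realType}.
Implicit Types (f g : R -> R) (x a b c : R).

Lemma der_comp f g x a b : is_derive x 1 f a -> is_derive (f x) 1 g b ->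
  is_derive x 1 (fun t => g (f t)) (b * a).
Proof. by move=> df dg; exact: is_derive1_comp. Qed.

Lemma der_continuous f x a : is_derive x 1 f a -> {for x, continuous f}.
Proof.
move=> df; apply: differentiable_continuous; apply/derivable1_diffP.
exact: (@ex_derive _ _ _ _ _ _ _ df).
Qed.

End pointwise_derivatives.

Ltac der_tac := apply: is_derive_eq; rewrite /GRing.scale /=.

Section calculus.
Context {R : realType}.
Local Notation mu := (@lebesgue_measure R).
Lemma continuous_integrable_cc (f : R -> R) (a b : R) : continuous f ->
  mu.-integrable `[a, b] (EFin \o f).
Proof.
move=> cf; apply: continuous_compact_integrable; first exact: segment_compact.
exact: continuous_subspaceT.
Qed.

Lemma Rintegral_ccZ (f : R -> R) (a b c : R) : continuous f ->
  \int[mu]_(t in `[a, b]) (c * f t) = c * \int[mu]_(t in `[a, b]) f t.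
Proof. by move=> cf; rewrite RintegralZl //; exact: continuous_integrable_cc. Qed.

Lemma Rintegral_ccD (f g : R -> R) (a b : R) : continuous f -> continuous g ->
  \int[mu]_(t in `[a, b]) (f t + g t) =
  \int[mu]_(t in `[a, b]) f t + \int[mu]_(t in `[a, b]) g t.
Proof. by move=> cf cg; rewrite RintegralD //; exact: continuous_integrable_cc. Qed.

Lemma continuous_Zf (f : R -> R) (c : R) : continuous f -> continuous (fun t => c * f t).
Proof. by move=> cf t; apply: cvgM; [exact: cvg_cst | exact: cf]. Qed.

Lemma continuous_Df (f g : R -> R) : continuous f -> continuous g ->
  continuous (fun t => f t + g t).
Proof. by move=> cf cg t; apply: cvgD; [exact: cf | exact: cg]. Qed.

Lemma Rintegral_FTC (F f : R -> R) (a b : R) : a <= b ->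
  (forall t : R, is_derive t 1 F (f t)) -> continuous f ->
  \int[mu]_(t in `[a, b]) f t = F b - F a.
Proof.
move=> ab dF cf; move: ab; rewrite le_eqVlt => /predU1P[<-|ab].
  by rewrite set_itv1 Rintegral_set1 subrr.
have cF : continuous F by move=> t; exact: der_continuous (dF t).
rewrite /Rintegral (@continuous_FTC2 R f F a b) //.
- exact: continuous_subspaceT.
- split.
  + by move=> x _; exact: (@ex_derive _ _ _ _ _ _ _ (dF x)).
  + by apply: cvg_at_right_filter; exact: cF.
  + by apply: cvg_at_left_filter; exact: cF.
- by move=> x _; rewrite derive1E (@derive_val _ _ _ _ _ _ _ (dF x)).
Qed.

Lemma is_derive_integral (B : set R) (f D : R -> R -> R) (G : R -> R) (u v a : R) :
  measurable B ->
  (forall x, u < x < v -> mu.-integrable B (EFin \o f x)) ->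
  (forall x y : R, u < x < v -> B y -> is_derive x 1 (f ^~ y) (D x y)) ->
  mu.-integrable B (EFin \o G) -> (forall y, 0 <= G y) ->
  (forall x y, u < x < v -> B y -> `|D x y| <= G y) -> u < a < v ->
  is_derive a 1 (fun x => \int[mu]_(y in B) f x y) (\int[mu]_(y in B) D a y).
Proof.
move=> mB intf df intG G0 DG auv.
have d1 x y : u < x < v -> B y -> partial1of2 f x y = D x y.
  by move=> xuv By; rewrite partial1of2E (@derive_val _ _ _ _ _ _ _ (df x y xuv By)).
have Ia : `]u, v[%classic a by rewrite /= in_itv.
have H : h^-1 *: ((\int[mu]_(y in B) f (h + a) y) - (\int[mu]_(y in B) f a y)) @[h --> 0^']
    --> \int[mu]_(y in B) D a y.
  rewrite (_ : \int[mu]_(y in B) D a y = \int[mu]_(y in B) partial1of2 f a y); last first.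
    by apply: eq_Rintegral => y /set_mem By; rewrite d1.
  apply: (@cvg_differentiation_under_integral R _ _ mu f B mB a u v Ia _ _ G G0 intG).
  - by move=> x; rewrite /= in_itv /= => xuv; exact: intf.
  - move=> x y; rewrite /= in_itv /= => xuv By.
    exact: (@ex_derive _ _ _ _ _ _ _ (df x y xuv By)).
  - by move=> x y; rewrite /= in_itv /= => xuv By; rewrite d1 // DG.
have E : (fun h : R => h^-1 *: (((fun x => \int[mu]_(y in B) f x y) \o shift a) (h *: 1)
      - \int[mu]_(y in B) f a y)) =
   (fun h => h^-1 *: ((\int[mu]_(y in B) f (h + a) y) - (\int[mu]_(y in B) f a y))).
  by apply/funext => h; rewrite /= /shift /= scaler1.
apply: DeriveDef; first by rewrite /derivable E; apply/cvg_ex; exists (\int[mu]_(y in B) D a y).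
by rewrite /derive E; exact: cvg_lim.
Qed.

Lemma dominated_Rintegral_cvg (B : set R) (f_ : nat -> R -> R) (f G : R -> R) :
  measurable B -> (forall n, measurable_fun B (f_ n)) -> measurable_fun B f ->
  (forall t, B t -> f_ n t @[n --> \oo] --> f t) ->
  mu.-integrable B (EFin \o G) ->
  (forall n t, B t -> `|f_ n t| <= G t) ->
  (\int[mu]_(t in B) f_ n t) @[n --> \oo] --> \int[mu]_(t in B) f t.
Proof.
move=> mB mf_ mf cf intG fG.
have [||||| intf _ H] := @dominated_convergence _ _ R mu B mB (fun n => EFin \o f_ n) (EFin \o f) (EFin \o G).
- by move=> n; apply/measurable_EFinP; exact: mf_.
- by apply/measurable_EFinP; exact: mf.
- by apply: aeW => t Bt; apply: cvg_EFin; [exact: nearW|exact: cf].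
- by [].
- by apply: aeW => t n Bt; rewrite /= lee_fin fG.
apply: fine_cvg; rewrite /Rintegral fineK //.
exact: integrable_fin_num.
Qed.

Lemma integrable_oneDsqrV : mu.-integrable `[0, +oo[ (fun t => (1 + t ^+ 2)^-1%:E).
Proof.
apply/integrableP; split.
  apply/measurable_EFinP; apply: measurable_funTS; apply: continuous_measurable_fun.
  exact: continuous_oneDsqrV.
under eq_integral do rewrite /= ger0_norm ?invr_ge0 ?addr_ge0 ?sqr_ge0 //.
have := @integral0y_oneDsqr R; rewrite /oneDsqr /= => ->.
by rewrite ltry.
Qed.

(* From [expR u >= (1 + u / 4) ^+ 4]. *)
Lemma expRN_sqr_le (c t : R) : 0 < c <= 4 ->
  expR (- (c * t ^+ 2)) <= (4 / c) ^+ 4 / (1 + t ^+ 2) ^+ 4.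
Proof.
move=> /andP[c0 c4]; have t2 : 0 <= t ^+ 2 by rewrite sqr_ge0.
rewrite expRN -[leRHS]invrK lef_pV2 ?posrE ?expR_gt0 ?invr_gt0 ?divr_gt0 ?exprn_gt0 ?divr_gt0 ?ltr_wpDr //.
rewrite invf_div -expr_div_n.
have -> : c * t ^+ 2 = 4%:R * (c * t ^+ 2 / 4) by field.
rewrite expRM_natl; apply: lerXn2r.
- by rewrite nnegrE divr_ge0 ?divr_ge0 ?addr_ge0 // ltW.
- by rewrite nnegrE expR_ge0.
apply: le_trans (expR_ge1Dx _); rewrite invf_div.
have : 0 <= c * t ^+ 2 by rewrite mulr_ge0 // ltW.
lra.
Qed.

End calculus.

Section trig_bounds.
Context {R : realType}.
Implicit Types (t x : R).

Lemma ge0_of_derive (f df : R -> R) t : (forall x : R, is_derive x 1 f (df x)) ->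
  f 0 = 0 -> (forall x, 0 <= x -> 0 <= df x) -> 0 <= t -> 0 <= f t.
Proof.
move=> d f0 df0; rewrite le_eqVlt => /predU1P[<-|t0]; first by rewrite f0.
have cf : {within `[0, t], continuous f}.
  by apply: continuous_subspaceT => s; exact: der_continuous (d s).
have [s] := MVT t0 (fun s _ => d s) cf.
rewrite in_itv /= f0 subr0 => /andP[s0 _] ->.
by rewrite subr0 mulr_ge0 ?df0 // ltW.
Qed.

(** Start of a chain of Taylor bounds up to order 5: each difference vanishes at 0 and has the
    preceding one as its derivative. *)
Lemma sin_le t : 0 <= t -> sin t <= t.
Proof.
move=> t0; rewrite -subr_ge0.
have d (x : R) : is_derive x 1 (fun t => t - sin t) (1 - cos x).
  by der_tac; field.
apply: (ge0_of_derive d _ _ t0) => /=; first by rewrite sin0 subrr.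
by move=> x _; rewrite subr_ge0 cos_le1.
Qed.

Lemma cos_ge t : 0 <= t -> 1 - cos t <= t ^+ 2 / 2.
Proof.
move=> t0; rewrite -subr_ge0.
have d (x : R) : is_derive x 1 (fun t => t ^+ 2 / 2 - (1 - cos t)) (x - sin x).
  by der_tac; field.
apply: (ge0_of_derive d _ _ t0) => /=; first by rewrite cos0; ring.
by move=> x x0; rewrite subr_ge0 sin_le.
Qed.

Lemma sin_ge t : 0 <= t -> t - sin t <= t ^+ 3 / 6.
Proof.
move=> t0; rewrite -subr_ge0.
have d (x : R) : is_derive x 1 (fun t => t ^+ 3 / 6 - (t - sin t)) (x ^+ 2 / 2 - (1 - cos x)).
  by der_tac; field.
apply: (ge0_of_derive d _ _ t0) => /=; first by rewrite sin0; ring.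
by move=> x x0; rewrite subr_ge0 cos_ge.
Qed.

Lemma cos_le t : 0 <= t -> t ^+ 2 / 2 - (1 - cos t) <= t ^+ 4 / 24.
Proof.
move=> t0; rewrite -subr_ge0.
have d (x : R) : is_derive x 1 (fun t => t ^+ 4 / 24 - (t ^+ 2 / 2 - (1 - cos t))) (x ^+ 3 / 6 - (x - sin x)).
  by der_tac; field.
apply: (ge0_of_derive d _ _ t0) => /=; first by rewrite cos0; ring.
by move=> x x0; rewrite subr_ge0 sin_ge.
Qed.

Lemma sin_le3 t : 0 <= t -> t ^+ 3 / 6 - (t - sin t) <= t ^+ 5 / 120.
Proof.
move=> t0; rewrite -subr_ge0.
have d (x : R) : is_derive x 1 (fun t => t ^+ 5 / 120 - (t ^+ 3 / 6 - (t - sin t))) (x ^+ 4 / 24 - (x ^+ 2 / 2 - (1 - cos x))).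
  by der_tac; field.
apply: (ge0_of_derive d _ _ t0) => /=; first by rewrite sin0; ring.
by move=> x x0; rewrite subr_ge0 cos_le.
Qed.

Lemma pi_le4 : pi <= 4 :> R.
Proof.
have d (x : R) : is_derive x 1 (fun t => t - atan t) (1 - (1 + x ^+ 2)^-1) by der_tac.
have : 0 <= 1 - atan 1 :> R.
  apply: (ge0_of_derive d _ _ ler01) => /=; first by rewrite atan0 subrr.
  move=> x _; rewrite subr_ge0 invf_le1 ?lerDl ?sqr_ge0 //.
  by rewrite ltr_wpDr ?sqr_ge0.
rewrite atan1; lra.
Qed.

(** [1 - cos t = 2 sin (t / 2) ^+ 2], and [sin u >= u / 3] for [0 <= u <= 2]. Valid on the whole
    half-circle, it gives Gaussian domination without splitting off the neighbourhood of the
    saddle. *)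
Lemma onem_cos_ge t : 0 <= t <= pi -> t ^+ 2 / 18 <= 1 - cos t.
Proof.
move=> /andP[t0 tpi].
have -> : 1 - cos t = 2 * sin (t / 2) ^+ 2.
  have -> : cos t = cos (t / 2 + t / 2) by congr cos; field.
  rewrite cosD; have := cos2Dsin2 (t / 2); rewrite -!expr2; lra.
have t20 : 0 <= t / 2 by rewrite divr_ge0.
have h : t / 2 / 3 <= sin (t / 2).
  have := sin_ge t20; have t22 : t / 2 <= 2 by have := pi_le4; lra.
  have : (t / 2) ^+ 3 <= 4 * (t / 2).
    by rewrite exprSr ler_wpM2r // (_ : 4 = 2 ^+ 2) ?lerXn2r ?nnegrE //; ring.
  lra.
have : (t / 2 / 3) ^+ 2 <= sin (t / 2) ^+ 2 by apply: lerXn2r; rewrite ?nnegrE ?divr_ge0 // (le_trans _ h) ?divr_ge0.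
by rewrite !expr_div_n; lra.
Qed.

(** The remainder has derivative [s ^+ 3 / (1 - s)]. Three terms are kept because the logarithm is
    later multiplied by [N] at [h = N^(-1/3)]: the cubic term survives as the constant [1/3]. *)
Lemma ln_expand (h : R) : 0 <= h <= 2^-1 ->
  0 <= - ln (1 - h) - h - h ^+ 2 / 2 - h ^+ 3 / 3 <= 2 * h ^+ 4.
Proof.
move=> /andP[h0 h2]; pose G (h : R) := - ln (1 - h) - h - h ^+ 2 / 2 - h ^+ 3 / 3.
move: h0; rewrite le_eqVlt => /predU1P[<-|h0].
  by rewrite (subr0 1) ln1; lra.
have d (s : R) : s < 1 -> is_derive s 1 G (s ^+ 3 / (1 - s)).
  move=> s1; have s10 : 0 < 1 - s by rewrite subr_gt0.
  have dl := is_derive1_ln s10.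
  have dc : is_derive s 1 (fun s => ln (1 - s)) ((1 - s)^-1 * -1).
    have d1 : is_derive s 1 (fun s => 1 - s) (- 1) by der_tac; ring.
    exact: (der_comp d1 dl).
  rewrite /G; der_tac.
  by field; rewrite gt_eqF.
have cG : {within `[0, h], continuous G}.
  apply: derivable_within_continuous => s; rewrite in_itv /= => /andP[_ sh].
  have s1 : s < 1 by lra.
  exact: (@ex_derive _ _ _ _ _ _ _ (d s s1)).
have lt1 s : s \in `]0, h[ -> s < 1 by rewrite in_itv /= => /andP[_ sh]; lra.
have [s] := MVT h0 (fun s hs => d s (lt1 s hs)) cG.
rewrite in_itv /= => /andP[s0 sh].
have -> : G 0 = 0 by rewrite /G (subr0 1) ln1; ring.
rewrite !subr0 -/(G h) => ->.
have s10 : 0 < 1 - s by lra.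
apply/andP; split; first by rewrite mulr_ge0 ?divr_ge0 ?exprn_ge0 ?ltW.
rewrite (exprSr h 3) mulrA; apply: ler_wpM2r; first exact: ltW.
rewrite ler_pdivrMr // mulrAC -[X in X <= _]mul1r.
apply: ler_pM => //; first by rewrite exprn_ge0 // ltW.
  lra.
by rewrite lerXn2r ?nnegrE ?ltW.
Qed.

End trig_bounds.

(** * Circle integrals at the edge *)

Section circle_integral.
Context {R : realType}.
Local Notation mu := (@lebesgue_measure R).
Variables (kp bt x : R).
Hypothesis kp0 : 0 < kp.

(* Real part and argument of [w^-k exp(x w - bt w^2/2)] at [w = r exp(i t / kp)],
   without the factor [r^-k]. *)
Definition circ_exp (r t : R) : R := x * r * cos (t / kp) - bt * (r ^+ 2 / 2) * cos (2 * (t / kp)).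
Definition circ_arg (k r t : R) : R :=
  x * r * sin (t / kp) - bt * (r ^+ 2 / 2) * sin (2 * (t / kp)) - k * (t / kp).

Definition circ_integrand k r t : R := expR (circ_exp r t) * cos (circ_arg k r t).
Definition circ_int k r : R := \int[mu]_(t in `[0, pi * kp]) circ_integrand k r t.

Lemma circ_arg_pred k r t : circ_arg (k - 1) r t = circ_arg k r t + t / kp.
Proof. by rewrite /circ_arg; ring. Qed.

Lemma circ_arg_pred2 k r t : circ_arg (k - 2) r t = circ_arg k r t + 2 * (t / kp).
Proof. by rewrite /circ_arg; ring. Qed.

Lemma continuous_circ_integrand k r : continuous (circ_integrand k r).
Proof.
by move=> t; apply: (@der_continuous _ _ _ (_ : R)).
Qed.

Lemma integrable_circ_integrand k r :
  mu.-integrable `[0, pi * kp] (EFin \o circ_integrand k r).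
Proof. exact/continuous_integrable_cc/continuous_circ_integrand. Qed.

(** Up to the factor [kp], the combination is an exact derivative in the angle, and its primitive
    contains the sine of an argument that is a multiple of [pi] at both ends. *)
Lemma circ_int_rec k r : sin (k * pi) = 0 ->
  x * r * circ_int (k - 1) r - bt * r ^+ 2 * circ_int (k - 2) r = k * circ_int k r.
Proof.
move=> sk; have kn0 : kp != 0 by rewrite gt_eqF.
pose f t := x * r * circ_integrand (k - 1) r t
  + ((- (bt * r ^+ 2)) * circ_integrand (k - 2) r t + (- k) * circ_integrand k r t).
have cC k' : continuous (circ_integrand k' r) by exact: continuous_circ_integrand.
have cf' : continuous f.
  by apply: continuous_Df; [|apply: continuous_Df]; exact: continuous_Zf.
have df (t : R) : is_derive t 1 (fun t => expR (circ_exp r t) * sin (circ_arg k r t)) (kp^-1 * f t).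
  rewrite /circ_exp /circ_arg; der_tac.
  rewrite /f /circ_integrand circ_arg_pred circ_arg_pred2 !(cosD (circ_arg k r t)).
  rewrite /circ_exp /circ_arg; set E := expR _; set S := sin (_ - _ - _).
  by set C := cos (_ - _ - _); field.
have cf : continuous (fun t => kp^-1 * f t) by exact: continuous_Zf.
have : \int[mu]_(t in `[0, pi * kp]) (kp^-1 * f t) = 0.
  rewrite (Rintegral_FTC _ df cf); last by rewrite mulr_ge0 ?pi_ge0 // ltW.
  rewrite /circ_arg mulfK // !mul0r !mulr0 sinpi sin0 mulr0.
  rewrite mulr_natl sin2pi !mulr0 !subr0 sub0r sinN sk oppr0 !mulr0.
  by rewrite sin0 mulr0 subrr.
rewrite Rintegral_ccZ // => /eqP; rewrite mulf_eq0 invr_eq0 (negbTE kn0) /= => /eqP.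
rewrite Rintegral_ccD; [|exact: continuous_Zf|by apply: continuous_Df; exact: continuous_Zf].
rewrite Rintegral_ccD; [|exact: continuous_Zf|exact: continuous_Zf].
rewrite !Rintegral_ccZ // -!/(circ_int _ _) => H.
by apply/eqP; rewrite -subr_eq0 -H; apply/eqP; ring.
Qed.

(** For integer [k], together with [circ_int_rec], [r] times the derivative is [k] times the
    integral: the homogeneity that analyticity would give, obtained by real calculus. *)
Lemma is_derive_circ_int (k r : R) :
  is_derive r 1 (circ_int k) (x * circ_int (k - 1) r - bt * r * circ_int (k - 2) r).
Proof.
pose D s t := x * circ_integrand (k - 1) s t + (- (bt * s)) * circ_integrand (k - 2) s t.
pose rho := `|r| + 1.
have cC k' s : continuous (circ_integrand k' s) by exact: continuous_circ_integrand.
have -> : x * circ_int (k - 1) r - bt * r * circ_int (k - 2) r =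
    \int[mu]_(t in `[0, pi * kp]) D r t.
  rewrite Rintegral_ccD; [|exact: continuous_Zf|exact: continuous_Zf].
  by rewrite !Rintegral_ccZ // mulNr.
pose G : R -> R := cst (expR (`|x| * rho + `|bt| * rho ^+ 2) * (`|x| + `|bt| * rho)).
apply: (@is_derive_integral _ _ (circ_integrand k) D G (r - 1) (r + 1)) => //.
- by move=> s _; exact: integrable_circ_integrand.
- move=> s t _ _; rewrite /circ_integrand /circ_exp /circ_arg; der_tac.
  rewrite /D /circ_integrand circ_arg_pred circ_arg_pred2 !(cosD (circ_arg k s t)).
  rewrite /circ_exp /circ_arg; set E := expR _; set S := sin (_ - _ - _).
  by set C := cos (_ - _ - _); field.
- exact/continuous_integrable_cc/cst_continuous.
- by move=> y; rewrite /G /= mulr_ge0 ?expR_ge0 // addr_ge0 // mulr_ge0 // /rho addr_ge0.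
- move=> s t /andP[rs sr] _.
  have srho : `|s| <= rho by rewrite /rho; have := ler_norm r; have := ler_norm (- r); rewrite normrN ler_norml; lra.
  have rho0 : 0 <= rho by rewrite /rho addr_ge0.
  have cb k' : `|circ_integrand k' s t| <= expR (`|x| * rho + `|bt| * rho ^+ 2).
    rewrite /circ_integrand normrM (ger0_norm (expR_ge0 _)) -[leRHS]mulr1.
    apply: ler_pM; rewrite ?expR_ge0 ?cos_max // ler_expR /circ_exp lerD //.
      apply: le_trans (ler_norm _) _; rewrite !normrM -[leRHS]mulr1.
      by apply: ler_pM; rewrite ?mulr_ge0 ?cos_max // ler_wpM2l.
    apply: le_trans (ler_norm _) _; rewrite normrN normrM -[leRHS]mulr1.
    apply: ler_pM; rewrite ?cos_max // normrM ler_wpM2l //.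
    rewrite normrM normfV normrX -[leRHS]mulr1; apply: ler_pM; rewrite ?invr_ge0 ?exprn_ge0 ?lerXn2r ?nnegrE //.
    by rewrite ger0_norm // invf_le1 // ler1n.
  rewrite /D /G /= mulrDr; apply: le_trans (ler_normD _ _) _.
  rewrite (normrM x) (normrM (- (bt * s))) normrN (normrM bt).
  by apply: lerD; rewrite [leRHS]mulrC; apply: ler_pM; rewrite ?mulr_ge0 // ler_wpM2l.
- by rewrite ltrBlDr !ltrDl ltr01.
Qed.

Lemma circ_int0 r : 0 <= r -> circ_int 0 r = pi * kp.
Proof.
move=> r0.
have c00 : circ_int 0 0 = pi * kp.
  rewrite /circ_int /circ_integrand /circ_exp /circ_arg.
  under eq_Rintegral do rewrite !(mulr0, mul0r, expr0n, subr0, expR0, cos0, mulr1) /=.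
  rewrite Rintegral_cst //= lebesgue_measure_itv /= lte_fin mulr_gt0 ?pi_gt0 //.
  by rewrite sube0 /= mul1r.
move: r0; rewrite le_eqVlt => /predU1P[<- //|r0].
have d s := is_derive_circ_int 0 s.
have cJ : {within `[0, r], continuous (circ_int 0)}.
  by apply: continuous_subspaceT => s; exact: der_continuous (d s).
have [s] := MVT r0 (fun s _ => d s) cJ.
rewrite in_itv /= => /andP[s0 sr] /eqP.
rewrite c00 subr_eq => /eqP ->.
have := @circ_int_rec 0 s; rewrite mul0r sin0 mul0r => /(_ erefl) H.
have -> : x * circ_int (0 - 1) s - bt * s * circ_int (0 - 2) s = 0.
  by apply: (mulfI (lt0r_neq0 s0)); rewrite mulr0; apply: etrans H; ring.
by rewrite mul0r add0r.
Qed.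

(** A coefficient of negative index: by homogeneity its product with [r] is constant, hence equal to
    its value 0 at the origin. *)
Lemma circ_intN1 r : 0 <= r -> r * circ_int (- 1) r = 0.
Proof.
move=> r0.
have d (s : R) : is_derive s 1 (fun s => s * circ_int (- 1) s) 0.
  have ds := is_derive_circ_int (- 1) s.
  der_tac.
  have := @circ_int_rec (- 1) s; rewrite mulN1r sinN sinpi oppr0 mulN1r => /(_ erefl) H.
  transitivity (circ_int (-1) s + (x * s * circ_int (-1 - 1) s - bt * s ^+ 2 * circ_int (-1 - 2) s)).
    by ring.
  by rewrite H subrr.
move: r0; rewrite le_eqVlt => /predU1P[<-|r0]; first by rewrite mul0r.
have cJ : {within `[0, r], continuous (fun s => s * circ_int (- 1) s)}.
  by apply: continuous_subspaceT => s; exact: der_continuous (d s).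
have [s _] := MVT r0 (fun s _ => d s) cJ.
by rewrite !mul0r subr0.
Qed.

(** Cauchy's formula for the Taylor coefficients of [exp(x w - bt w^2/2)], by matching three-term
    recurrences. It serves twice: [bt = 1] gives the Hermite polynomials, [bt = 0] the reciprocal
    factorials for Stirling's formula. *)
Lemma circ_int_coef (c : nat -> R) : c 0%N = 1 -> c 1%N = x ->
  (forall n, n.+2%:R * c n.+2 = x * c n.+1 - bt * c n) ->
  forall n r, 0 <= r -> circ_int n%:R r = pi * kp * r ^+ n * c n.
Proof.
move=> c0 c1 cS n r r0.
elim/ltn_ind: n => -[_|[_|n IHn]].
- by rewrite circ_int0 // expr0 c0 !mulr1.
- have := @circ_int_rec 1 r; rewrite mul1r sinpi mul1r => /(_ erefl) <-.
  rewrite (_ : 1 - 1 = 0) ?subrr // circ_int0 // (_ : 1 - 2 = -1 :> R); last by ring.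
  by rewrite expr2 -(mulrA bt) -(mulrA r r) circ_intN1 // c1; ring.
have n20 : n.+2%:R != 0 :> R by rewrite pnatr_eq0.
apply: (mulfI n20).
have := @circ_int_rec n.+2%:R r.
rewrite (_ : sin (n.+2%:R * pi) = 0); last first.
  by elim: (n.+2) => [|m IHm]; rewrite ?mul0r ?sin0 // -natr1 mulrDl mul1r sinDpi IHm oppr0.
move=> /(_ erefl) <-.
rewrite (_ : n.+2%:R - 1 = n.+1%:R :> R); last by rewrite -[n.+2%:R]natr1 addrK.
rewrite (_ : n.+2%:R - 2 = n%:R :> R); last by rewrite -[n.+2]addn2 natrD addrK.
rewrite IHn // IHn // [RHS]mulrCA cS !exprS; ring.
Qed.

End circle_integral.

Lemma circ_int_hermite (R : realType) (kp x : R) n r : 0 < kp -> 0 <= r ->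
  circ_int kp 1 x n%:R r = pi * kp * r ^+ n * herm_fun n x.
Proof.
move=> kp0 r0; apply: (@circ_int_coef _ _ _ _ kp0 (fun n => herm_fun n x)) => //.
- by rewrite /herm_fun /= -(polyC1 R) hornerC.
- by rewrite /herm_fun /= hornerX.
- by move=> m; rewrite mul1r hermite_fact_rec.
Qed.

Lemma circ_int_exp (R : realType) (kp x : R) n r : 0 < kp -> 0 <= r ->
  circ_int kp 0 x n%:R r = pi * kp * r ^+ n * (x ^+ n / n`!%:R).
Proof.
move=> kp0 r0; apply: (@circ_int_coef _ _ _ _ kp0 (fun n => x ^+ n / n`!%:R)) => //.
- by rewrite fact0 expr0 divr1.
- by rewrite factS fact0 expr1 divr1.
move=> m; rewrite mul0r subr0 [m.+2`!]factS natrM exprS.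
have : m.+1`!%:R != 0 :> R by rewrite pnatr_eq0 -lt0n fact_gt0.
have : m.+2%:R != 0 :> R by rewrite pnatr_eq0.
by move: (m.+1`!%:R) (m.+2%:R) => u v v0 u0; field; rewrite ?u0 ?v0.
Qed.

Section sequence_limits.
Context {R : realType}.
Implicit Types (f g : nat -> R) (a b : R).

Lemma seq_cst a : (fun _ : nat => a) n @[n --> \oo] --> a.
Proof. exact: cvg_cst. Qed.

Lemma seqD f g a b : f n @[n --> \oo] --> a -> g n @[n --> \oo] --> b ->
  f n + g n @[n --> \oo] --> a + b.
Proof. by move=> fa gb; exact: cvgD. Qed.

Lemma seqN f a : f n @[n --> \oo] --> a -> - f n @[n --> \oo] --> - a.
Proof. by move=> fa; exact: cvgN. Qed.

Lemma seqB f g a b : f n @[n --> \oo] --> a -> g n @[n --> \oo] --> b ->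
  f n - g n @[n --> \oo] --> a - b.
Proof. by move=> fa gb; exact: cvgB. Qed.

Lemma seqM f g a b : f n @[n --> \oo] --> a -> g n @[n --> \oo] --> b ->
  f n * g n @[n --> \oo] --> a * b.
Proof. by move=> fa gb; exact: cvgM. Qed.

Lemma seqX f a m : f n @[n --> \oo] --> a -> f n ^+ m @[n --> \oo] --> a ^+ m.
Proof.
move=> fa; elim: m => [|m IHm]; first by under eq_fun do rewrite expr0; exact: cvg_cst.
by under eq_fun do rewrite exprS; rewrite exprS; exact: cvgM.
Qed.

End sequence_limits.
Arguments seq_cst {R} a.

Section edge_limits.
Context {R : realType}.

Variables (mu : R) (h q1 q2 s1 : nat -> R) (l1 l2 l3 : R).
Hypotheses (hl : h n @[n --> \oo] --> (0 : R)) (q1l : q1 n @[n --> \oo] --> l1)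
  (q2l : q2 n @[n --> \oo] --> l2) (s1l : s1 n @[n --> \oo] --> l3).

Lemma cvg_edge_exp : (- q1 n) * (2 + (mu - 2) * h n - mu * h n ^+ 2
    + (h n - 2 * h n ^+ 2 + h n ^+ 3) * q1 n) @[n --> \oo] -->
  - l1 * (2 + (mu - 2) * 0 - mu * 0 ^+ 2 + (0 - 2 * 0 ^+ 2 + 0 ^+ 3) * l1).
Proof.
exact: (seqM (seqN q1l) (seqD (seqB (seqD (seq_cst 2) (seqM (seq_cst (mu - 2)) hl)) (seqM (seq_cst mu) (seqX (m := 2%N) hl)))
  (seqM (seqD (seqB hl (seqM (seq_cst 2) (seqX (m := 2%N) hl))) (seqX (m := 3%N) hl)) q1l))).
Qed.

Lemma cvg_edge_arg : q2 n + ((mu - 1) - mu * h n) * s1 n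
    + (1 - 2 * h n + h n ^+ 2) * s1 n * q1 n @[n --> \oo] -->
  l2 + ((mu - 1) - mu * 0) * l3 + (1 - 2 * 0 + 0 ^+ 2) * l3 * l1.
Proof.
exact: (seqD (seqD q2l (seqM (seqB (seq_cst (mu - 1)) (seqM (seq_cst mu) hl)) s1l))
  (seqM (seqM (seqD (seqB (seq_cst 1) (seqM (seq_cst 2) hl)) (seqX (m := 2%N) hl)) s1l) q1l)).
Qed.

Lemma cvg_edge_dcos : - 1 - (1 - h n) * h n * q1 n - mu / 2 * h n @[n --> \oo] -->
  - 1 - (1 - 0) * 0 * l1 - mu / 2 * 0.
Proof.
exact: (seqB (seqB (seq_cst (- 1)) (seqM (seqM (seqB (seq_cst 1) hl) hl) q1l)) (seqM (seq_cst (mu / 2)) hl)).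
Qed.

Lemma cvg_edge_dsin : - (1 - h n) * s1 n @[n --> \oo] --> - (1 - 0) * l3.
Proof.
exact: (seqM (seqN (seqB (seq_cst 1) hl)) s1l).
Qed.

End edge_limits.

Section edge_phase_dct.
Context {R : realType}.
Local Notation lmu := (@lebesgue_measure R).

(** The integrands are extended by zero to the half-line, where [1 / (1 + t ^+ 2)] is integrable; at
    a fixed [t] the cut-off is eventually 1. *)
Lemma dominated_growing_cvg (k_ : nat -> R) (g_ : nat -> R -> R) (g : R -> R) (K : R) :
  k_ n @[n --> \oo] --> +oo -> (forall n, continuous (g_ n)) -> continuous g ->
  (forall t, 0 <= t -> g_ n t @[n --> \oo] --> g t) -> 0 <= K ->
  (forall n t, 0 <= t <= pi * k_ n -> `|g_ n t| <= K / (1 + t ^+ 2)) ->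
  \int[lmu]_(t in `[0, pi * k_ n]) g_ n t @[n --> \oo] --> \int[lmu]_(t in `[0, +oo[) g t.
Proof.
move=> ky cg_ cg gl K0 gK.
pose f_ n t := \1_(`[0, pi * k_ n]) t * g_ n t : R.
have -> : (fun n => \int[lmu]_(t in `[0, pi * k_ n]) g_ n t) =
    (fun n => \int[lmu]_(t in `[0, +oo[) f_ n t).
  apply/funext => n.
  have -> : `[0, pi * k_ n]%classic = `[0, +oo[ `&` `[0, pi * k_ n] :> set R.
    by apply/seteqP; split=> t /=; rewrite !in_itv /= andbT; [case/andP=> -> -> | case].
  rewrite Rintegral_mkcondr; apply: eq_Rintegral => t _.
  by rewrite patchE /f_ indicE; case: ifPn; rewrite ?mul1r ?mul0r.
apply: (@dominated_Rintegral_cvg _ _ _ _ (fun t => K * (1 + t ^+ 2)^-1)) => //.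
- move=> n; apply: measurable_funTS; apply: measurable_funM.
    exact: measurable_indic.
  exact: continuous_measurable_fun.
- by apply: measurable_funTS; exact: continuous_measurable_fun.
- move=> t; rewrite /= in_itv /= andbT => t0.
  apply: cvg_trans (gl t t0); apply: near_eq_cvg.
  have : \forall n \near \oo, t / pi <= k_ n by move/cvgryPge : ky; apply.
  apply: filterS => n tk; rewrite /f_ indicE mem_set ?mul1r //=.
  by rewrite in_itv /= t0 mulrC -ler_pdivrMr ?pi_gt0.
- apply: (integrableZl _ K (@integrable_oneDsqrV R)) => //.
- move=> n t; rewrite /= in_itv /= andbT => t0; rewrite /f_ indicE.
  have [|tk] := boolP (t \in `[0, pi * k_ n]%classic).
    by rewrite inE /= in_itv /= => tk; rewrite mul1r gK.
  by rewrite mul0r normr0 mulr_ge0 // invr_ge0 addr_ge0 // sqr_ge0.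
Qed.

End edge_phase_dct.

(** Rescaled trigonometric functions of the angle [t / k]: [edge_q1], [edge_q2], [edge_s1] tend to
    [t^2/2], [- t^3/6] and [t]. The phases at the edge are polynomials in these and [1/k]. *)
Definition edge_q1 (R : realType) (k t : R) : R := k ^+ 2 * (1 - cos (t / k)).
Definition edge_q2 (R : realType) (k t : R) : R := k ^+ 3 * (sin (t / k) - t / k).
Definition edge_s1 (R : realType) (k t : R) : R := k * sin (t / k).
Lemma le_div_oneDsqrX (R : realType) (K t : R) : 0 <= K -> K / (1 + t ^+ 2) ^+ 4 <= K / (1 + t ^+ 2).
Proof.
move=> K0; have t1 : 1 <= 1 + t ^+ 2 by rewrite lerDl sqr_ge0.
rewrite ler_wpM2l // lef_pV2 ?posrE ?exprn_gt0 ?(lt_le_trans ltr01) //.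
by rewrite (exprS (1 + t ^+ 2) 3); apply: ler_peMr; [exact: le_trans t1 | exact: exprn_ege1].
Qed.

Section growing_scale.
Context {R : realType}.
Variable k_ : nat -> R.
Hypothesis k_ge1 : forall n, 1 <= k_ n.
Hypothesis k_y : k_ n @[n --> \oo] --> +oo.

Let k_gt0 n : 0 < k_ n. Proof. exact: lt_le_trans (k_ge1 n). Qed.

Lemma inv_scale_cvg : (k_ n)^-1 @[n --> \oo] --> 0.
Proof. by apply/gtr0_cvgV0 => //; exact: nearW. Qed.

Lemma inv_scale_le1 n : 0 <= (k_ n)^-1 <= 1.
Proof. by rewrite invr_ge0 ltW //= invf_le1. Qed.

Lemma squeeze_inv_scale (f : nat -> R) l C : (forall n, `|f n - l| <= C * (k_ n)^-1) ->
  f n @[n --> \oo] --> l.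
Proof.
move=> fl.
have Ch : C * (k_ n)^-1 @[n --> \oo] --> 0.
  by rewrite -(mulr0 C); apply: cvgM; [exact: cvg_cst | exact: inv_scale_cvg].
apply: (@squeeze_cvgr _ _ _ _ (fun n => l - C * (k_ n)^-1) (fun n => l + C * (k_ n)^-1)).
- by apply: nearW => n; have := fl n; rewrite ler_norml; lra.
- by rewrite -[X in _ --> X](subr0 l); apply: cvgB => //; exact: cvg_cst.
- by rewrite -[X in _ --> X](addr0 l); apply: cvgD => //; exact: cvg_cst.
Qed.

Lemma scaled_ge0 n t : 0 <= t -> 0 <= t / k_ n.
Proof. by move=> t0; rewrite divr_ge0 // ltW. Qed.

Let scaled_bound n t j c D : 0 <= t -> 0 <= c -> 0 <= D <= c * (t / k_ n) ^+ (j + 2) ->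
  `|k_ n ^+ j * D| <= c * t ^+ (j + 2) * (k_ n)^-1.
Proof.
move=> t0 c0 /andP[D0 Dc]; have kj : 0 < k_ n ^+ j by rewrite exprn_gt0.
rewrite ger0_norm; last by rewrite mulr_ge0 // ltW.
apply: (@le_trans _ _ (k_ n ^+ j * (c * (t / k_ n) ^+ (j + 2)))).
  by rewrite ler_wpM2l // ltW.
rewrite (_ : k_ n ^+ j * _ = c * t ^+ (j + 2) * (k_ n)^-1 * (k_ n)^-1); last first.
  by rewrite expr_div_n !exprD; field; rewrite !gt_eqF.
rewrite ler_piMr ?mulr_ge0 ?exprn_ge0 //; first by have /andP[] := inv_scale_le1 n.
by have /andP[] := inv_scale_le1 n.
Qed.

Lemma edge_s1_cvg t : 0 <= t -> edge_s1 (k_ n) t @[n --> \oo] --> t.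
Proof.
move=> t0; apply: (@squeeze_inv_scale _ _ (6^-1 * t ^+ (1 + 2))) => n.
have -> : edge_s1 (k_ n) t - t = - (k_ n ^+ 1 * (t / k_ n - sin (t / k_ n))).
  by rewrite /edge_s1; field; rewrite gt_eqF.
rewrite normrN; apply: scaled_bound => //.
by rewrite subr_ge0 sin_le ?scaled_ge0 //= [X in _ <= X]mulrC sin_ge ?scaled_ge0.
Qed.

Lemma edge_q1_cvg t : 0 <= t -> edge_q1 (k_ n) t @[n --> \oo] --> t ^+ 2 / 2.
Proof.
move=> t0; apply: (@squeeze_inv_scale _ _ (24^-1 * t ^+ (2 + 2))) => n.
have -> : edge_q1 (k_ n) t - t ^+ 2 / 2 =
    - (k_ n ^+ 2 * ((t / k_ n) ^+ 2 / 2 - (1 - cos (t / k_ n)))).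
  by rewrite /edge_q1; field; rewrite gt_eqF.
rewrite normrN; apply: scaled_bound => //.
by rewrite subr_ge0 cos_ge ?scaled_ge0 //= [X in _ <= X]mulrC cos_le ?scaled_ge0.
Qed.

Lemma edge_q2_cvg t : 0 <= t -> edge_q2 (k_ n) t @[n --> \oo] --> - (t ^+ 3 / 6).
Proof.
move=> t0; apply: (@squeeze_inv_scale _ _ (120^-1 * t ^+ (3 + 2))) => n.
have -> : edge_q2 (k_ n) t - - (t ^+ 3 / 6) =
    k_ n ^+ 3 * ((t / k_ n) ^+ 3 / 6 - (t / k_ n - sin (t / k_ n))).
  by rewrite /edge_q2; field; rewrite gt_eqF.
apply: scaled_bound => //.
by rewrite subr_ge0 sin_ge ?scaled_ge0 //= [X in _ <= X]mulrC sin_le3 ?scaled_ge0.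
Qed.

Lemma scaled_le_pi n t : 0 <= t <= pi * k_ n -> 0 <= t / k_ n <= pi.
Proof. by move=> /andP[t0 tk]; rewrite scaled_ge0 //= ler_pdivrMr. Qed.

Lemma edge_q1_ge n t : 0 <= t <= pi * k_ n -> t ^+ 2 / 18 <= edge_q1 (k_ n) t.
Proof.
move=> tk; rewrite (_ : t ^+ 2 / 18 = k_ n ^+ 2 * ((t / k_ n) ^+ 2 / 18)); last first.
  by field; rewrite gt_eqF.
by rewrite ler_wpM2l ?sqr_ge0 // onem_cos_ge // scaled_le_pi.
Qed.

End growing_scale.

Section edge_phase.
Context {R : realType}.
Local Notation lmu := (@lebesgue_measure R).
Variables (mu : R).

(** Exponent on the circle of radius [sqrt N (1 - 1/k)] minus its value at angle 0; [edge_arg] is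
    the argument there. Both are exact: the terms growing with [k] have cancelled, which expresses
    that the saddle point is double. *)
Definition edge_exp (k t : R) : R :=
  - edge_q1 k t * (2 + (mu - 2) * k^-1 - mu * k^-1 ^+ 2
    + (k^-1 - 2 * k^-1 ^+ 2 + k^-1 ^+ 3) * edge_q1 k t).
Definition edge_arg (k t : R) : R :=
  edge_q2 k t + ((mu - 1) - mu * k^-1) * edge_s1 k t
  + (1 - 2 * k^-1 + k^-1 ^+ 2) * edge_s1 k t * edge_q1 k t.
(** Obtained from [(k - 1) cos (arg + t / k) - (k + mu / (2 k)) cos arg], in which the two large
    terms cancel. *)
Definition edge_dcos (k t : R) : R :=
  - 1 - (1 - k^-1) * k^-1 * edge_q1 k t - mu / 2 * k^-1.
Definition edge_dsin (k t : R) : R := - (1 - k^-1) * edge_s1 k t.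

Definition edge_fun (k t : R) : R := expR (edge_exp k t) * cos (edge_arg k t).
Definition edge_dfun (k t : R) : R := expR (edge_exp k t) *
  (edge_dcos k t * cos (edge_arg k t) + edge_dsin k t * sin (edge_arg k t)).

(* Real parts of [exp(i (t+i)^3/3 + i mu (t+i))] and of its mu-derivative,
   up to the factor [exp(1/3 - mu)]. *)
Definition airy_phase (t : R) : R := t ^+ 3 / 3 + (mu - 1) * t.
Definition airy_fun (t : R) : R := expR (- t ^+ 2) * cos (airy_phase t).
Definition airy_dfun (t : R) : R :=
  expR (- t ^+ 2) * (- cos (airy_phase t) - t * sin (airy_phase t)).

Lemma continuous_edge_fun k : continuous (edge_fun k).
Proof. by move=> t; apply: (@der_continuous _ _ _ (_ : R)). Qed.

Lemma continuous_edge_dfun k : continuous (edge_dfun k).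
Proof. by move=> t; apply: (@der_continuous _ _ _ (_ : R)). Qed.

Lemma continuous_airy_fun : continuous airy_fun.
Proof. by move=> t; apply: (@der_continuous _ _ _ (_ : R)). Qed.

Lemma continuous_airy_dfun : continuous airy_dfun.
Proof. by move=> t; apply: (@der_continuous _ _ _ (_ : R)). Qed.

Section limits.
Variable k_ : nat -> R.
Hypothesis k_large : forall n, `|mu| + 3 <= k_ n.
Hypothesis k_y : k_ n @[n --> \oo] --> +oo.

Let k_ge1 n : 1 <= k_ n.
Proof. by have := k_large n; have := normr_ge0 mu; lra. Qed.

Let k_gt0 n : 0 < k_ n. Proof. exact: lt_le_trans (k_ge1 n). Qed.

Let hl := inv_scale_cvg k_ge1 k_y.
Let hle1 := inv_scale_le1 k_ge1.
Let theta_ge0 := scaled_ge0 k_ge1.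
Let theta_bound := scaled_le_pi k_ge1.
Let s1l := edge_s1_cvg k_ge1 k_y.
Let q1l := edge_q1_cvg k_ge1 k_y.
Let q2l := edge_q2_cvg k_ge1 k_y.

Let expl t : 0 <= t -> edge_exp (k_ n) t @[n --> \oo] --> - t ^+ 2.
Proof.
move=> t0; rewrite (_ : - t ^+ 2 = - (t ^+ 2 / 2) * (2 + (mu - 2) * 0 - mu * 0 ^+ 2
    + (0 - 2 * 0 ^+ 2 + 0 ^+ 3) * (t ^+ 2 / 2))); last by field.
exact: (cvg_edge_exp hl (q1l t0)).
Qed.

Let argl t : 0 <= t -> edge_arg (k_ n) t @[n --> \oo] --> airy_phase t.
Proof.
move=> t0; rewrite (_ : airy_phase t = - (t ^+ 3 / 6) + ((mu - 1) - mu * 0) * t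
   + (1 - 2 * 0 + 0 ^+ 2) * t * (t ^+ 2 / 2)); last by rewrite /airy_phase; field.
exact: (cvg_edge_arg hl (q1l t0) (q2l t0) (s1l t0)).
Qed.

Let fun_l t : 0 <= t -> edge_fun (k_ n) t @[n --> \oo] --> airy_fun t.
Proof.
move=> t0; apply: cvgM.
  by apply: continuous_cvg; [exact: continuous_expR | exact: expl].
by apply: continuous_cvg; [exact: continuous_cos | exact: argl].
Qed.

Let dfun_l t : 0 <= t -> edge_dfun (k_ n) t @[n --> \oo] --> airy_dfun t.
Proof.
move=> t0; apply: cvgM.
  by apply: continuous_cvg; [exact: continuous_expR | exact: expl].
rewrite (_ : - cos (airy_phase t) - t * sin (airy_phase t) =
  (- 1 - (1 - 0) * 0 * (t ^+ 2 / 2) - mu / 2 * 0) * cos (airy_phase t)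
  + (- (1 - 0) * t) * sin (airy_phase t)); last by field.
rewrite /edge_dcos /edge_dsin; apply: cvgD; apply: cvgM.
- exact: (cvg_edge_dcos hl (q1l t0)).
- by apply: continuous_cvg; [exact: continuous_cos | exact: argl].
- exact: (cvg_edge_dsin hl (s1l t0)).
- by apply: continuous_cvg; [exact: continuous_sin | exact: argl].
Qed.

Let exp_bound n t : 0 <= t <= pi * k_ n ->
  expR (edge_exp (k_ n) t) <= 72 ^+ 4 / (1 + t ^+ 2) ^+ 4.
Proof.
move=> tk; have kn0 : k_ n != 0 by rewrite gt_eqF.
have h0 := hle1 n; set h := (k_ n)^-1 in h0; case/andP: h0 => h0 h1.
have q1_ge := edge_q1_ge k_ge1 tk.
have q10 : 0 <= edge_q1 (k_ n) t by apply: le_trans q1_ge; rewrite divr_ge0 ?sqr_ge0.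
have hm : (`|mu| + 3) * h <= 1 by rewrite ler_pdivrMr // mul1r.
(* The lower bound [|mu| + 3] on [k] is what lets the corrections take at most 1 from the leading
   2. *)
have bracket : 1 <= 2 + (mu - 2) * h - mu * h ^+ 2
    + (h - 2 * h ^+ 2 + h ^+ 3) * edge_q1 (k_ n) t.
  have b1 : 0 <= (h - 2 * h ^+ 2 + h ^+ 3) * edge_q1 (k_ n) t.
    rewrite (_ : h - 2 * h ^+ 2 + h ^+ 3 = h * (1 - h) ^+ 2); last by ring.
    by apply: mulr_ge0 => //; apply: mulr_ge0; rewrite ?sqr_ge0.
  have b2 : - (`|mu| * h) <= mu * h by rewrite -mulNr ler_wpM2r // lerNl; have := ler_norm (- mu); rewrite normrN.
  have b3 : mu * h * h <= h.
    rewrite ler_piMl // (le_trans (ler_wpM2r h0 (ler_norm mu))) //.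
    by apply: le_trans hm; rewrite ler_wpM2r // lerDl.
  by rewrite expr2 mulrA; move: b1 b2 b3 hm; rewrite !mulrDl; lra.
(* The rate [1/18] is that of [edge_q1_ge], and [72 = 4 * 18]. *)
apply: (@le_trans _ _ (expR (- (18^-1 * t ^+ 2)))).
  rewrite ler_expR /edge_exp mulNr lerN2 mulrC; apply: le_trans q1_ge _.
  by rewrite ler_peMr.
have := @expRN_sqr_le R 18^-1 t; rewrite invrK (_ : 4 * 18 = 72); last by ring.
by apply; apply/andP; split; lra.
Qed.

Lemma edge_int_cvg : \int[lmu]_(t in `[0, pi * k_ n]) edge_fun (k_ n) t @[n --> \oo]
  --> \int[lmu]_(t in `[0, +oo[) airy_fun t.
Proof.
apply: (@dominated_growing_cvg _ _ _ _ (72 ^+ 4)) => //.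
- by move=> n; exact: continuous_edge_fun.
- exact: continuous_airy_fun.
- move=> n t tk; rewrite /edge_fun normrM ger0_norm ?expR_ge0 //.
  apply: le_trans (le_div_oneDsqrX _ _) => //; rewrite -[leRHS]mulr1.
  by apply: ler_pM; rewrite ?expR_ge0 ?cos_max ?exp_bound.
Qed.

Lemma edge_dint_cvg : \int[lmu]_(t in `[0, pi * k_ n]) edge_dfun (k_ n) t @[n --> \oo]
  --> \int[lmu]_(t in `[0, +oo[) airy_dfun t.
Proof.
apply: (@dominated_growing_cvg _ _ _ _ (72 ^+ 4 * (2 + `|mu|))) => //.
- by move=> n; exact: continuous_edge_dfun.
- exact: continuous_airy_dfun.
move=> n t tk; case/andP: (tk) => t0 _.
have kn0 : k_ n != 0 by rewrite gt_eqF.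
have t1 : 1 <= 1 + t ^+ 2 by rewrite lerDl sqr_ge0.
have th0 := theta_ge0 n t0.
have q1_le : 0 <= edge_q1 (k_ n) t <= t ^+ 2 / 2.
  apply/andP; split; first by apply: mulr_ge0; rewrite ?sqr_ge0 ?subr_ge0 ?cos_le1.
  rewrite (_ : t ^+ 2 / 2 = k_ n ^+ 2 * ((t / k_ n) ^+ 2 / 2)); last by field.
  by rewrite ler_wpM2l ?sqr_ge0 // cos_ge.
have s1_le : 0 <= edge_s1 (k_ n) t <= t.
  apply/andP; split; first by apply: mulr_ge0; rewrite ?sin_ge0_pi ?theta_bound // ltW.
  rewrite [leRHS](_ : t = k_ n * (t / k_ n)); last by field.
  by rewrite ler_wpM2l ?sin_le // ltW.
have /andP[h0 h1] := hle1 n.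
have dc : `|edge_dcos (k_ n) t| <= 1 + t ^+ 2 / 2 + `|mu|.
  rewrite /edge_dcos; set h := (k_ n)^-1 in h0 h1 *; set q := edge_q1 _ _ in q1_le *.
  case/andP: q1_le => q0 qt.
  apply: le_trans (ler_normB _ _) _; apply: lerD; last first.
    by rewrite -mulrA normrM ler_piMr // ler_norml; apply/andP; split; lra.
  apply: le_trans (ler_normB _ _) _; rewrite normrN normr1 lerD2l.
  have h1h : 0 <= 1 - h <= 1 by apply/andP; split; lra.
  case/andP: h1h => h2 h3.
  rewrite (ger0_norm (mulr_ge0 (mulr_ge0 h2 h0) q0)); apply: le_trans qt.
  by apply: ler_piMl => //; apply: mulr_ile1.
have ds : `|edge_dsin (k_ n) t| <= t.
  case/andP: s1_le => s0 st; rewrite /edge_dsin mulNr normrN.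
  have h2 : 0 <= 1 - (k_ n)^-1 by rewrite subr_ge0.
  rewrite (ger0_norm (mulr_ge0 h2 s0)); apply: le_trans st.
  by apply: ler_piMl => //; rewrite lerBlDr lerDl.
rewrite /edge_dfun normrM ger0_norm ?expR_ge0 //.
(* One of the four powers of [1 + t ^+ 2] absorbs the quadratic growth of the trigonometric
   factors. *)
apply: (@le_trans _ _ (72 ^+ 4 / (1 + t ^+ 2) ^+ 4 * ((2 + `|mu|) * (1 + t ^+ 2)))).
  apply: ler_pM; rewrite ?expR_ge0 ?exp_bound //.
  apply: (@le_trans _ _ (`|edge_dcos (k_ n) t| + `|edge_dsin (k_ n) t|)).
    apply: le_trans (ler_normD _ _) _; rewrite !normrM.
    by apply: lerD; rewrite ler_piMr ?cos_max ?sin_max.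
  have tt : t <= 1 / 2 + t ^+ 2 / 2 by have := sqr_ge0 (t - 1); rewrite sqrrB1; lra.
  have := normr_ge0 mu; have : 0 <= `|mu| * t ^+ 2 by rewrite mulr_ge0 ?sqr_ge0.
  by have := sqr_ge0 t; move: dc ds tt; rewrite mulrDl !mulrDr; lra.
rewrite [leLHS](_ : _ = 72 ^+ 4 * (2 + `|mu|) / (1 + t ^+ 2) ^+ 3); last first.
  by field; rewrite gt_eqF // (lt_le_trans ltr01).
rewrite ler_wpM2l ?mulr_ge0 ?addr_ge0 // lef_pV2 ?posrE ?exprn_gt0 ?(lt_le_trans ltr01) //.
by rewrite (exprS (1 + t ^+ 2) 2); apply: ler_peMr; [exact: le_trans t1 | exact: exprn_ege1].
Qed.

End limits.
End edge_phase.

(** * Stirling's formula from the circle integral of the exponential *)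

Section stirling.
Context {R : realType}.
Local Notation lmu := (@lebesgue_measure R).

(** The shift by 2 keeps the scale at least 1. With [n + 2 = 2 k^2], the exponent
    [(n + 2) (cos - 1)] on the saddle circle of radius [n + 2] is [- 2 edge_q1], with limit
    [- t^2]. *)
Let k (n : nat) : R := Num.sqrt (n.+2%:R / 2).

Let k2 n : k n ^+ 2 = n.+2%:R / 2.
Proof. by rewrite sqr_sqrtr. Qed.

Let k_ge1 n : 1 <= k n.
Proof.
by rewrite -[leLHS]sqrtr1 ler_sqrt ?divr_gt0 // ler_pdivlMr // mul1r (ler_nat _ 2).
Qed.

Let k_gt0 n : 0 < k n. Proof. exact: lt_le_trans (k_ge1 n). Qed.

Let k_y : k n @[n --> \oo] --> +oo.
Proof.
apply/cvgryPge => A.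
near=> n.
rewrite (le_trans (ler_norm A)) // -sqrtr_sqr ler_sqrt // ler_pdivlMr //.
have : `|A ^+ 2 * 2| <= n%:R by near: n; exact: nbhs_infty_ger.
move=> /(le_trans (ler_norm _)) /le_trans; apply.
by rewrite ler_nat (leq_trans (leqnSn _)).
Unshelve. all: by end_near. Qed.

Let f n (t : R) : R := expR (- 2 * edge_q1 (k n) t) * cos (2 * (k n)^-1 * edge_q2 (k n) t).

Let f_cvg : \int[lmu]_(t in `[0, pi * k n]) f n t @[n --> \oo] --> Num.sqrt pi / 2.
Proof.
have -> : Num.sqrt pi / 2 = \int[lmu]_(t in `[0, +oo[) gauss_fun t.
  by rewrite /Rintegral integral0y_gauss.
apply: (@dominated_growing_cvg _ _ _ _ (36 ^+ 4)) => //.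
- by move=> n t; apply: (@der_continuous _ _ _ (_ : R)).
- exact: continuous_gauss_fun.
- move=> t t0; rewrite -[gauss_fun t]mulr1 -cos0; apply: seqM.
    apply: continuous_cvg; first exact: continuous_expR.
    rewrite (_ : - t ^+ 2 = - 2 * (t ^+ 2 / 2)); last by field.
    by apply: seqM; [exact: seq_cst | exact: (edge_q1_cvg k_ge1 k_y t0)].
  apply: continuous_cvg; first exact: continuous_cos.
  rewrite (_ : 0 = 2 * 0 * (- (t ^+ 3 / 6))); last by ring.
  apply: seqM; last exact: (edge_q2_cvg k_ge1 k_y t0).
  by apply: seqM; [exact: seq_cst | exact: (inv_scale_cvg k_ge1 k_y)].
- move=> n t tk; rewrite /f normrM ger0_norm ?expR_ge0 //.
  apply: le_trans (le_div_oneDsqrX _ _) => //; rewrite -[leRHS]mulr1.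
  apply: ler_pM; rewrite ?expR_ge0 ?cos_max //.
  apply: (@le_trans _ _ (expR (- (9^-1 * t ^+ 2)))).
    by rewrite ler_expR mulNr lerN2; have := edge_q1_ge k_ge1 tk; lra.
  have := @expRN_sqr_le R 9^-1 t; rewrite invrK (_ : 4 * 9 = 36); last by ring.
  by apply; apply/andP; split; lra.
Qed.

Let f_int n : \int[lmu]_(t in `[0, pi * k n]) f n t =
  pi * k n * n.+2%:R ^+ n.+2 / n.+2`!%:R * expR (- n.+2%:R).
Proof.
have := @circ_int_exp R (k n) 1 n.+2 n.+2%:R (k_gt0 n) (ler0n _ _).
rewrite expr1n mul1r => H; rewrite -H /circ_int [RHS]mulrC -Rintegral_ccZ; last first.
  exact: continuous_circ_integrand.
apply: eq_Rintegral => t _; rewrite /f /circ_integrand mulrA -expRD.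
have kn0 : k n != 0 by rewrite gt_eqF.
have nE : n.+2%:R = k n ^+ 2 * 2 by rewrite k2 divfK // pnatr_eq0.
congr (expR _ * cos _).
  by rewrite /circ_exp /edge_q1 nE; ring.
by rewrite /circ_arg /edge_q2 nE; field.
Qed.

(** The rescaled Cauchy integral for the coefficient [1/n!] of the exponential tends to the
    half-line Gaussian integral [sqrt pi / 2]; the claim is this limit solved for the factorial. *)
Lemma stirling : n`!%:R / (Num.sqrt (2 * pi) * Num.sqrt n%:R * n%:R ^+ n * expR (- n%:R))
  @[n --> \oo] --> (1 : R).
Proof.
rewrite -(cvg_shiftn 2) /=.
have s0 : Num.sqrt pi / 2 != 0 :> R by rewrite gt_eqF // divr_gt0 // sqrtr_gt0 pi_gt0.
suff : Num.sqrt pi / 2 * (\int[lmu]_(t in `[0, pi * k n]) f n t)^-1 @[n --> \oo] --> Num.sqrt pi / 2 * (Num.sqrt pi / 2)^-1.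
  rewrite mulfV // => H; apply: cvg_trans H; apply: near_eq_cvg; apply: nearW => n.
  rewrite addn2 f_int.
  have kE : k n = Num.sqrt n.+2%:R / Num.sqrt 2.
    by rewrite /k sqrtrM // sqrtrV.
  have p0 : Num.sqrt pi != 0 :> R by rewrite gt_eqF // sqrtr_gt0 pi_gt0.
  have q0 : Num.sqrt 2 != 0 :> R by rewrite gt_eqF // sqrtr_gt0.
  have n0 : Num.sqrt n.+2%:R != 0 :> R by rewrite gt_eqF // sqrtr_gt0 ltr0n.
  have f0 : n.+2`!%:R != 0 :> R by rewrite pnatr_eq0 -lt0n fact_gt0.
  have e0 : expR (- n.+2%:R) != 0 :> R by rewrite gt_eqF // expR_gt0.
  have mm0 : n.+2%:R ^+ n.+2 != 0 :> R by rewrite expf_neq0 // pnatr_eq0.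
  rewrite kE sqrtrM //.
  have piE : pi = Num.sqrt pi * Num.sqrt pi :> R by rewrite -expr2 sqr_sqrtr // pi_ge0.
  have s2E : 2 = Num.sqrt 2 * Num.sqrt 2 :> R by rewrite -expr2 sqr_sqrtr.
  move: (Num.sqrt pi) (Num.sqrt 2) p0 q0 piE s2E => p q p0 q0 -> ->.
  move: (n.+2%:R ^+ n.+2) (n.+2`!%:R) (expR _) (Num.sqrt _) mm0 f0 e0 n0 => M F E N M0 F0 E0 N0.
  by field; rewrite ?p0 ?q0 ?N0 ?M0 ?F0 ?E0.
by apply: seqM; [exact: seq_cst | apply: cvgV => //; exact: f_cvg].
Qed.

End stirling.

(** * Hermite functions at the edge *)

Section edge_scaling.
Context {R : realType}.
Local Notation lmu := (@lebesgue_measure R).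
Implicit Types (N : nat) (mu : R).

Definition edge_scale N : R := N%:R `^ 3^-1.

Lemma edge_scale_cube N : edge_scale N ^+ 3 = N%:R.
Proof. by rewrite /edge_scale -powR_mulrn ?powR_ge0 // -powRrM mulVf ?powRr1 ?pnatr_eq0. Qed.

Lemma edge_scale_ge0 N : 0 <= edge_scale N.
Proof. exact: powR_ge0. Qed.

Lemma edge_scale_gt0 N : (0 < N)%N -> 0 < edge_scale N.
Proof. by move=> N0; rewrite powR_gt0 // ltr0n. Qed.

Lemma edge_scale_cvg : edge_scale N @[N --> \oo] --> +oo.
Proof.
apply/cvgryPge => A; near=> N.
have AN : `|A| ^+ 3 <= N%:R by near: N; exact: nbhs_infty_ger.
apply: le_trans (ler_norm A) _; rewrite -(@ler_pXn2r _ 3) ?nnegrE ?edge_scale_ge0 //.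
by rewrite edge_scale_cube.
Unshelve. all: by end_near. Qed.

Lemma sqrt_edge_scale N : Num.sqrt N%:R ^+ 2 = edge_scale N ^+ 3.
Proof. by rewrite sqr_sqrtr // edge_scale_cube. Qed.

Lemma edge_pointE N mu : (0 < N)%N ->
  edge_point N mu = 2 * Num.sqrt N%:R + mu * edge_scale N / Num.sqrt N%:R.
Proof.
move=> N0; have N0' : N%:R != 0 :> R by rewrite pnatr_eq0 -lt0n.
rewrite /edge_point -mulrA; congr (_ + _ * _).
have E : Num.sqrt N%:R = N%:R `^ 6^-1 * edge_scale N :> R.
  rewrite -powR12_sqrt // /edge_scale -powRD; last by rewrite N0' implybT.
  by congr (_ `^ _); field.
rewrite E; field.
by rewrite !gt_eqF ?edge_scale_gt0 ?powR_gt0 // ltr0n.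
Qed.

Section fixed_size.
Variables (N : nat) (mu : R).
Hypothesis N_gt0 : (0 < N)%N.
Hypothesis k_gt1 : 1 < edge_scale N.
Let k := edge_scale N.
Let S : R := Num.sqrt N%:R.
Let r := S * (1 - k^-1).
Let x := edge_point N mu.

Let k0 : k != 0. Proof. by rewrite gt_eqF ?edge_scale_gt0. Qed.
Let S_gt0 : 0 < S. Proof. by rewrite sqrtr_gt0 ltr0n. Qed.
Let S0 : S != 0. Proof. by rewrite gt_eqF. Qed.
Let h1 : 0 < 1 - k^-1. Proof. by rewrite subr_gt0 invf_lt1 // edge_scale_gt0. Qed.
Let r_gt0 : 0 < r. Proof. by rewrite mulr_gt0. Qed.
Let S2 : S ^+ 2 = k ^+ 3. Proof. exact: sqrt_edge_scale. Qed.

(** [S ^+ 2 = k ^+ 3] makes this product and [r ^+ 2] polynomials in [k], with no square root left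
    and no error term. *)
Let xr : x * r = 2 * k ^+ 3 - 2 * k ^+ 2 + mu * k - mu.
Proof.
rewrite /x edge_pointE // -/k -/S /r.
rewrite (_ : _ * _ = 2 * S ^+ 2 * (1 - k^-1) + mu * k * (1 - k^-1)); last by field; rewrite k0 S0.
by rewrite S2; field.
Qed.

Let r2 : r ^+ 2 = k ^+ 3 - 2 * k ^+ 2 + k.
Proof. by rewrite /r exprMn S2; field. Qed.

Let circ_expE t : circ_exp k 1 x r t = (x * r - r ^+ 2 / 2) + edge_exp mu k t.
Proof.
rewrite /circ_exp mulr_natl cos_mulr2n /edge_exp /edge_q1 xr r2.
by set c := cos _; field.
Qed.

Let circ_argE t : circ_arg k 1 x N%:R r t = edge_arg mu k t.
Proof.
rewrite /circ_arg mulr_natl sin_mulr2n /edge_arg /edge_q1 /edge_q2 /edge_s1 xr r2 -(edge_scale_cube N) -/k.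
by set c := cos _; set s := sin _; field.
Qed.

Lemma edge_herm_int : pi * k * r ^+ N * herm_fun N x =
  expR (x * r - r ^+ 2 / 2) * \int[lmu]_(t in `[0, pi * k]) edge_fun mu k t.
Proof.
rewrite -circ_int_hermite ?ltW ?edge_scale_gt0 // /circ_int -Rintegral_ccZ; last first.
  exact: continuous_edge_fun.
apply: eq_Rintegral => t _.
by rewrite /circ_integrand circ_expE circ_argE expRD /edge_fun mulrA.
Qed.

(** The derivative is the Hermite function of order [N.-1], so [herm_dfun] is a combination of two
    circle integrals. The factor [k / S = N^(-1/6)] is the slope of the edge variable in [mu]; it
    leaves two terms of size [k] that cancel to order 1. *)
Lemma edge_herm_dint : pi * k * r ^+ N * (k / S * herm_dfun N x) =
  expR (x * r - r ^+ 2 / 2) * \int[lmu]_(t in `[0, pi * k]) edge_dfun mu k t.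
Proof.
have k0' : 0 < k by exact: edge_scale_gt0.
have H1 : pi * k * r ^+ N.-1 * herm_fun N.-1 x = circ_int k 1 x (N%:R - 1) r.
  rewrite -circ_int_hermite ?ltW //; congr (circ_int _ _ _ _ _).
  by rewrite -{2}(prednK N_gt0) -natr1 addrK.
have H2 := @circ_int_hermite R k x N r k0' (ltW r_gt0).
have -> : pi * k * r ^+ N * (k / S * herm_dfun N x) =
    (k / S * r) * circ_int k 1 x (N%:R - 1) r - (k / S * x / 2) * circ_int k 1 x N%:R r.
  rewrite -H1 H2 /herm_dfun (_ : (hermite_fact R N)^`() = hermite_fact R N.-1); last first.
    by rewrite -[in LHS](prednK N_gt0) deriv_hermite_fact.
  rewrite -/(herm_fun _ _) -/(herm_fun _ _) -[in r ^+ N](prednK N_gt0) exprS.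
  by ring.
have cC j : continuous (circ_integrand k 1 x j r) by exact: continuous_circ_integrand.
rewrite -mulNr /circ_int -!Rintegral_ccZ //; last exact: continuous_edge_dfun.
rewrite -Rintegral_ccD; [|exact: continuous_Zf|exact: continuous_Zf].
apply: eq_Rintegral => t _.
rewrite /circ_integrand circ_arg_pred circ_expE circ_argE expRD /edge_dfun cosD.
have kSr : k / S * r = k - 1 by rewrite /r; field; rewrite k0 S0.
have kSx : k / S * x / 2 = k + mu / 2 * k^-1.
  rewrite /x edge_pointE // -/k -/S (_ : _ / 2 = k + mu / 2 * k ^+ 2 / S ^+ 2).
    by rewrite S2; field.
  by field.
rewrite kSr kSx /edge_dcos /edge_dsin /edge_s1 /edge_q1.
set C := cos (edge_arg _ _ _); set D := sin (edge_arg _ _ _); set E1 := expR _.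
by set E2 := expR _; set c := cos _; set s := sin _; field.
Qed.

(** The square root of the normalization [edge_norm], up to [k ^+ 2], the square of the factorial
    and the exponentials in [mu] and [nu]: each of the two Hermite functions receives the same
    factor. *)
Definition edge_weight : R :=
  Num.sqrt (N`!%:R * k ^+ 2 / (Num.sqrt (2 * pi) * S * expR (2 * N%:R))).

(** What remains of the weights after division by [pi k r^N]: a Stirling ratio, and an exponent
    whose divergent terms [- k^2 - k/2] are compensated by the logarithm. *)
Definition edge_prefactor : R :=
  Num.sqrt (N`!%:R / (Num.sqrt (2 * pi) * S * N%:R ^+ N * expR (- N%:R)))
  * expR (- k ^+ 2 - k / 2 - mu - k ^+ 3 * ln (1 - k^-1)) / pi.

Lemma edge_weight_prefactor :
  edge_weight * expR (- (mu * k)) * expR (x * r - r ^+ 2 / 2) = edge_prefactor * (pi * k * r ^+ N).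
Proof.
rewrite /edge_weight /edge_prefactor.
have -> : r ^+ N = S ^+ N * expR (k ^+ 3 * ln (1 - k^-1)).
  by rewrite /r exprMn (edge_scale_cube N) expRM_natl lnK.
have -> : N`!%:R * k ^+ 2 / (Num.sqrt (2 * pi) * S * expR (2 * N%:R)) =
    (N`!%:R / (Num.sqrt (2 * pi) * S * N%:R ^+ N * expR (- N%:R)))
      * (k * S ^+ N * expR (- (3 / 2 * k ^+ 3))) ^+ 2.
  rewrite !exprMn -exprM mulnC exprM sqr_sqrtr // -expRM_natl.
  have -> : expR (2 * N%:R) = expR (- N%:R) / expR (2 * - (3 / 2 * k ^+ 3)).
    by rewrite -expRN -expRD -(edge_scale_cube N) -/k; congr expR; field.
  have e1 : expR (- N%:R) != 0 :> R by rewrite gt_eqF ?expR_gt0.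
  have e2 : expR (2 * - (3 / 2 * k ^+ 3)) != 0 :> R by rewrite gt_eqF ?expR_gt0.
  have n1 : N%:R ^+ N != 0 :> R by rewrite expf_neq0 // pnatr_eq0 -lt0n.
  have p1 : Num.sqrt (2 * pi) != 0 :> R by rewrite gt_eqF // sqrtr_gt0 mulr_gt0 ?pi_gt0.
  move: (expR _) (expR _) (_ ^+ N) (Num.sqrt (2 * pi)) (N`!%:R) e1 e2 n1 p1 => a b c d e a0 b0 c0 d0.
  by field; rewrite ?a0 ?b0 ?c0 ?d0 ?S0.
rewrite sqrtrM; last by rewrite divr_ge0 // !mulr_ge0 ?sqrtr_ge0 ?expR_ge0 ?exprn_ge0.
rewrite sqrtr_sqr ger0_norm; last by rewrite !mulr_ge0 ?edge_scale_ge0 ?exprn_ge0 ?expR_ge0 ?sqrtr_ge0.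
set s := Num.sqrt (_ / _).
have -> : s * (k * S ^+ N * expR (- (3 / 2 * k ^+ 3))) * expR (- (mu * k)) * expR (x * r - r ^+ 2 / 2) =
   s * k * S ^+ N * (expR (- (3 / 2 * k ^+ 3)) * expR (- (mu * k)) * expR (x * r - r ^+ 2 / 2)) by ring.
have pi0 : pi != 0 :> R by rewrite gt_eqF ?pi_gt0.
have -> : s * expR (- k ^+ 2 - k / 2 - mu - k ^+ 3 * ln (1 - k^-1)) / pi *
    (pi * k * (S ^+ N * expR (k ^+ 3 * ln (1 - k^-1)))) =
   s * k * S ^+ N * (expR (- k ^+ 2 - k / 2 - mu - k ^+ 3 * ln (1 - k^-1)) * expR (k ^+ 3 * ln (1 - k^-1))).
  move: (expR (k ^+ 3 * _)) (expR (- k ^+ 2 - _ - _ - _)) => u v.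
  by clearbody s; move: (pi : R) pi0 => p p0; field.
rewrite -!expRD; congr (_ * expR _).
by rewrite xr r2; field.
Qed.

Lemma edge_herm_fun : herm_fun N x * edge_weight * expR (- (mu * k)) =
  edge_prefactor * \int[lmu]_(t in `[0, pi * k]) edge_fun mu k t.
Proof.
have c0 : pi * k * r ^+ N != 0.
  by rewrite gt_eqF // !mulr_gt0 ?pi_gt0 ?edge_scale_gt0 ?exprn_gt0.
apply: (mulfI c0).
transitivity (edge_weight * expR (- (mu * k)) * (pi * k * r ^+ N * herm_fun N x)); first by ring.
rewrite edge_herm_int [LHS]mulrA edge_weight_prefactor; ring.
Qed.

Lemma edge_herm_dfun : k / S * herm_dfun N x * edge_weight * expR (- (mu * k)) =
  edge_prefactor * \int[lmu]_(t in `[0, pi * k]) edge_dfun mu k t.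
Proof.
have c0 : pi * k * r ^+ N != 0.
  by rewrite gt_eqF // !mulr_gt0 ?pi_gt0 ?edge_scale_gt0 ?exprn_gt0.
apply: (mulfI c0).
transitivity (edge_weight * expR (- (mu * k)) * (pi * k * r ^+ N * (k / S * herm_dfun N x))); first by ring.
rewrite edge_herm_dint [LHS]mulrA edge_weight_prefactor; ring.
Qed.

End fixed_size.

Lemma edge_prefactor_cvg mu : edge_prefactor N mu @[N --> \oo] --> expR (3^-1 - mu) / pi.
Proof.
have sig := @stirling R.
have ex : expR (- edge_scale N ^+ 2 - edge_scale N / 2 - mu - edge_scale N ^+ 3 * ln (1 - (edge_scale N)^-1))
   @[N --> \oo] --> expR (3^-1 - mu).
  apply: continuous_cvg; first exact: continuous_expR.
  have k2 : \forall N \near \oo, 2 <= edge_scale N by move/cvgryPge : edge_scale_cvg; apply.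
  have hl : (edge_scale N)^-1 @[N --> \oo] --> 0.
    apply/gtr0_cvgV0; last exact: edge_scale_cvg.
    by apply: filterS k2 => N; apply: lt_le_trans.
  apply: (@squeeze_cvgr _ _ _ _ (fun=> 3^-1 - mu) (fun N => 3^-1 - mu + 2 * (edge_scale N)^-1)).
  - apply: filterS k2 => N k2; set k := edge_scale N in k2 *.
    have k0 : 0 < k by apply: lt_le_trans k2.
    have /ln_expand : 0 <= k^-1 <= 2^-1 by rewrite invr_ge0 ltW //= lef_pV2 // posrE.
    move/andP => [l1 l2].
    have k3 : 0 <= k ^+ 3 by rewrite exprn_ge0 // ltW.
    (* Multiplied by [k ^+ 3], the quartic error of [ln_expand] becomes [2 / k]. *)
    have := ler_wpM2l k3 l2; have := mulr_ge0 k3 l1.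
    have -> : k ^+ 3 * (2 * k^-1 ^+ 4) = 2 * k^-1 by field; rewrite gt_eqF.
    have -> : k ^+ 3 * (- ln (1 - k^-1) - k^-1 - k^-1 ^+ 2 / 2 - k^-1 ^+ 3 / 3) =
       - k ^+ 2 - k / 2 - mu - k ^+ 3 * ln (1 - k^-1) - (3^-1 - mu).
      by move: (ln _) => l; field; rewrite gt_eqF.
    by move=> ? ?; apply/andP; split; lra.
  - exact: seq_cst.
  rewrite -[X in _ --> X]addr0 -[X in _ --> _ + X](mulr0 2).
  by apply: seqD; [exact: seq_cst | apply: seqM => //; exact: seq_cst].
have -> : expR (3^-1 - mu) / pi = Num.sqrt 1 * expR (3^-1 - mu) / pi by rewrite sqrtr1 mul1r.
apply: seqM; last exact: seq_cst.
apply: seqM => //.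
by apply: continuous_cvg; [exact: sqrt_continuous | exact: sig].
Qed.

Lemma edge_herm_cvg mu :
  (herm_fun N (edge_point N mu) * edge_weight N * expR (- (mu * edge_scale N)) @[N --> \oo]
    --> expR (3^-1 - mu) / pi * \int[lmu]_(t in `[0, +oo[) airy_fun mu t) /\
  (edge_scale N / Num.sqrt N%:R * herm_dfun N (edge_point N mu) * edge_weight N
     * expR (- (mu * edge_scale N)) @[N --> \oo]
    --> expR (3^-1 - mu) / pi * \int[lmu]_(t in `[0, +oo[) airy_dfun mu t).
Proof.
(* The domination needs [k >= |mu| + 3] at every index, so the sequences are shifted by [N0]. *)
have [N0 N0_gt0 N0P] : exists2 N0, (0 < N0)%N & forall N, (N0 <= N)%N -> `|mu| + 3 <= edge_scale N.
  have [N1 _ N1P] : \forall N \near \oo, `|mu| + 3 <= edge_scale N by move/cvgryPge : edge_scale_cvg; apply.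
  by exists N1.+1 => // N NN; apply: N1P; exact: ltnW.
have kl n : `|mu| + 3 <= edge_scale (n + N0) by apply: N0P; exact: leq_addl.
have k1 n : 1 < edge_scale (n + N0) by have := kl n; have := normr_ge0 mu; lra.
have n0 n : (0 < n + N0)%N by rewrite addn_gt0 N0_gt0 orbT.
have ky : edge_scale (n + N0) @[n --> \oo] --> +oo.
  by rewrite (cvg_shiftn N0 edge_scale); exact: edge_scale_cvg.
have pl := @edge_prefactor_cvg mu; rewrite -(cvg_shiftn N0) /= in pl.
split; rewrite -(cvg_shiftn N0) /=.
- under eq_fun => n do rewrite (edge_herm_fun mu (n0 n) (k1 n)).
  by apply: seqM => //; exact: edge_int_cvg.
- under eq_fun => n do rewrite (edge_herm_dfun mu (n0 n) (k1 n)).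
  by apply: seqM => //; exact: edge_dint_cvg.
Qed.

End edge_scaling.

(** * The Airy function *)

Section contour_shift.
Context {R : realType}.
Local Notation lmu := (@lebesgue_measure R).
Variable x : R.

(* [exp(i (z^3/3 + x z))] at [z = t + i eta] is
   [expR (shift_exp eta t)] times the phase [shift_arg eta t]. *)
Definition shift_exp (eta t : R) : R := - (eta * t ^+ 2) + eta ^+ 3 / 3 - x * eta.
Definition shift_arg (eta t : R) : R := t ^+ 3 / 3 - eta ^+ 2 * t + x * t.
Definition shift_re (eta t : R) : R := expR (shift_exp eta t) * cos (shift_arg eta t).
Definition shift_im (eta t : R) : R := expR (shift_exp eta t) * sin (shift_arg eta t).

(** By the Cauchy-Riemann equations this is both the [eta]-derivative of the real part and minus the
    [t]-derivative of the imaginary part. *)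
Let dshift (eta t : R) : R := expR (shift_exp eta t) *
  (2 * eta * t * sin (shift_arg eta t) - (t ^+ 2 - eta ^+ 2 + x) * cos (shift_arg eta t)).

Let continuous_re eta : continuous (shift_re eta).
Proof. by move=> t; apply: (@der_continuous _ _ _ (_ : R)). Qed.

Let continuous_dshift eta : continuous (dshift eta).
Proof. by move=> t; apply: (@der_continuous _ _ _ (_ : R)). Qed.

Let shift_im_t (eta t : R) : is_derive t 1 (shift_im eta) (- dshift eta t).
Proof.
rewrite /shift_im /dshift /shift_exp /shift_arg; der_tac.
by set E := expR _; set S := sin _; set C := cos _; field.
Qed.

Let shift_re_eta (eta t : R) : is_derive eta 1 (shift_re ^~ t) (dshift eta t).
Proof.
rewrite /shift_re /dshift /shift_exp /shift_arg; der_tac.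
by set E := expR _; set S := sin _; set C := cos _; field.
Qed.

Let dshift_bound (M r eta t : R) : 0 <= t <= r -> `|eta| <= M ->
  `|dshift eta t| <= expR (M * r ^+ 2 + M ^+ 3 + `|x| * M) * (2 * M * r + (r ^+ 2 + M ^+ 2 + `|x|)).
Proof.
move=> /andP[t0 tr] eM; have M0 : 0 <= M by apply: le_trans eM.
have r0 : 0 <= r by apply: le_trans tr.
have tn : `|t| <= r by rewrite ger0_norm.
rewrite /dshift normrM ger0_norm ?expR_ge0 //.
apply: ler_pM; rewrite ?expR_ge0 //.
  rewrite ler_expR /shift_exp; apply: lerD; first apply: lerD.
  - apply: le_trans (ler_norm _) _; rewrite normrN normrM normrX.
    by apply: ler_pM; rewrite ?exprn_ge0 // lerXn2r ?nnegrE.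
  - apply: le_trans (ler_norm _) _; rewrite normrM normrX -[leRHS]mulr1.
    apply: ler_pM; rewrite ?exprn_ge0 ?lerXn2r ?nnegrE //.
    by rewrite ger0_norm ?invr_ge0 // invf_le1 // ler1n.
  - by apply: le_trans (ler_norm _) _; rewrite normrN normrM ler_wpM2l.
apply: le_trans (ler_normB _ _) _; apply: lerD.
  rewrite normrM -[leRHS]mulr1; apply: ler_pM; rewrite ?sin_max // !normrM.
  by apply: ler_pM; rewrite ?mulr_ge0 //; apply: ler_pM => //; rewrite ger0_norm.
rewrite normrM -[leRHS]mulr1; apply: ler_pM; rewrite ?cos_max //.
apply: le_trans (ler_normD _ _) _; rewrite lerD2r.
by apply: le_trans (ler_normB _ _) _; rewrite !normrX; apply: lerD; rewrite lerXn2r ?nnegrE.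
Qed.

(** Cauchy's theorem, in real parts, on the rectangle with opposite corners 0 and [r + i]. The side
    [t = 0] drops out: the integrand is real there and [dz] imaginary. *)
Lemma contour_shift_diff r : 0 <= r ->
  \int[lmu]_(t in `[0, r]) shift_re 1 t - \int[lmu]_(t in `[0, r]) shift_re 0 t =
  \int[lmu]_(eta in `[0, 1]) - shift_im eta r.
Proof.
move=> r0; symmetry; apply: (@Rintegral_FTC _ (fun eta => \int[lmu]_(t in `[0, r]) shift_re eta t)) => //.
  move=> eta.
  have -> : - shift_im eta r = \int[lmu]_(t in `[0, r]) dshift eta t.
    have im0 : shift_im eta 0 = 0.
      by rewrite /shift_im /shift_arg expr0n /= mul0r !mulr0 subr0 addr0 sin0 mulr0.
    have H (t : R) : is_derive t 1 (fun t => - shift_im eta t) (dshift eta t).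
      by have h := shift_im_t eta t; apply: is_derive_eq; rewrite opprK.
    by rewrite (@Rintegral_FTC _ _ _ _ _ r0 H (@continuous_dshift eta)) im0 oppr0 subr0.
  pose M := `|eta| + 1.
  apply: (@is_derive_integral _ _ shift_re dshift
    (cst (expR (M * r ^+ 2 + M ^+ 3 + `|x| * M) * (2 * M * r + (r ^+ 2 + M ^+ 2 + `|x|))))
    (eta - 1) (eta + 1)) => //.
  - by move=> s _; exact: continuous_integrable_cc.
  - exact/continuous_integrable_cc/cst_continuous.
  - by move=> y /=; rewrite mulr_ge0 ?expR_ge0 // !addr_ge0 ?mulr_ge0 ?sqr_ge0 // /M addr_ge0.
  - move=> s t /andP[rs sr]; rewrite /= in_itv /= => tr; apply: dshift_bound => //.
    by rewrite /M; have := ler_norm eta; have := ler_norm (- eta); rewrite normrN ler_norml; lra.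
  - by rewrite ltrBlDr !ltrDl ltr01.
by move=> t; apply: (@der_continuous _ _ _ (_ : R)).
Qed.

(** On the vertical side at [r] the integrand is at most [expR (1 + |x|) * expR (- (eta * r ^+ 2))],
    and integration over [eta] brings the factor [1 / r ^+ 2]. *)
Lemma contour_shift_le r : 0 < r ->
  `|\int[lmu]_(t in `[0, r]) shift_re 1 t - \int[lmu]_(t in `[0, r]) shift_re 0 t|
  <= expR (1 + `|x|) / r ^+ 2.
Proof.
move=> r0; rewrite (contour_shift_diff (ltW r0)).
have cQ : continuous (fun eta : R => - shift_im eta r).
  by move=> t; apply: (@der_continuous _ _ _ (_ : R)).
have cE : continuous (fun eta : R => expR (1 + `|x|) * expR (- (eta * r ^+ 2))).
  by move=> t; apply: (@der_continuous _ _ _ (_ : R)).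
apply: le_trans; first by apply: le_normr_Rintegral => //; exact: continuous_integrable_cc.
apply: (@le_trans _ _ (\int[lmu]_(eta in `[0, 1]) (expR (1 + `|x|) * expR (- (eta * r ^+ 2))))).
  apply: le_Rintegral => //.
  - by apply: continuous_integrable_cc => t; apply: cvg_norm; exact: cQ.
  - exact: continuous_integrable_cc.
  move=> eta; rewrite /= in_itv /= => /andP[e0 e1].
  rewrite normrN normrM ger0_norm ?expR_ge0 // -expRD -[leRHS]mulr1.
  apply: ler_pM; rewrite ?expR_ge0 ?sin_max // ler_expR /shift_exp.
  have : - (x * eta) <= `|x|.
    apply: le_trans (ler_norm _) _; rewrite normrN normrM ler_piMr // ger0_norm //.
  have : eta ^+ 3 <= 1 by apply: exprn_ile1.
  by lra.
have dF (eta : R) : is_derive eta 1 (fun eta => - (expR (1 + `|x|) / r ^+ 2 * expR (- (eta * r ^+ 2))))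
    (expR (1 + `|x|) * expR (- (eta * r ^+ 2))).
  by der_tac; set E := expR (1 + _); set F := expR _; field; rewrite gt_eqF.
rewrite (Rintegral_FTC _ dF) // mul0r oppr0 expR0 mulr1 opprK addrC lerBlDr lerDl.
by rewrite mulr_ge0 ?expR_ge0 // mulr_ge0 ?expR_ge0 // invr_ge0 sqr_ge0.
Qed.

Lemma shift_re1 t : shift_re 1 t = expR (3^-1 - x) * airy_fun x t.
Proof.
rewrite /shift_re /airy_fun /airy_phase mulrA -expRD; congr (expR _ * cos _).
  by rewrite /shift_exp; field.
by rewrite /shift_arg; ring.
Qed.

Lemma gauss_le (t : R) : expR (- t ^+ 2) <= 4 ^+ 4 / (1 + t ^+ 2) ^+ 4.
Proof.
have := @expRN_sqr_le R 1 t; rewrite mul1r divr1.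
by apply; apply/andP; split; lra.
Qed.

(** The difference of the contours vanishes in the limit, and on the shifted line the integral
    converges absolutely; so the limit defining [Airy] exists and is this integral. *)
Lemma Airy_shifted : Airy x = expR (3^-1 - x) / pi * \int[lmu]_(t in `[0, +oo[) airy_fun x t.
Proof.
rewrite /Airy mulrC [in RHS]mulrAC; congr (_ / _); apply: cvg_lim => //.
apply/cvg_pinftyP => u uy.
(* The upper end in [dominated_growing_cvg] has the form [pi * k_ n]. *)
have uy' : u n / pi @[n --> \oo] --> +oo.
  apply/cvgryPge => A; move/cvgryPge : uy => /(_ (A * pi)); apply: filterS => n.
  by rewrite ler_pdivlMr ?pi_gt0.
have uE n : pi * (u n / pi) = u n by rewrite mulrC divfK // gt_eqF ?pi_gt0.
have L : \int[lmu]_(t in `[0, u n]) airy_fun x t @[n --> \oo] --> \int[lmu]_(t in `[0, +oo[) airy_fun x t.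
  have := @dominated_growing_cvg R _ (fun=> airy_fun x) (airy_fun x) (4 ^+ 4) uy'.
  under eq_fun do rewrite uE.
  apply=> [_||t _||n t _]; rewrite ?exprn_ge0 //.
  - exact: continuous_airy_fun.
  - exact: continuous_airy_fun.
  - exact: seq_cst.
  rewrite /airy_fun normrM ger0_norm ?expR_ge0 //.
  apply: (le_trans _ (le_div_oneDsqrX _ (exprn_ge0 4 (ler0n _ 4)))); rewrite -[leRHS]mulr1.
  by apply: ler_pM; rewrite ?expR_ge0 ?cos_max ?gauss_le.
have ul : (u n)^-1 @[n --> \oo] --> 0.
  by apply/gtr0_cvgV0 => //; move/cvgryPgt : uy; apply.
have el : expR (1 + `|x|) * (u n)^-1 ^+ 2 @[n --> \oo] --> 0.
  rewrite [X in _ --> X](_ : 0 = expR (1 + `|x|) * 0 ^+ 2); last by rewrite expr0n mulr0.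
  by apply: seqM; [exact: seq_cst | exact: seqX].
have re0 t : cos (t ^+ 3 / 3 + x * t) = shift_re 0 t.
  by rewrite /shift_re /shift_exp /shift_arg mul0r !expr0n /= !mul0r mulr0 !subr0 oppr0 add0r expR0 mul1r.
under eq_fun do under eq_Rintegral do rewrite re0.
have S1 n : \int[lmu]_(t in `[0, u n]) shift_re 1 t = expR (3^-1 - x) * \int[lmu]_(t in `[0, u n]) airy_fun x t.
  by rewrite -Rintegral_ccZ; [apply: eq_Rintegral => t _; rewrite shift_re1 | exact: continuous_airy_fun].
have M := seqM (seq_cst (expR (3^-1 - x))) L.
apply: (@squeeze_cvgr _ _ _ _
  (fun n => expR (3^-1 - x) * \int[lmu]_(t in `[0, u n]) airy_fun x t - expR (1 + `|x|) * (u n)^-1 ^+ 2)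
  (fun n => expR (3^-1 - x) * \int[lmu]_(t in `[0, u n]) airy_fun x t + expR (1 + `|x|) * (u n)^-1 ^+ 2)).
- have u0 : \forall n \near \oo, 0 < u n by move/cvgryPgt : uy; apply.
  apply: filterS u0 => n u0; have := contour_shift_le u0.
  rewrite S1 exprVn ler_norml; move: (\int[lmu]_(t in _) airy_fun x t) (\int[lmu]_(t in _) shift_re 0 t) => A B.
  by move=> /andP[? ?]; apply/andP; split; lra.
- by rewrite -[X in _ --> X]subr0; apply: seqB.
- by rewrite -[X in _ --> X]addr0; apply: seqD.
Qed.

End contour_shift.

Section airy_derivatives.
Context {R : realType}.
Local Notation lmu := (@lebesgue_measure R).

Lemma gauss_mul_le : exists2 C : R, 0 <= C & forall a t : R,
  `|a| <= 2 * (1 + t ^+ 2) -> `|expR (- t ^+ 2) * a| <= C * (1 + t ^+ 2)^-1.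
Proof.
exists (4 ^+ 4 * 2); first by rewrite mulr_ge0 ?exprn_ge0.
move=> a t at2; have t1 : 1 <= 1 + t ^+ 2 by rewrite lerDl sqr_ge0.
have t0 : 0 < 1 + t ^+ 2 by apply: lt_le_trans t1.
rewrite normrM (ger0_norm (expR_ge0 _)).
apply: (@le_trans _ _ (4 ^+ 4 / (1 + t ^+ 2) ^+ 4 * (2 * (1 + t ^+ 2)))).
  by apply: ler_pM; rewrite ?expR_ge0 ?gauss_le.
have -> : 4 ^+ 4 / (1 + t ^+ 2) ^+ 4 * (2 * (1 + t ^+ 2)) = 4 ^+ 4 * 2 / (1 + t ^+ 2) ^+ 3.
  by move: (4 ^+ 4) => c; field; rewrite gt_eqF.
rewrite ler_wpM2l ?mulr_ge0 ?exprn_ge0 // lef_pV2 ?posrE ?exprn_gt0 //.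
by rewrite (exprS (1 + t ^+ 2) 2); apply: ler_peMr; [exact: ltW | exact: exprn_ege1].
Qed.

Lemma integrable_gauss_mul (p : R -> R) : continuous p ->
  (forall t, 0 <= t -> `|p t| <= 2 * (1 + t ^+ 2)) ->
  lmu.-integrable `[0, +oo[ (EFin \o (fun t => expR (- t ^+ 2) * p t)).
Proof.
move=> cp pb; have [C C0 CP] := gauss_mul_le.
have I : lmu.-integrable `[0, +oo[ (EFin \o (fun t => C * (1 + t ^+ 2)^-1)).
  exact: (integrableZl _ C (@integrable_oneDsqrV R)).
apply: (le_integrable _ _ _ I) => //.
  apply/measurable_EFinP; apply: measurable_funTS; apply: measurable_funM.
    by apply: continuous_measurable_fun => t; apply: (@der_continuous _ _ _ (_ : R)).
  exact: continuous_measurable_fun.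
move=> t; rewrite /= in_itv /= andbT => t0; rewrite lee_fin.
apply: le_trans (ler_norm _); apply: CP; exact: pb.
Qed.

Lemma is_derive_gauss_int (p dp : R -> R -> R) (m : R) :
  (forall m, continuous (p m)) ->
  (forall m t : R, is_derive m 1 (p ^~ t) (dp m t)) ->
  (forall m t, 0 <= t -> `|p m t| <= 2 * (1 + t ^+ 2)) ->
  (forall m t, 0 <= t -> `|dp m t| <= 2 * (1 + t ^+ 2)) ->
  is_derive m 1 (fun m => \int[lmu]_(t in `[0, +oo[) (expR (- t ^+ 2) * p m t))
    (\int[lmu]_(t in `[0, +oo[) (expR (- t ^+ 2) * dp m t)).
Proof.
move=> cp dpd pb dpb; have [C C0 CP] := gauss_mul_le.
have I : lmu.-integrable `[0, +oo[ (EFin \o (fun t => C * (1 + t ^+ 2)^-1)).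
  exact: (integrableZl _ C (@integrable_oneDsqrV R)).
have C1 (t : R) : 0 <= C * (1 + t ^+ 2)^-1 by rewrite mulr_ge0 // invr_ge0 addr_ge0 // sqr_ge0.
apply: (@is_derive_integral _ _ (fun m t => expR (- t ^+ 2) * p m t) (fun m t => expR (- t ^+ 2) * dp m t)
  _ (m - 1) (m + 1) m _ _ _ I C1) => //.
- by move=> s _; apply: integrable_gauss_mul => // t t0; exact: pb.
- by move=> s t _; rewrite /= in_itv /= andbT => t0; apply: CP; exact: dpb.
- by rewrite ltrBlDr !ltrDl ltr01.
Qed.

Lemma continuous_airy_phase (m : R) : continuous (airy_phase m).
Proof. by move=> t; apply: (@der_continuous _ _ _ (_ : R)). Qed.

Let linear_le (t : R) : 0 <= t -> 1 + t <= 2 * (1 + t ^+ 2).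
Proof. by move=> t0; have := sqr_ge0 (t - 1); rewrite sqrrB1; have := sqr_ge0 t; lra. Qed.

Let quadratic_le (t : R) : 0 <= t -> t + t ^+ 2 <= 2 * (1 + t ^+ 2).
Proof. by move=> t0; have := sqr_ge0 (t - 1); rewrite sqrrB1; have := sqr_ge0 t; lra. Qed.

Let trig_le (a b u : R) : `|a * sin u + b * cos u| <= `|a| + `|b|.
Proof.
apply: le_trans (ler_normD _ _) _; rewrite !normrM.
by apply: lerD; rewrite ler_piMr ?sin_max ?cos_max.
Qed.

Let airy_cos (m : R) : R := \int[lmu]_(t in `[0, +oo[) airy_fun m t.
Let airy_dcos (m : R) : R := \int[lmu]_(t in `[0, +oo[) airy_dfun m t.
(** The [m]-derivative of [airy_cos]; the coefficient 0 is kept so that one template,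
    [a sin + b cos], serves all integrands. *)
Let airy_tsin (m : R) : R := \int[lmu]_(t in `[0, +oo[) (expR (- t ^+ 2) * (- t * sin (airy_phase m t) + 0 * cos (airy_phase m t))).
Let airy_d2 (m : R) : R := \int[lmu]_(t in `[0, +oo[)
  (expR (- t ^+ 2) * (t * sin (airy_phase m t) + (- t ^+ 2) * cos (airy_phase m t))).

Let cp0 (m : R) (a b : R -> R) : continuous a -> continuous b ->
  continuous (fun t => a t * sin (airy_phase m t) + b t * cos (airy_phase m t)).
Proof.
move=> ca cb; apply: continuous_Df => t.
  by apply: cvgM; [exact: ca | apply: continuous_comp; [exact: continuous_airy_phase | exact: continuous_sin]].
by apply: cvgM; [exact: cb | apply: continuous_comp; [exact: continuous_airy_phase | exact: continuous_cos]].
Qed.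

Let cid : continuous (fun t : R => t).
Proof. by move=> t; exact: cvg_id. Qed.

Let csqr : continuous (fun t : R => - t ^+ 2).
Proof. by move=> t; apply: (@der_continuous _ _ _ (_ : R)). Qed.

Let is_derive_airy_cos (m : R) : is_derive m 1 airy_cos (airy_tsin m).
Proof.
have := @is_derive_gauss_int (fun m t => 0 * sin (airy_phase m t) + 1 * cos (airy_phase m t))
  (fun m t => - t * sin (airy_phase m t) + 0 * cos (airy_phase m t)) m.
have -> : (fun m => \int[lmu]_(t in `[0, +oo[) (expR (- t ^+ 2) * (0 * sin (airy_phase m t) + 1 * cos (airy_phase m t)))) = airy_cos.
  by apply/funext => s; apply: eq_Rintegral => t _; rewrite mul0r add0r mul1r.
apply.
- by move=> s; apply: cp0 => t; exact: cst_continuous.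
- move=> s t; rewrite /airy_phase; der_tac.
  by set S := sin _; set C := cos _; ring.
- move=> s t t0; apply: le_trans (trig_le _ _ _) _; rewrite normr0 normr1 add0r.
  by apply: le_trans (linear_le t0); rewrite lerDl.
- move=> s t t0; apply: le_trans (trig_le _ _ _) _; rewrite normr0 normrN addr0 ger0_norm //.
  by apply: le_trans (linear_le t0); rewrite lerDr.
Qed.

(** The difference is the contribution of the prefactor [exp(1/3 - m)] when [Airy_shifted] is
    differentiated. *)
Let airy_dcosE (m : R) : airy_dcos m = airy_tsin m - airy_cos m.
Proof.
rewrite /airy_tsin /airy_cos -RintegralB //; last 2 first.
- apply: integrable_gauss_mul; first by apply: cp0 => // t; [exact: cvgN | exact: cst_continuous].
  move=> t t0; apply: le_trans (trig_le _ _ _) _; rewrite normr0 normrN addr0 ger0_norm //.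
  by apply: le_trans (linear_le t0); rewrite lerDr.
- apply: integrable_gauss_mul.
    by move=> t; apply: continuous_comp; [exact: continuous_airy_phase | exact: continuous_cos].
  move=> t t0; apply: le_trans (cos_max _) _.
  by apply: le_trans (linear_le t0); rewrite lerDl.
by apply: eq_Rintegral => t _; rewrite /airy_dfun /airy_fun; ring.
Qed.

Let is_derive_airy_dcos (m : R) : is_derive m 1 airy_dcos (airy_d2 m).
Proof.
have := @is_derive_gauss_int (fun m t => - t * sin (airy_phase m t) + (- 1) * cos (airy_phase m t))
  (fun m t => t * sin (airy_phase m t) + (- t ^+ 2) * cos (airy_phase m t)) m.
have -> : (fun m => \int[lmu]_(t in `[0, +oo[) (expR (- t ^+ 2) * (- t * sin (airy_phase m t) + (- 1) * cos (airy_phase m t)))) = airy_dcos.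
  by apply/funext => s; apply: eq_Rintegral => t _; rewrite /airy_dfun; ring.
apply.
- by move=> s; apply: cp0 => t; [apply: cvgN; exact: cvg_id | exact: cst_continuous].
- move=> s t; rewrite /airy_phase; der_tac.
  by set S := sin _; set C := cos _; ring.
- move=> s t t0; apply: le_trans (trig_le _ _ _) _; rewrite !normrN normr1 ger0_norm // addrC.
  exact: linear_le.
- move=> s t t0; apply: le_trans (trig_le _ _ _) _; rewrite normrN !ger0_norm ?sqr_ge0 //.
  exact: quadratic_le.
Qed.

Lemma is_derive_Airy (m : R) : is_derive m 1 (@Airy R) (expR (3^-1 - m) / pi * airy_dcos m).
Proof.
have -> : @Airy R = fun m => expR (3^-1 - m) / pi * airy_cos m by apply/funext => s; exact: Airy_shifted.
have h := is_derive_airy_cos m; rewrite airy_dcosE; der_tac.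
set E := expR _; set A := airy_cos m; set B := airy_tsin m.
have : pi != 0 :> R by rewrite gt_eqF ?pi_gt0.
by move: (pi : R) => p p0; field.
Qed.

Lemma dAiry_shifted (m : R) :
  dAiry m = expR (3^-1 - m) / pi * \int[lmu]_(t in `[0, +oo[) airy_dfun m t.
Proof. by rewrite /dAiry derive1E (@derive_val _ _ _ _ _ _ _ (is_derive_Airy m)). Qed.

(* The contour integral of the exact differential [d (i exp(i (z^3/3 + m z)))]. *)
Let airy_ode_int (m : R) : airy_d2 m - airy_dcos m = m * airy_cos m.
Proof.
pose g t : R := expR (- t ^+ 2) * (2 * t * sin (airy_phase m t) + (1 - t ^+ 2 - m) * cos (airy_phase m t)).
have intc : lmu.-integrable `[0, +oo[ (EFin \o airy_fun m).
  apply: integrable_gauss_mul.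
    by move=> t; apply: continuous_comp; [exact: continuous_airy_phase | exact: continuous_cos].
  move=> t t0; apply: le_trans (cos_max _) _.
  by apply: le_trans (linear_le t0); rewrite lerDl.
have intd : lmu.-integrable `[0, +oo[ (EFin \o airy_dfun m).
  have -> : airy_dfun m = fun t => expR (- t ^+ 2) * (- t * sin (airy_phase m t) + (- 1) * cos (airy_phase m t)).
    by apply/funext => t; rewrite /airy_dfun; ring.
  apply: integrable_gauss_mul.
    by apply: cp0 => t; [apply: cvgN; exact: cvg_id | exact: cst_continuous].
  move=> t t0; apply: le_trans (trig_le _ _ _) _; rewrite !normrN normr1 ger0_norm // addrC.
  exact: linear_le.
have int2 : lmu.-integrable `[0, +oo[ (EFin \o (fun t => expR (- t ^+ 2) * (t * sin (airy_phase m t) + (- t ^+ 2) * cos (airy_phase m t)))).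
  apply: integrable_gauss_mul; first exact: cp0.
  move=> t t0; apply: le_trans (trig_le _ _ _) _; rewrite normrN !ger0_norm ?sqr_ge0 //.
  exact: quadratic_le.
have E : \int[lmu]_(t in `[0, +oo[) g t = airy_d2 m - airy_dcos m - m * airy_cos m.
  pose f2 t := expR (- t ^+ 2) * (t * sin (airy_phase m t) + (- t ^+ 2) * cos (airy_phase m t)) : R.
  have i2 : lmu.-integrable `[0, +oo[ (EFin \o (fun t => m * airy_fun m t)).
    exact: (integrableZl _ m intc).
  have i3 : lmu.-integrable `[0, +oo[ (EFin \o (fun t => expR (- t ^+ 2) *
      (t * sin (airy_phase m t) + (- t ^+ 2) * cos (airy_phase m t)) - airy_dfun m t)).
    exact: (integrableB _ int2 intd).
  rewrite /airy_d2 /airy_dcos /airy_cos -!RintegralZl // -RintegralB // -RintegralB //.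
  apply: eq_Rintegral => t _; rewrite /g /airy_dfun /airy_fun.
  by set S := sin _; set C := cos _; set X := expR _; ring.
apply/eqP; rewrite -subr_eq0 -E; apply/eqP.
(* The primitive is 0 at [t = 0], where the phase vanishes, and is killed by the Gaussian at
   infinity. *)
have dG (t : R) : is_derive t 1 (fun t => - (expR (- t ^+ 2) * sin (airy_phase m t))) (g t).
  rewrite /g /airy_phase; der_tac.
  by set S := sin _; set C := cos _; set X := expR _; field.
have cg : continuous g by move=> t; apply: (@der_continuous _ _ _ (_ : R)).
have ny : (n%:R : R) @[n --> \oo] --> +oo by exact: cvgr_idn.
have pb t : 0 <= t -> `|g t| <= (4 ^+ 4 * (3 + `|m|)) / (1 + t ^+ 2).
  move=> t0; have t1 : 1 <= 1 + t ^+ 2 by rewrite lerDl sqr_ge0.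
  have tg : 0 < 1 + t ^+ 2 by apply: lt_le_trans t1.
  rewrite /g normrM (ger0_norm (expR_ge0 _)).
  apply: (@le_trans _ _ (4 ^+ 4 / (1 + t ^+ 2) ^+ 4 * ((3 + `|m|) * (1 + t ^+ 2)))).
    apply: ler_pM; rewrite ?expR_ge0 ?gauss_le //.
    apply: le_trans (trig_le _ _ _) _.
    have a1 : `|2 * t| <= 1 + t ^+ 2.
      by rewrite ger0_norm ?mulr_ge0 //; have := sqr_ge0 (t - 1); rewrite sqrrB1; lra.
    have a2 : `|1 - t ^+ 2 - m| <= 1 + t ^+ 2 + `|m|.
      have := sqr_ge0 t; have := ler_norm m; have := ler_norm (- m); rewrite normrN ler_norml.
      by move=> ? ? ?; apply/andP; split; lra.
    have : 0 <= `|m| * t ^+ 2 by rewrite mulr_ge0 ?sqr_ge0.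
    by move: a1 a2; rewrite mulrDl !mulrDr; have := sqr_ge0 t; lra.
  have -> : 4 ^+ 4 / (1 + t ^+ 2) ^+ 4 * ((3 + `|m|) * (1 + t ^+ 2)) = 4 ^+ 4 * (3 + `|m|) / (1 + t ^+ 2) ^+ 3.
    by move: (4 ^+ 4) => c; field; rewrite gt_eqF.
  rewrite ler_wpM2l ?mulr_ge0 ?exprn_ge0 ?addr_ge0 // lef_pV2 ?posrE ?exprn_gt0 //.
  by rewrite (exprS (1 + t ^+ 2) 2); apply: ler_peMr; [exact: ltW | exact: exprn_ege1].
have K0 : 0 <= 4 ^+ 4 * (3 + `|m|) by rewrite mulr_ge0 ?exprn_ge0 ?addr_ge0.
have L : \int[lmu]_(t in `[0, pi * n%:R]) g t @[n --> \oo] --> \int[lmu]_(t in `[0, +oo[) g t.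
  apply: (dominated_growing_cvg ny (fun=> cg) cg _ K0).
    by move=> t _; exact: seq_cst.
  by move=> n t /andP[t0 _]; exact: pb.
have L0 : \int[lmu]_(t in `[0, pi * n%:R]) g t @[n --> \oo] --> (0 : R).
  have k1 (n : nat) : 0 <= pi * n%:R :> R by rewrite mulr_ge0 ?pi_ge0.
  have ph0 : airy_phase m 0 = 0 by rewrite /airy_phase expr0n /= mul0r mulr0 addr0.
  have ex : (fun n : nat => expR (- (pi * n%:R) ^+ 2)) n @[n --> \oo] --> (0 : R).
    apply: (@cvg_comp _ _ _ (fun n : nat => (pi * n%:R : R) ^+ 2) (fun y => expR (- y)) _ +oo); last first.
      exact: cvgr_expR.
    apply/cvgryPge => A; near=> n.
    have An : `|A| + 1 <= n%:R by near: n; exact: nbhs_infty_ger.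
    have n1 : 1 <= n%:R :> R by apply: le_trans An; rewrite lerDr.
    have p1 : 1 <= pi :> R by have := @pi_ge2 R; lra.
    apply: (@le_trans _ _ n%:R); first by have := ler_norm A; lra.
    apply: (@le_trans _ _ (pi * n%:R)); first by rewrite ler_peMl // ltW // (lt_le_trans ltr01).
    by rewrite expr2 ler_peMl // mulr_ege1.
  apply: (@squeeze_cvgr _ _ _ _ (fun n : nat => - expR (- (pi * n%:R) ^+ 2)) (fun n : nat => expR (- (pi * n%:R) ^+ 2))) => //.
    apply: nearW => n; rewrite (Rintegral_FTC (k1 n) dG cg) ph0 sin0 mulr0 oppr0 subr0.
    have := sin_max (airy_phase m (pi * n%:R)); have := expR_ge0 (- (pi * n%:R : R) ^+ 2).
    rewrite -ler_norml normrN normrM => e0 s1; rewrite (ger0_norm e0).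
    by rewrite ler_piMr.
  by rewrite -oppr0; apply: seqN.
by apply: (cvg_unique _ L L0).
Unshelve. all: by end_near. Qed.

(** Airy's equation. Differentiating the prefactor subtracts [airy_dcos] from [airy_d2], and
    [airy_ode_int] evaluates the difference. *)
Lemma is_derive_dAiry (m : R) : is_derive m 1 (@dAiry R) (m * Airy m).
Proof.
have -> : @dAiry R = fun m => expR (3^-1 - m) / pi * airy_dcos m.
  by apply/funext => s; exact: dAiry_shifted.
have h := is_derive_airy_dcos m; rewrite Airy_shifted -/(airy_cos m); der_tac.
have -> : m * (expR (3^-1 - m) / pi * airy_cos m) = expR (3^-1 - m) / pi * (m * airy_cos m) by ring.
rewrite -airy_ode_int.
set E := expR _; set A := airy_cos m; set B := airy_dcos m; set D := airy_d2 m.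
have : pi != 0 :> R by rewrite gt_eqF ?pi_gt0.
by move: (pi : R) => p p0; field.
Qed.

End airy_derivatives.

(** * The Airy kernel on the diagonal *)

Section airy_kernel_diagonal.
Context {R : realType}.
Implicit Types (p q m d : R).
Local Notation A := (@Airy R).
Local Notation D := (@dAiry R).

(* Second derivative along [(m + d, m - d)], in [d], of the cleared numerator
   of the kernel. *)
Definition kernel_taylor p q : R :=
  2 * (p + q) * ((p + q) * (A p * A q) - 2 * (D p * D q))
  - 2 * (A p * D q + D p * A q) - (p - q) ^+ 2 * (A p * A q).

(** The kernel at [(m + d, m - d)] is [num m d / (8 d^3)]. Airy's equation makes the derivative of
    [num] divisible by [2 d], with quotient [num1]. *)
Let num m d : R := 2 * d * (2 * m * (A (m + d) * A (m - d)) - 2 * (D (m + d) * D (m - d)))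
  + 2 * (A (m + d) * D (m - d) - D (m + d) * A (m - d)).
Let num1 m d : R := 4 * m * (D (m + d) * A (m - d) - A (m + d) * D (m - d))
  - 2 * d * (A (m + d) * D (m - d) + D (m + d) * A (m - d)).

Let is_derive_Ap m d : is_derive d 1 (fun d => A (m + d)) (D (m + d)).
Proof.
have h1 : is_derive d 1 (fun d => m + d) 1 by der_tac; ring.
have h2 : is_derive (m + d) 1 A (D (m + d)).
  by rewrite dAiry_shifted; exact: is_derive_Airy.
by have := der_comp h1 h2; rewrite mulr1.
Qed.

Let is_derive_Am m d : is_derive d 1 (fun d => A (m - d)) (- D (m - d)).
Proof.
have h1 : is_derive d 1 (fun d => m - d) (- 1) by der_tac; ring.
have h2 : is_derive (m - d) 1 A (D (m - d)).
  by rewrite dAiry_shifted; exact: is_derive_Airy.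
by have := der_comp h1 h2; rewrite mulrN1.
Qed.

Let is_derive_Dp m d : is_derive d 1 (fun d => D (m + d)) ((m + d) * A (m + d)).
Proof.
have h1 : is_derive d 1 (fun d => m + d) 1 by der_tac; ring.
by have := der_comp h1 (is_derive_dAiry (m + d)); rewrite mulr1.
Qed.

Let is_derive_Dm m d : is_derive d 1 (fun d => D (m - d)) (- ((m - d) * A (m - d))).
Proof.
have h1 : is_derive d 1 (fun d => m - d) (- 1) by der_tac; ring.
by have := der_comp h1 (is_derive_dAiry (m - d)); rewrite mulrN1.
Qed.

Let is_derive_num m d : is_derive d 1 (num m) (2 * d * num1 m d).
Proof.
have gen (a b a1 b1 : R -> R) : is_derive d 1 a (a1 d) -> is_derive d 1 b (- b1 d) ->
    is_derive d 1 a1 ((m + d) * a d) -> is_derive d 1 b1 (- ((m - d) * b d)) ->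
  is_derive d 1 (fun d => 2 * d * (2 * m * (a d * b d) - 2 * (a1 d * b1 d)) + 2 * (a d * b1 d - a1 d * b d))
    (2 * d * (4 * m * (a1 d * b d - a d * b1 d) - 2 * d * (a d * b1 d + a1 d * b d))).
  move=> h1 h2 h3 h4; der_tac.
  by move: (a d) (b d) (a1 d) (b1 d) => x y z w; ring.
exact: (gen _ _ _ _ (is_derive_Ap m d) (is_derive_Am m d) (is_derive_Dp m d) (is_derive_Dm m d)).
Qed.

Let is_derive_num1 m d : is_derive d 1 (num1 m) (kernel_taylor (m + d) (m - d)).
Proof.
have gen (a b a1 b1 : R -> R) : is_derive d 1 a (a1 d) -> is_derive d 1 b (- b1 d) ->
    is_derive d 1 a1 ((m + d) * a d) -> is_derive d 1 b1 (- ((m - d) * b d)) ->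
  is_derive d 1 (fun d => 4 * m * (a1 d * b d - a d * b1 d) - 2 * d * (a d * b1 d + a1 d * b d))
    (2 * (m + d + (m - d)) * ((m + d + (m - d)) * (a d * b d) - 2 * (a1 d * b1 d))
      - 2 * (a d * b1 d + a1 d * b d) - (m + d - (m - d)) ^+ 2 * (a d * b d)).
  move=> h1 h2 h3 h4; der_tac.
  by move: (a d) (b d) (a1 d) (b1 d) => x y z w; ring.
exact: (gen _ _ _ _ (is_derive_Ap m d) (is_derive_Am m d) (is_derive_Dp m d) (is_derive_Dm m d)).
Qed.

(** Two mean value steps replace a third-order expansion: Cauchy's for [num] against [d ^+ 3], then
    Lagrange's for [num1], which vanishes at [d = 0]. The factors [2/3] and [1/8] give [1/12]. *)
Let kernel_mean_value_pos m d : 0 < d ->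
  exists2 c, 0 < c < d & airy_kernel_offdiag (m + d) (m - d) = kernel_taylor (m + c) (m - c) / 12.
Proof.
move=> d0.
have rolle (f df : R -> R) s : 0 < s -> (forall x : R, is_derive x 1 f (df x)) ->
    exists2 c, 0 < c < s & f s - f 0 = df c * s.
  move=> s0 fd; have [|c] := @MVT R f df 0 s s0 (fun x _ => fd x).
    by apply: continuous_subspaceT => x; exact: der_continuous (fd x).
  by rewrite in_itv /= subr0 => cs E; exists c.
(* [phi] vanishes at both ends of [[0, d]]. *)
pose phi s := num m s * d ^+ 3 - num m d * s ^+ 3.
have dphi (s : R) : is_derive s 1 phi (2 * s * num1 m s * d ^+ 3 - num m d * (3 * s ^+ 2)).
  have h := is_derive_num m s; rewrite /phi; der_tac.
  by move: (num m d) (num m s) (num1 m s) => a b c; ring.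
have [c /andP[c0 cd]] := rolle _ _ d d0 dphi.
have num0 : num m 0 = 0 by rewrite /num addr0 subr0; ring.
rewrite /phi num0 expr0n /= mulr0 mul0r subrr subr0 subrr => /esym/eqP.
rewrite mulf_eq0 [d == 0]gt_eqF // orbF subr_eq0 => /eqP E1.
have [c' /andP[c'0 c'c]] := rolle _ _ c c0 (is_derive_num1 m).
rewrite {2}/num1 addr0 subr0 [D m * A m]mulrC subrr !mulr0 mul0r !subr0 => E2.
exists c'; first by rewrite c'0 (lt_trans c'c).
have dn0 : d != 0 by rewrite gt_eqF.
have cn0 : c != 0 by rewrite gt_eqF.
have numE : num m d = 2 * (kernel_taylor (m + c') (m - c')) * d ^+ 3 / 3.
  apply: (mulIf (_ : 3 * c ^+ 2 != 0)); first by rewrite mulf_neq0 ?expf_neq0.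
  by rewrite -E1 E2; move: (kernel_taylor _ _) => L; field.
transitivity (num m d / (8 * d ^+ 3)); last by rewrite numE; move: (kernel_taylor _ _) => L; field.
rewrite /airy_kernel_offdiag /num (_ : m + d - (m - d) = 2 * d); last by ring.
rewrite (_ : m + d + (m - d) = 2 * m); last by ring.
by move: (A (m + d)) (A (m - d)) (D (m + d)) (D (m - d)) => a b a' b'; field.
Qed.

Lemma airy_kernel_offdiagC p q : airy_kernel_offdiag p q = airy_kernel_offdiag q p.
Proof.
rewrite /airy_kernel_offdiag -(opprB q p) (addrC q p).
move: (q - p) (A p) (A q) (D p) (D q) => e a b a' b'.
rewrite sqrrN (_ : (- e) ^+ 3 = - e ^+ 3); last by ring.
by rewrite invrN; move: ((e ^+ 2)^-1) ((e ^+ 3)^-1) => u v; ring.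
Qed.

(** With [m] the midpoint and [d] half the difference, [p'] and [q'] lie between [p] and [q]; the
    joint limit at the diagonal is thereby reduced to the continuity of [kernel_taylor]. *)
Lemma kernel_mean_value mu r p q : p != q -> `|mu - p| < r -> `|mu - q| < r ->
  exists p' q', [/\ `|mu - p'| < r, `|mu - q'| < r &
    airy_kernel_offdiag p q = kernel_taylor p' q' / 12].
Proof.
wlog qp : p q / q < p => [H|_].
  have [qp|] := ltP q p; first exact: H.
  rewrite le_eqVlt => /predU1P[->|pq]; first by rewrite eqxx.
  rewrite eq_sym airy_kernel_offdiagC => ? ? ?; exact: H.
move=> pr qr; have d0 : 0 < (p - q) / 2 by rewrite divr_gt0 ?subr_gt0.
have [c /andP[c0 cd] E] := kernel_mean_value_pos ((p + q) / 2) d0.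
exists ((p + q) / 2 + c), ((p + q) / 2 - c); split.
- by move: pr qr; rewrite !ltr_norml => /andP[? ?] /andP[? ?]; apply/andP; split; lra.
- by move: pr qr; rewrite !ltr_norml => /andP[? ?] /andP[? ?]; apply/andP; split; lra.
by rewrite -E; congr airy_kernel_offdiag; field.
Qed.

Lemma continuous_Airy : continuous A.
Proof. by move=> x; exact: der_continuous (is_derive_Airy x). Qed.

Lemma continuous_dAiry : continuous D.
Proof. by move=> x; exact: der_continuous (is_derive_dAiry x). Qed.

Lemma airy_kernel_diag mu : airy_kernel mu mu =
  2 / 3 * mu ^+ 2 * A mu ^+ 2 - 2 / 3 * mu * D mu ^+ 2 - 1 / 3 * (A mu * D mu).
Proof.
rewrite /airy_kernel eqxx.
(* Points off the diagonal accumulate at [(mu, mu)], which makes the limit unique. *)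
have pf : ProperFilter (within [set p : R * R | p.1 != p.2] (nbhs (mu, mu))).
  apply: within_nbhs_proper => V /nbhs_ballP[e /= e0 eV].
  exists (mu + e / 2, mu); split; first by rewrite /= -subr_eq0 addrAC subrr add0r gt_eqF // divr_gt0.
  apply: eV; split; rewrite /= /ball /=; last by rewrite subrr normr0.
  rewrite opprD addrA subrr add0r normrN gtr0_norm ?divr_gt0 //; lra.
apply: cvg_lim => //.
have ct : (fun z : R * R => kernel_taylor z.1 z.2 / 12) z @[z --> (mu, mu)] --> kernel_taylor mu mu / 12.
  have c1 : z.1 @[z --> (mu, mu)] --> mu by exact: cvg_fst.
  have c2 : z.2 @[z --> (mu, mu)] --> mu by exact: cvg_snd.
  have a1 : A z.1 @[z --> (mu, mu)] --> A mu by apply: continuous_cvg => //; exact: continuous_Airy.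
  have a2 : A z.2 @[z --> (mu, mu)] --> A mu by apply: continuous_cvg => //; exact: continuous_Airy.
  have d1 : D z.1 @[z --> (mu, mu)] --> D mu by apply: continuous_cvg => //; exact: continuous_dAiry.
  have d2 : D z.2 @[z --> (mu, mu)] --> D mu by apply: continuous_cvg => //; exact: continuous_dAiry.
  have cM (f g : R * R -> R) (a b : R) : f z @[z --> (mu, mu)] --> a -> g z @[z --> (mu, mu)] --> b ->
    f z * g z @[z --> (mu, mu)] --> a * b by exact: cvgM.
  have cD (f g : R * R -> R) (a b : R) : f z @[z --> (mu, mu)] --> a -> g z @[z --> (mu, mu)] --> b ->
    f z + g z @[z --> (mu, mu)] --> a + b by exact: cvgD.
  have cB (f g : R * R -> R) (a b : R) : f z @[z --> (mu, mu)] --> a -> g z @[z --> (mu, mu)] --> b ->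
    f z - g z @[z --> (mu, mu)] --> a - b by exact: cvgB.
  have k (r : R) : (fun _ : R * R => r) z @[z --> (mu, mu)] --> r by exact: cvg_cst.
  have aa := cM _ _ _ _ a1 a2; have dd := cM _ _ _ _ d1 d2.
  have ad := cD _ _ _ _ (cM _ _ _ _ a1 d2) (cM _ _ _ _ d1 a2).
  have s := cD _ _ _ _ c1 c2; have e := cB _ _ _ _ c1 c2.
  apply: (cM _ _ _ _ _ (k 12^-1)); apply: (cB _ _ _ _ _ (cM _ _ _ _ (cM _ _ _ _ e e) aa)).
  apply: (cB _ _ _ _ _ (cM _ _ _ _ (k 2) ad)); apply: (cM _ _ _ _ (cM _ _ _ _ (k 2) s)).
  exact: (cB _ _ _ _ (cM _ _ _ _ s aa) (cM _ _ _ _ (k 2) dd)).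
rewrite (_ : _ - _ = kernel_taylor mu mu / 12); last first.
  by rewrite /kernel_taylor; move: (A mu) (D mu) => a b; field.
apply/cvgrPdist_lt => e e0; have /cvgrPdist_lt/(_ e e0)/nbhs_ballP[r /= r0 rP] := ct.
rewrite /within /=; apply/nbhs_ballP; exists r => //= z [z1 z2] zn.
have [p' [q' [p'r q'r ->]]] := kernel_mean_value zn z1 z2.
exact: (rP (p', q')).
Qed.

End airy_kernel_diagonal.

(** * Convergence at the edge *)

Section edge_universality.
Context {R : realType}.
Implicit Types (mu nu : R) (N : nat).

Definition edge_herm mu N : R :=
  herm_fun N (edge_point N mu) * edge_weight N * expR (- (mu * edge_scale N)).
Definition edge_dherm mu N : R :=
  edge_scale N / Num.sqrt N%:R * herm_dfun N (edge_point N mu) * edge_weight N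
    * expR (- (mu * edge_scale N)).

Lemma edge_herm_Airy mu : edge_herm mu N @[N --> \oo] --> Airy mu.
Proof. by rewrite Airy_shifted; case: (edge_herm_cvg mu). Qed.

Lemma edge_dherm_dAiry mu : edge_dherm mu N @[N --> \oo] --> dAiry mu.
Proof. by rewrite dAiry_shifted; case: (edge_herm_cvg mu). Qed.

Lemma inv_edge_scale_cvg : (@edge_scale R N)^-1 @[N --> \oo] --> (0 : R).
Proof.
apply/gtr0_cvgV0; last exact: edge_scale_cvg.
by near=> N; apply: edge_scale_gt0; near: N; exact: nbhs_infty_gt.
Unshelve. all: by end_near. Qed.

(** [s = N^(1/6)]: its integer powers express all the fractional powers of [N], so that [field] can
    treat the edge formulas. *)
Lemma edge_root N : (0 < N)%N -> exists2 s : R, s != 0 &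
  [/\ edge_scale N = s ^+ 2, Num.sqrt N%:R = s ^+ 3, N%:R = s ^+ 6 &
      forall mu, edge_point N mu = 2 * s ^+ 3 + mu / s].
Proof.
move=> N0; pose k : R := edge_scale N; pose S : R := Num.sqrt N%:R.
have k0 : k != 0 by rewrite gt_eqF ?edge_scale_gt0.
have S0 : S != 0 by rewrite gt_eqF // sqrtr_gt0 ltr0n.
have S2 : S ^+ 2 = k ^+ 3 := sqrt_edge_scale N.
have kE : k = (S / k) ^+ 2 by rewrite expr_div_n S2; field.
have SE : S = (S / k) ^+ 3.
  by rewrite expr_div_n (exprS S 2) S2; field.
exists (S / k); first by rewrite mulf_neq0 ?invr_eq0.
split => //; first by rewrite -(edge_scale_cube N) -/k [in LHS]kE -exprM.
by move=> mu; rewrite edge_pointE // -/k -/S -SE; congr (_ + _); field; rewrite k0 S0.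
Qed.

Lemma edge_norm_weight mu nu N : (0 < N)%N ->
  edge_norm mu nu N = edge_weight N ^+ 2 * expR (- (mu * edge_scale N)) * expR (- (nu * edge_scale N))
    / (edge_scale N ^+ 2 * N`!%:R ^+ 2).
Proof.
move=> N0; rewrite /edge_norm /edge_weight powR12_sqrt // -/(edge_scale N).
have k0 : edge_scale N != 0 :> R by rewrite gt_eqF ?edge_scale_gt0.
have S0 : Num.sqrt N%:R != 0 :> R by rewrite gt_eqF // sqrtr_gt0 ltr0n.
have f0 : N`!%:R != 0 :> R by rewrite pnatr_eq0 -lt0n fact_gt0.
have p0 : Num.sqrt (2 * pi) != 0 :> R by rewrite gt_eqF // sqrtr_gt0 mulr_gt0 ?pi_gt0.
have e0 : expR (2 * N%:R) != 0 :> R by rewrite gt_eqF ?expR_gt0.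
have m0 : expR (mu * edge_scale N) != 0 by rewrite gt_eqF ?expR_gt0.
have n0 : expR (nu * edge_scale N) != 0 by rewrite gt_eqF ?expR_gt0.
rewrite sqr_sqrtr; last first.
  by rewrite divr_ge0 // !mulr_ge0 ?sqrtr_ge0 ?expR_ge0 ?exprn_ge0 ?edge_scale_ge0.
rewrite (mulrDl mu nu) !expRD !expRN.
move: (expR (2 * N%:R)) (expR (mu * edge_scale N)) (expR (nu * edge_scale N)) (Num.sqrt (2 * pi)) (Num.sqrt N%:R) (N`!%:R) (edge_scale N) e0 m0 n0 p0 S0 f0 k0.
move=> e m n p S f k e0 m0 n0 p0 S0 f0 k0.
by field; rewrite ?e0 ?m0 ?n0 ?p0 ?S0 ?f0 ?k0.
Qed.

(** In the edge variables the large parts of the closed form cancel exactly, leaving the shape of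
    the Airy kernel plus corrections in powers of [N^(-1/3)]. *)
Lemma edge_kernel_sum_offdiag mu nu N : (0 < N)%N -> mu != nu ->
  edge_norm mu nu N * (N`!%:R * herm_kernel_sum N (edge_point N mu) (edge_point N nu)) =
  ((mu - nu) * ((mu + nu + (mu * nu + (mu - nu) ^+ 2) / 2 * (edge_scale N)^-1 ^+ 2 - (edge_scale N)^-1)
                 * (edge_herm mu N * edge_herm nu N)
               - 2 * (edge_dherm mu N * edge_dherm nu N))
   - (2 + (mu - nu) ^+ 2 * (edge_scale N)^-1)
     * (edge_dherm mu N * edge_herm nu N - edge_herm mu N * edge_dherm nu N)) / (mu - nu) ^+ 3.
Proof.
move=> N0 mn; rewrite edge_norm_weight // /edge_herm /edge_dherm.
have [s s0 [kE SE NE xE]] := edge_root N0.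
have d0 : mu - nu != 0 by rewrite subr_eq0.
have f0 : N`!%:R != 0 :> R by rewrite pnatr_eq0 -lt0n fact_gt0.
have H := herm_kernel_sum_offdiag N (edge_point N mu) (edge_point N nu).
have xy : edge_point N mu - edge_point N nu = (mu - nu) / s by rewrite !xE; field.
have K : herm_kernel_sum N (edge_point N mu) (edge_point N nu) =
  ((edge_point N mu - edge_point N nu) ^+ 3 * herm_kernel_sum N (edge_point N mu) (edge_point N nu))
    * s ^+ 3 / (mu - nu) ^+ 3.
  by rewrite xy; move: (herm_kernel_sum _ _ _) => X; field; rewrite s0 d0.
rewrite K H xy kE SE NE.
move: (herm_fun N (edge_point N mu)) (herm_fun N (edge_point N nu)) => a b.
move: (herm_dfun N (edge_point N mu)) (herm_dfun N (edge_point N nu)) => a' b'.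
rewrite !xE; move: (expR _) (expR _) (edge_weight N) (N`!%:R) f0 => e e' w f f0.
by field; rewrite s0 f0 d0.
Qed.

Lemma edge_kernel_sum_diag mu N : (0 < N)%N ->
  edge_norm mu mu N * (N`!%:R * herm_kernel_sum N (edge_point N mu) (edge_point N mu)) =
  (2 / 3 * (mu + mu ^+ 2 / 4 * (edge_scale N)^-1 ^+ 2) ^+ 2
    - 5 / 3 * (mu + mu ^+ 2 / 4 * (edge_scale N)^-1 ^+ 2) * (edge_scale N)^-1
    + (edge_scale N)^-1 ^+ 2) * edge_herm mu N ^+ 2
  + (4 / 3 * (edge_scale N)^-1 - 2 / 3 * mu - mu ^+ 2 / 6 * (edge_scale N)^-1 ^+ 2) * edge_dherm mu N ^+ 2
  - (1 / 3 + mu / 6 * (edge_scale N)^-1 ^+ 2) * (edge_herm mu N * edge_dherm mu N).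
Proof.
move=> N0; rewrite edge_norm_weight // /edge_herm /edge_dherm herm_kernel_sum_diag.
have [s s0 [kE SE NE xE]] := edge_root N0.
have f0 : N`!%:R != 0 :> R by rewrite pnatr_eq0 -lt0n fact_gt0.
rewrite kE SE NE.
move: (herm_fun N (edge_point N mu)) (herm_dfun N (edge_point N mu)) => a a'.
rewrite !xE; move: (expR _) (edge_weight N) (N`!%:R) f0 => e w f f0.
by field; rewrite s0 f0.
Qed.

(** Every coefficient carries a factor [N^(-1/3)]: a single kernel is smaller by that order than the
    sum of the kernels. *)
Lemma edge_kernel_diag mu N : (0 < N)%N ->
  edge_norm mu mu N * (N`!%:R * herm_kernel N (edge_point N mu) (edge_point N mu)) =
  ((edge_scale N)^-1 ^+ 2 - mu * (edge_scale N)^-1 - mu ^+ 2 / 4 * (edge_scale N)^-1 ^+ 3) * edge_herm mu N ^+ 2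
  + (edge_scale N)^-1 * edge_dherm mu N ^+ 2.
Proof.
move=> N0; rewrite edge_norm_weight // /edge_herm /edge_dherm herm_kernel_diag.
have [s s0 [kE SE NE xE]] := edge_root N0.
have f0 : N`!%:R != 0 :> R by rewrite pnatr_eq0 -lt0n fact_gt0.
rewrite -natr1 kE SE NE.
move: (herm_fun N (edge_point N mu)) (herm_dfun N (edge_point N mu)) => a a'.
rewrite !xE; move: (expR _) (edge_weight N) (N`!%:R) f0 => e w f f0.
by field; rewrite s0 f0.
Qed.

Lemma edge_kernel_sum_cvg mu nu :
  edge_norm mu nu N * (N`!%:R * herm_kernel_sum N (edge_point N mu) (edge_point N nu)) @[N --> \oo]
    --> airy_kernel mu nu.
Proof.
have hl := inv_edge_scale_cvg; have um := @edge_herm_Airy mu; have vm := @edge_dherm_dAiry mu.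
have un := @edge_herm_Airy nu; have vn := @edge_dherm_dAiry nu.
have N1 : \forall N \near \oo, (0 < N)%N by exact: nbhs_infty_gt.
have c (r : R) := seq_cst r.
have [<-|mn] := eqVneq mu nu.
  have q := seqD (c mu) (seqM (c (mu ^+ 2 / 4)) (seqX (m := 2) hl)).
  have P1 := seqD (seqB (seqM (c (2 / 3)) (seqX (m := 2) q)) (seqM (seqM (c (5 / 3)) q) hl)) (seqX (m := 2) hl).
  have P2 := seqB (seqB (seqM (c (4 / 3)) hl) (c (2 / 3 * mu))) (seqM (c (mu ^+ 2 / 6)) (seqX (m := 2) hl)).
  have P3 := seqD (c (1 / 3)) (seqM (c (mu / 6)) (seqX (m := 2) hl)).
  have L := seqB (seqD (seqM P1 (seqX (m := 2) um)) (seqM P2 (seqX (m := 2) vm))) (seqM P3 (seqM um vm)).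
  rewrite airy_kernel_diag.
  set l := (X in _ --> X) in L.
  rewrite [X in _ --> X](_ : _ = l).
    apply: cvg_trans L; apply: near_eq_cvg; apply: filterS N1 => N N0.
    by rewrite edge_kernel_sum_diag.
  by rewrite /l; move: (Airy mu) (dAiry mu) => a a'; field.
have P1 := seqB (seqD (c (mu + nu)) (seqM (c ((mu * nu + (mu - nu) ^+ 2) / 2)) (seqX (m := 2) hl))) hl.
have P2 := seqM (c (mu - nu)) (seqB (seqM P1 (seqM um un)) (seqM (c 2) (seqM vm vn))).
have P3 := seqD (c 2) (seqM (c ((mu - nu) ^+ 2)) hl).
have L := seqM (seqB P2 (seqM P3 (seqB (seqM vm un) (seqM um vn)))) (c ((mu - nu) ^+ 3)^-1).
set l := (X in _ --> X) in L.
rewrite [X in _ --> X](_ : _ = l).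
  apply: cvg_trans L; apply: near_eq_cvg; apply: filterS N1 => N N0.
  by rewrite edge_kernel_sum_offdiag.
have d0 : mu - nu != 0 by rewrite subr_eq0.
rewrite /l /airy_kernel (negPf mn) /airy_kernel_offdiag.
move: (Airy mu) (dAiry mu) (Airy nu) (dAiry nu) => a a' e e'.
by field; rewrite subr_eq0.
Qed.

Lemma edge_kernel_cvg0 mu :
  edge_norm mu mu N * (N`!%:R * herm_kernel N (edge_point N mu) (edge_point N mu)) @[N --> \oo] --> 0.
Proof.
have hl := inv_edge_scale_cvg; have um := @edge_herm_Airy mu; have vm := @edge_dherm_dAiry mu.
have N1 : \forall N \near \oo, (0 < N)%N by exact: nbhs_infty_gt.
have c (r : R) := seq_cst r.
have P1 := seqB (seqB (seqX (m := 2) hl) (seqM (c mu) hl)) (seqM (c (mu ^+ 2 / 4)) (seqX (m := 3) hl)).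
have L := seqD (seqM P1 (seqX (m := 2) um)) (seqM hl (seqX (m := 2) vm)).
set l := (X in _ --> X) in L.
rewrite [X in _ --> X](_ : _ = l).
  apply: cvg_trans L; apply: near_eq_cvg; apply: filterS N1 => N N0.
  by rewrite edge_kernel_diag.
by rewrite /l; move: (Airy mu) (dAiry mu) => a a'; ring.
Qed.

(** * Effect of the fourth cumulant *)

Section moment_error.
Variable b : R.
Let beta := (b - 3) / 2.
Let partial_exp (z : R) n : R := \sum_(k < n) z ^+ k / k`!%:R.

Let partial_exp_cvg z : partial_exp z n @[n --> \oo] --> expR z.
Proof.
have -> : partial_exp z = series (exp_coeff z).
  by apply/funext => n; rewrite /partial_exp /series /= big_mkord.
exact: (is_cvg_series_exp_coeff z).
Qed.

(** Under truncated subtraction the term of index [k] differs by at most [2 k], and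
    [k / k! = 1 / (k - 1)!] turns the sum of these errors into an exponential sum again. *)
Let moment_coef_err N j : (j < N.+1)%N ->
  `|moment_coef b N j - partial_exp beta N.+1 * (N.+1 - j)%:R| <= 2 * `|beta| * partial_exp `|beta| N.
Proof.
move=> jN; rewrite /moment_coef /partial_exp big_distrl /= -sumrB.
apply: le_trans (ler_norm_sum _ _ _) _.
rewrite big_ord_recl /= double0 subn0 subrr normr0 add0r mulr_sumr.
apply: ler_sum => k _; rewrite -mulrBr normrM -/beta.
rewrite /bump /= add1n normrM normfV normrX (ger0_norm (ler0n _ _)).
have -> : 2 * `|beta| * (`|beta| ^+ k / k`!%:R) = `|beta| ^+ k.+1 / k.+1`!%:R * (2 * k.+1%:R).
  rewrite exprS factS natrM; have : k`!%:R != 0 :> R by rewrite pnatr_eq0 -lt0n fact_gt0.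
  have : k.+1%:R != 0 :> R by rewrite pnatr_eq0.
  by move: (k`!%:R) (k.+1%:R) (`|beta|) => f m a m0 f0; field; rewrite m0 f0.
rewrite ler_wpM2l ?divr_ge0 ?exprn_ge0 // -natrM.
rewrite distrC -natrB ?ger0_norm ?ler_nat //; last by lia.
lia.
Qed.

(** The weight [t] is left free so that it can compensate the different normalizations at the two
    points. *)
Let herm_prod_amgm (t : R) j (x y : R) : 0 < t ->
  `|herm_prod j x y| <= (t * herm_prod j x x + t^-1 * herm_prod j y y) / 2.
Proof.
move=> t0; rewrite /herm_prod -!mulrA !normrM (ger0_norm (ler0n _ _)).
have -> : t * (j`!%:R * ((hermite_fact R j).[x] * (hermite_fact R j).[x]))
    + t^-1 * (j`!%:R * ((hermite_fact R j).[y] * (hermite_fact R j).[y])) =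
  j`!%:R * (t * ((hermite_fact R j).[x] * (hermite_fact R j).[x])
    + t^-1 * ((hermite_fact R j).[y] * (hermite_fact R j).[y])) by ring.
rewrite -mulrA ler_wpM2l // -normrM.
move: (_.[x]) (_.[y]) => p q.
have t1 : t * t^-1 = 1 by rewrite mulfV // gt_eqF.
have s1 : 0 <= t * (p - t^-1 * q) ^+ 2 by rewrite mulr_ge0 ?sqr_ge0 // ltW.
have s2 : 0 <= t * (p + t^-1 * q) ^+ 2 by rewrite mulr_ge0 ?sqr_ge0 // ltW.
have e1 : t * (p - t^-1 * q) ^+ 2 = t * (p * p) + t^-1 * (q * q) - 2 * (p * q).
  by field; rewrite gt_eqF.
have e2 : t * (p + t^-1 * q) ^+ 2 = t * (p * p) + t^-1 * (q * q) + 2 * (p * q).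
  by field; rewrite gt_eqF.
by move: s1 s2; rewrite e1 e2 ler_norml => ? ?; apply/andP; split; lra.
Qed.

(** Hermite products at two points may change sign, so their sum gives no bound; each is dominated
    by the diagonal ones, whose sums are the kernels of [edge_kernel_cvg0]. *)
Lemma edge_moment_err mu nu N : (0 < N)%N ->
  `|edge_norm mu nu N * (N`!%:R * \sum_(j < N.+1) moment_coef b N j
       * herm_prod j (edge_point N mu) (edge_point N nu))
    - partial_exp beta N.+1 *
      (edge_norm mu nu N * (N`!%:R * herm_kernel_sum N (edge_point N mu) (edge_point N nu)))|
  <= `|beta| * partial_exp `|beta| N *
     (edge_norm mu mu N * (N`!%:R * herm_kernel N (edge_point N mu) (edge_point N mu))
      + edge_norm nu nu N * (N`!%:R * herm_kernel N (edge_point N nu) (edge_point N nu))).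
Proof.
move=> N0; set x := edge_point N mu; set y := edge_point N nu.
set k := edge_scale N : R.
(* Chosen to turn the mixed normalization into [edge_norm mu mu] and, inverted, into
   [edge_norm nu nu]. *)
pose t : R := expR (- (mu * k)) / expR (- (nu * k)).
have t0 : 0 < t by rewrite divr_gt0 ?expR_gt0.
have nt : edge_norm mu nu N * t = edge_norm mu mu N.
  rewrite !edge_norm_weight // /t -/k.
  by field; rewrite !gt_eqF ?expR_gt0 ?edge_scale_gt0 // ltr0n fact_gt0.
have nt' : edge_norm mu nu N * t^-1 = edge_norm nu nu N.
  rewrite !edge_norm_weight // /t -/k.
  by field; rewrite !gt_eqF ?expR_gt0 ?edge_scale_gt0 // ltr0n fact_gt0.
have n0 : 0 <= edge_norm mu nu N.
  by rewrite /edge_norm invr_ge0 !mulr_ge0 ?sqrtr_ge0 ?powR_ge0 ?expR_ge0.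
pose C := 2 * `|beta| * partial_exp `|beta| N.
have C0 : 0 <= C.
  by rewrite !mulr_ge0 // sumr_ge0 // => i _; rewrite divr_ge0 ?exprn_ge0.
have -> : edge_norm mu nu N * (N`!%:R * \sum_(j < N.+1) moment_coef b N j * herm_prod j x y)
    - partial_exp beta N.+1 * (edge_norm mu nu N * (N`!%:R * herm_kernel_sum N x y)) =
  edge_norm mu nu N * (N`!%:R * \sum_(j < N.+1)
    (moment_coef b N j - partial_exp beta N.+1 * (N.+1 - j)%:R) * herm_prod j x y).
  under [in RHS]eq_bigr do rewrite mulrBl -mulrA.
  by rewrite sumrB -mulr_sumr -/(herm_kernel_sum N x y); ring.
rewrite normrM (ger0_norm n0) normrM (ger0_norm (ler0n _ _)).
apply: (@le_trans _ _ (edge_norm mu nu N * (N`!%:R *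
   (C * ((t * herm_kernel N x x + t^-1 * herm_kernel N y y) / 2))))).
  rewrite ler_wpM2l // ler_wpM2l //; apply: le_trans (ler_norm_sum _ _ _) _.
  rewrite /herm_kernel !mulr_sumr -big_split /= mulr_suml mulr_sumr; apply: ler_sum => j _.
  rewrite normrM; apply: ler_pM => //; first exact: moment_coef_err.
  exact: herm_prod_amgm.
rewrite le_eqVlt; apply/orP; left; apply/eqP; rewrite -nt -nt' /C.
by move: (herm_kernel _ _ _) (herm_kernel _ _ _) (partial_exp _ _) (t^-1) => u v w ti; field.
Qed.

Lemma edge_moment_cvg mu nu :
  edge_norm mu nu N * (N`!%:R * \sum_(j < N.+1) moment_coef b N j
       * herm_prod j (edge_point N mu) (edge_point N nu)) @[N --> \oo]
    --> expR beta * airy_kernel mu nu.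
Proof.
have pl : partial_exp beta N.+1 @[N --> \oo] --> expR beta.
  by have := @partial_exp_cvg beta; rewrite -(cvg_shiftS (partial_exp beta)).
have L := seqM pl (@edge_kernel_sum_cvg mu nu).
have E := seqM (seqM (seq_cst `|beta|) (@partial_exp_cvg `|beta|))
  (seqD (@edge_kernel_cvg0 mu) (@edge_kernel_cvg0 nu)).
rewrite addr0 mulr0 in E.
have L1 := seqB L E; have L2 := seqD L E; rewrite subr0 in L1; rewrite addr0 in L2.
apply: squeeze_cvgr L1 L2.
have N1 : \forall N \near \oo, (0 < N)%N by exact: nbhs_infty_gt.
apply: filterS N1 => N N0; have := edge_moment_err mu nu N0.
by rewrite ler_distl => /andP[? ?]; apply/andP; split; lra.
Qed.

End moment_error.
End edge_universality.

Theorem theorem1p3 (R : realType) (Q : probability R R) (b : R)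
    (Q_mean : (\int[Q]_x (x : R)%:E = 0)%E)
    (Q_var : (\int[Q]_x ((x : R) ^+ 2)%:E = 1)%E)
    (Q_fourth : (\int[Q]_x ((x : R) ^+ 4)%:E = b%:E)%E)
    (d : nat -> measure_display) (T : forall N : nat, measurableType (d N))
    (P : forall N : nat, probability (T N) R)
    (X : forall N : nat, 'I_N * 'I_N -> {RV (P N) >-> R})
    (X_iid : forall N : nat, (0 < N)%N -> iid_with_law (upper_index N) Q (X N))
    (mu nu : R) :
  edge_norm mu nu N * second_corr (X N) (edge_point N mu) (edge_point N nu)
    @[N --> \oo] --> expR ((b - 3) / 2) * airy_kernel mu nu.
Proof.
have L := @edge_moment_cvg R b mu nu.
apply: cvg_trans L; apply: near_eq_cvg.
(* The entries are i.i.d. by assumption for positive sizes, so the exact formula is applied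
   eventually. *)
have N1 : \forall N \near \oo, (0 < N)%N by exact: nbhs_infty_gt.
apply: filterS N1 => N N0.
by rewrite (second_corr_formula Q_mean Q_var Q_fourth _ _ (X_iid N N0)).
Qed.
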